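(* Let $P$ be a compact contractible polyhedron of dimension $2$ which admits a cover by two PL collapsible subpolyhedra. Then $P$ satisfies the Andrews–Curtis conjecture, that is, $P$ $3$-deforms to a point.
   Context: A polyhedron is the underlying topological space of some simplicial complex; a subpolyhedron $Q \subseteq P$ is the underlying space of a subcomplex of some triangulation of $P$. As usual in PL topology, all triangulations of a polyhedron are taken compatible with its PL structure. For a finite simplicial complex $K$, a simplex $\sigma$ is a free face if there is a unique simplex $\tau \in K$ properly containing $\sigma$; then there is an elementary collapse from $K$ to $K \setminus \{\sigma,\tau\}$. A complex $K$ collapses to $L$ if there is a finite sequence of elementary collapses from $K$ to $L$; $K$ is collapsible if it collapses to a single vertex. A polyhedron is PL collapsible if some triangulation of it is collapsible. There is an $n$-deformation from a finite complex $K$ to a finite complex $L$ ($K$ $n$-deforms to $L$) if there is a finite sequence of finite complexes $K_1 = K, K_2, \dots, K_r = L$, all of dimension at most $n$, such that for every $i$ one of $K_i, K_{i+1}$ is obtained from the other by an elementary collapse. A polyhedron $P$ $n$-deforms to a polyhedron $Q$ if some triangulation of $P$ $n$-deforms to some triangulation of $Q$. *)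

(* Defs.v *)
From HB Require Import structures.
From mathcomp Require Export all_boot all_order all_algebra finmap.
From mathcomp Require Export all_classical all_reals all_analysis.
Export numFieldNormedType.Exports.

Set Implicit Arguments.
Unset Strict Implicit.
Unset Printing Implicit Defensive.

Local Open Scope classical_set_scope.
Local Open Scope ring_scope.

(* Throughout, a simplex of R^d is given by its finite set of vertices, of type
   {fset 'rV[R]_d}, and a finite complex by its finite set of (nonempty)
   simplices. *)

Section Complexes.
Context {R : realType} {d : nat}.
Implicit Types (sigma tau rho : {fset 'rV[R]_d}) (K L : {fset {fset 'rV[R]_d}}).

(* The closed simplex spanned by sigma; empty when sigma is empty. *)
Definition hull sigma : set 'rV[R]_d :=
  [set x | exists w : 'rV[R]_d -> R,
    [/\ forall v, v \in sigma -> 0 <= w v,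
        \sum_(v <- sigma) w v = 1 &
        x = \sum_(v <- sigma) w v *: v]].

Definition affinely_independent sigma : Prop :=
  forall w : 'rV[R]_d -> R,
    \sum_(v <- sigma) w v = 0 -> \sum_(v <- sigma) w v *: v = 0 ->
    forall v, v \in sigma -> w v = 0.

(* As hull fset0 = set0, the last clause says that two simplices are either
   disjoint or meet in a common face. *)
Definition simplicial_complex K : Prop :=
  [/\ fset0 \notin K,
      forall sigma tau, sigma \in K -> (tau `<=` sigma)%fset -> tau != fset0 ->
        tau \in K,
      forall sigma, sigma \in K -> affinely_independent sigma &
      forall sigma tau, sigma \in K -> tau \in K ->
        hull sigma `&` hull tau = hull (sigma `&` tau)%fset].

Definition space K : set 'rV[R]_d :=
  [set x | exists2 sigma, sigma \in K & hull sigma x].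

Definition subcomplex L K : Prop := simplicial_complex L /\ (L `<=` K)%fset.

Definition complex_dim K : nat := \max_(sigma <- K) (#|` sigma|).-1.

Definition elementary_collapse K L : bool :=
  [exists sigma : K, exists tau : K,
    [&& val sigma `<` val tau,
        [forall rho : K, (val sigma `<` val rho) ==> (rho == tau)] &
        L == K `\` [fset val sigma; val tau]]]%fset.

Definition collapses K L : Prop :=
  exists2 s, path elementary_collapse K s & last K s = L.

Definition collapsible K : Prop :=
  exists v : 'rV[R]_d, collapses K [fset [fset v]]%fset.

Definition deforms n K L : Prop :=
  exists s : seq {fset {fset 'rV[R]_d}},
    [/\ forall M, M \in K :: s -> simplicial_complex M /\ (complex_dim M <= n)%N,
        path (fun M M' => elementary_collapse M M' || elementary_collapse M' M)
          K s &
        last K s = L].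

End Complexes.

Section Polyhedra.
Context {R : realType}.

(* Compact polyhedra are realized as subsets of some R^d. *)
Definition compact_polyhedron d (P : set 'rV[R]_d) : Prop :=
  exists2 K, simplicial_complex K & space K = P.

Definition affine_on d e (sigma : {fset 'rV[R]_d}) (f : 'rV[R]_d -> 'rV[R]_e) :=
  forall w : 'rV[R]_d -> R,
    (forall v, v \in sigma -> 0 <= w v) -> \sum_(v <- sigma) w v = 1 ->
    f (\sum_(v <- sigma) w v *: v) = \sum_(v <- sigma) w v *: f v.

(* f is piecewise linear on the compact polyhedron A; values of f outside A are
   irrelevant, and continuity on A is automatic. *)
Definition piecewise_linear d e (A : set 'rV[R]_d) (f : 'rV[R]_d -> 'rV[R]_e) :=
  exists K, [/\ simplicial_complex K, space K = A &
    forall sigma, sigma \in K -> affine_on sigma f].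

Definition pl_homeomorphism d e (A : set 'rV[R]_d) (B : set 'rV[R]_e)
    (f : 'rV[R]_d -> 'rV[R]_e) : Prop :=
  [/\ piecewise_linear A f, f @` A = B &
      exists2 g : 'rV[R]_e -> 'rV[R]_d,
        piecewise_linear B g & forall x, A x -> g (f x) = x].

(* The complex K may live in a Euclidean space other than that of P, and its
   simplices need not be mapped to straight simplices. *)
Definition triangulation d e (K : {fset {fset 'rV[R]_e}})
    (h : 'rV[R]_e -> 'rV[R]_d) (P : set 'rV[R]_d) : Prop :=
  simplicial_complex K /\ pl_homeomorphism (space K) P h.

Definition polyhedron_dim d (P : set 'rV[R]_d) (n : nat) : Prop :=
  exists e (K : {fset {fset 'rV[R]_e}}) h,
    triangulation K h P /\ complex_dim K = n.

Definition subpolyhedron d (Q P : set 'rV[R]_d) : Prop :=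
  exists e (K L : {fset {fset 'rV[R]_e}}) h,
    [/\ triangulation K h P, subcomplex L K & Q = h @` space L].

Definition pl_collapsible d (P : set 'rV[R]_d) : Prop :=
  exists e (K : {fset {fset 'rV[R]_e}}) h, triangulation K h P /\ collapsible K.

(* Any finite sequence of finite complexes can be realized on a common set of
   affinely independent vertices of some R^e, so asking all the complexes of a
   deformation to lie in one R^e, with e arbitrary, is no restriction. *)
Definition pl_deforms n d d' (P : set 'rV[R]_d) (Q : set 'rV[R]_d') : Prop :=
  exists e (K L : {fset {fset 'rV[R]_e}}) h k,
    [/\ triangulation K h P, triangulation L k Q & deforms n K L].

Definition contractible d (P : set 'rV[R]_d) : Prop :=
  exists x0 (H : 'rV[R]_d * R -> 'rV[R]_d),
    [/\ P x0,
        {within P `*` `[0, 1]%classic, continuous H},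
        forall x (t : R), P x -> 0 <= t <= 1 -> P (H (x, t)),
        forall x, P x -> H (x, 0) = x &
        forall x, P x -> H (x, 1) = x0].

End Polyhedra.

(* Main.v *)
Require Import Defs.
From mathcomp Require Import ring lra.
Import Order.TTheory GRing.Theory Num.Theory.

Set Implicit Arguments.
Unset Strict Implicit.
Unset Printing Implicit Defensive.

Local Open Scope classical_set_scope.
Local Open Scope ring_scope.

(* A complex of dimension at most 2 is collapsible exactly when it is connected, has
   H^1(-; Z/2) = 0, and every set of triangles has a free edge.  These properties
   pass to edge-stellar subdivisions and, in dimension 2, from any subdivision back
   to the complex.  Hence P has a triangulation K = K1 u K2 in which K1 and K2
   are collapsible complexes triangulating the two pieces of the cover.

   As P is contractible, H^1(K; Z/2) = H^2(K; Z/2) = 0 (simplicial approximation of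
   the contraction), so by Mayer-Vietoris K1 n K2 is connected with H^1 = 0; as it is
   a subcomplex of K1, it is collapsible too.  For a new vertex v,
   K expands to K u v*K2, because K2 is collapsible.  The latter collapses to
   K1 u v*(K1 n K2), removing the pairs (s, v*s) with s in K2 but not in K1, then to
   K1 because K1 n K2 is collapsible, and then to a point.  All these complexes
   have dimension at most 3. *)

(** * Elementary collapses and mod 2 cohomology *)

Section Combinatorial.
Local Open Scope nat_scope.
Local Open Scope fset_scope.
Context {V : choiceType}.
Implicit Types (s t rho : {fset V}) (K L : {fset {fset V}}) (x y z : V).

(** Collapsibility itself is awkward to carry through the argument: neither a subdivision nor a
    subcomplex of a collapsible complex is visibly collapsible. [tree_like] replaces it by
    conditions that can be tested. Free edges are demanded for all sets of triangles ([coreless])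
    instead of asking that H^2 vanish, because the dunce hat is acyclic and has no free edge. Being
    a condition on all sets of triangles, [coreless] is inherited by subcomplexes, so that only
    connectedness and H^1 of the intersection remain to be computed. Of two triangulations of one
    space, each has a stellar subdivision that refines the other; hence in dimension 2 [tree_like]
    depends on the space alone, and the given triangulations of the two pieces may be exchanged for
    subcomplexes of a common one. Subdivisions are generated by splitting single edges, where each
    condition can be checked directly, and cutting along hyperplanes produces enough of them.
    Coefficients mod 2 avoid orientations and reduce cochain identities to truth tables. *)

Definition face_closed K : Prop :=
  fset0 \notin K /\
  forall s t, s \in K -> t `<=` s -> t != fset0 -> t \in K.

Definition at_most_2dim K : Prop := forall s, s \in K -> #|` s| <= 3.

Definition edge_connected K : Prop :=
  (exists s, s \in K) /\
  forall g : V -> bool,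
    (forall s x y, s \in K -> x \in s -> y \in s -> g x = g y) ->
    forall s t x y, s \in K -> t \in K -> x \in s -> y \in t -> g x = g y.

(* Cochains mod 2 are functions of ordered tuples of vertices of a common simplex;
   degenerate tuples are allowed. *)
Definition cocycle1 K (a : V -> V -> bool) : Prop :=
  forall s x y z, s \in K -> x \in s -> y \in s -> z \in s ->
    a x y (+) a y z (+) a x z = false.

Definition cobounds1 K (a : V -> V -> bool) (g : V -> bool) : Prop :=
  forall s x y, s \in K -> x \in s -> y \in s -> a x y = g x (+) g y.

Definition cocycle2 K (b : V -> V -> V -> bool) : Prop :=
  forall s x y z w, s \in K -> x \in s -> y \in s -> z \in s -> w \in s ->
    b y z w (+) b x z w (+) b x y w (+) b x y z = false.

Definition cobounds2 K (b : V -> V -> V -> bool) (a : V -> V -> bool) : Prop :=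
  forall s x y z, s \in K -> x \in s -> y \in s -> z \in s ->
    b x y z = a x y (+) a y z (+) a x z.

Definition H1_trivial K : Prop :=
  forall a, cocycle1 K a -> exists g, cobounds1 K a g.

Definition H2_trivial K : Prop :=
  forall b, cocycle2 K b -> exists a, cobounds2 K b a.

(* S is to be read as the set of ordered triangles of a subcomplex without free edge. *)
Definition coreless K : Prop :=
  forall S : V -> V -> V -> Prop,
    (forall x y z, S x y z -> S y x z) ->
    (forall x y z, S x y z -> S x z y) ->
    (forall x y z, S x y z ->
       x != y /\ exists s, [/\ s \in K, x \in s, y \in s & z \in s]) ->
    (forall x y z, S x y z -> exists2 z', z' != z & S x y z') ->
    forall x y z, ~ S x y z.

Definition tree_like K : Prop :=
  [/\ face_closed K, at_most_2dim K, edge_connected K, H1_trivial K & coreless K].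

Definition free_pair K s t : Prop :=
  [/\ s \in K, t \in K, s `<` t &
      forall rho, rho \in K -> s `<` rho -> rho = t].

Lemma face_mem1 K s x : face_closed K -> s \in K -> x \in s -> [fset x] \in K.
Proof.
move=> [_ F] sK xs; apply: (F s) => //; first by rewrite fsub1set.
by apply/fset0Pn; exists x; rewrite inE.
Qed.

Lemma face_mem2 K s x y :
  face_closed K -> s \in K -> x \in s -> y \in s -> [fset x; y] \in K.
Proof.
move=> [_ F] sK xs ys; apply: (F s) => //.
  by apply/fsubsetP => q; rewrite !inE => /orP[] /eqP ->.
by apply/fset0Pn; exists x; rewrite !inE eqxx.
Qed.

Lemma face_mem3 K s x y z : face_closed K -> s \in K ->
  x \in s -> y \in s -> z \in s -> [fset x; y; z] \in K.
Proof.
move=> [_ F] sK xs ys zs; apply: (F s) => //.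
  by apply/fsubsetP => q; rewrite !inE => /orP[/orP[]|] /eqP ->.
by apply/fset0Pn; exists x; rewrite !inE eqxx.
Qed.

Lemma face_neq0 K s : face_closed K -> s \in K -> exists x, x \in s.
Proof. by move=> [n0 _] sK; apply/fset0Pn; apply: contraNneq n0 => <-. Qed.

Lemma card_fset3 x y z : x != y -> x != z -> y != z -> #|` [fset x; y; z]| = 3.
Proof.
move=> xy xz yz; rewrite [X in #|` X|]fsetUC cardfsU1 cardfs2 !inE xy.
by rewrite negb_or ![z == _]eq_sym xz yz.
Qed.

Lemma fset3_of_card_le3 s x y z : #|` s| <= 3 -> x \in s -> y \in s -> z \in s ->
  x != y -> x != z -> y != z -> s = [fset x; y; z].
Proof.
move=> s3 xs ys zs xy xz yz; apply/eqP; rewrite eq_sym eqEfcard card_fset3 // s3.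
by rewrite andbT; apply/fsubsetP => q; rewrite !inE => /orP[/orP[]|] /eqP ->.
Qed.

Lemma fset2_of_card_le2 s x y : #|` s| <= 2 -> x \in s -> y \in s ->
  x != y -> s = [fset x; y].
Proof.
move=> s3 xs ys xy; apply/eqP; rewrite eq_sym eqEfcard cardfs2 xy s3.
by rewrite andbT; apply/fsubsetP => q; rewrite !inE => /orP[] /eqP ->.
Qed.

Lemma card_gt2_distinct s : 2 < #|` s| ->
  exists x y z, [/\ x \in s, y \in s & z \in s] /\ [/\ x != y, x != z & y != z].
Proof.
move=> s3; have /fset0Pn[x xs] : s != fset0 by rewrite -cardfs_gt0 (ltn_trans _ s3).
rewrite (cardfsD1 x) xs ltnS in s3.
have /fset0Pn[y ys] : s `\ x != fset0 by rewrite -cardfs_gt0 ltnW.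
rewrite (cardfsD1 y) ys ltnS in s3.
have /fset0Pn[z zs] : (s `\ x) `\ y != fset0 by rewrite -cardfs_gt0.
move: ys zs; rewrite !inE => /andP[yx ys] /and3P[zy zx zs].
by exists x, y, z; split; split; rewrite // eq_sym.
Qed.

(** Adding to s one vertex of t outside s already gives a proper coface of s, which by uniqueness is
    t: a free face has codimension one. *)
Lemma free_pair_apex K s t : face_closed K -> free_pair K s t ->
  exists2 a, a \notin s & t = a |` s.
Proof.
move=> FK [sK tK st free].
have [a at_ as_] : exists2 a, a \in t & a \notin s.
  by apply/fsubsetPn; move: st; rewrite fproperE => /andP[].
exists a => //; apply/esym/free.
  apply: (FK.2 t) => //; last by apply/fset0Pn; exists a; rewrite !inE eqxx.
  by rewrite fsubUset fsub1set at_ fproper_sub.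
by rewrite fproperEneq fsubsetUr andbT; apply: contraNneq as_ => ->;
  rewrite !inE eqxx.
Qed.

Lemma mem_collapsed K s t rho : (rho \in K `\` [fset s; t]) =
  [&& rho != s, rho != t & rho \in K].
Proof. by rewrite !inE negb_or andbA. Qed.

Lemma free_pair_face_closed K s t : face_closed K -> free_pair K s t ->
  face_closed (K `\` [fset s; t]).
Proof.
move=> FK [sK tK st free]; split; first by rewrite mem_collapsed !negb_and FK.1 !orbT.
move=> r q; rewrite !mem_collapsed => /and3P[rs rt rK] qr q0.
rewrite (FK.2 _ _ rK qr q0) andbT; apply/andP; split.
  apply: contra_neq rt => qs; apply: free => //.
  by rewrite fproperEneq -qs qr andbT qs eq_sym.
apply: contra_neq rt => qt; apply: free => //.
by apply: fproper_sub_trans st _; rewrite -qt.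
Qed.

Section FreePair.
Context (K : {fset {fset V}}) (s t : {fset V}) (a : V).
Hypotheses (FK : face_closed K) (fp : free_pair K s t) (as_ : a \notin s)
  (tE : t = a |` s).
Let L := K `\` [fset s; t].

Let LK r : r \in L -> r \in K.
Proof. by rewrite mem_collapsed => /and3P[]. Qed.

Let s_notin r : r \in L -> ~~ (s `<=` r).
Proof.
rewrite mem_collapsed => /and3P[rs rt rK]; apply: contra_neqN rt => sr.
by case: fp => _ _ _; apply => //; rewrite fproperEneq sr eq_sym rs.
Qed.

Let KtoL r : r \in K -> r \in L \/ r `<=` t.
Proof.
move=> rK; case: (eqVneq r s) => [->|rs].
  by right; rewrite tE fsubsetUr.
case: (eqVneq r t) => [->|rt]; first by right.
by left; rewrite mem_collapsed rs rt.
Qed.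

Let at_ : a \in t. Proof. by rewrite tE !inE eqxx. Qed.
Let sK : s \in K. Proof. by case: fp. Qed.
Let tK : t \in K. Proof. by case: fp. Qed.

Let aL : [fset a] \in L.
Proof.
rewrite mem_collapsed (face_mem1 FK tK at_) andbT; apply/andP; split.
  by apply: contraNneq as_ => <-; rewrite inE.
have [b bs] := face_neq0 FK sK.
apply: contraNneq as_ => ta; have : b \in t by rewrite tE !inE bs orbT.
by rewrite -ta inE => /eqP <-.
Qed.

Let abL x : 1 < #|` s| -> x \in s -> [fset a; x] \in L.
Proof.
move=> s2 xs; have xt : x \in t by rewrite tE !inE xs orbT.
rewrite mem_collapsed (face_mem2 FK tK at_ xt) andbT; apply/andP; split.
  by apply: contraNneq as_ => <-; rewrite !inE eqxx.
apply: contraTneq s2 => ta; rewrite -leqNgt.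
have : #|` t| = #|` s|.+1 by rewrite tE cardfsU1 as_.
by rewrite -ta cardfs2; case: (_ != _) => -[<-].
Qed.

Let vertex_s : ~~ (1 < #|` s|) -> exists b, s = [fset b].
Proof.
move=> s2; have [b bs] := face_neq0 FK sK; exists b; apply/eqP.
by rewrite eq_sym eqEfcard fsub1set bs cardfs1 leqNgt.
Qed.

Let in_t x : x \in t -> x = a \/ x \in s.
Proof. by rewrite tE !inE => /orP[/eqP|]; [left|right]. Qed.

Lemma edge_connected_expand : edge_connected L -> edge_connected K.
Proof.
move=> [_ cL]; split; first by exists s.
move=> g gK.
have key r x : r \in K -> x \in r -> g x = g a.
  move=> rK xr; case: (KtoL rK) => [rL|rt].
    by apply: (cL g _ r [fset a]) => //; [move=> q u v /LK; exact: gK | rewrite inE].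
  by apply: (gK t) => //; exact: (fsubsetP rt).
by move=> r q x y rK qK xr yq; rewrite (key r) // (key q).
Qed.

Lemma edge_connected_collapse : edge_connected K -> edge_connected L.
Proof.
move=> [_ cK]; split; first by exists [fset a].
(* Giving s the value at the apex changes nothing on L: if s has several vertices, the edges from a
   to them lie in L; if s is a vertex, no simplex of L contains it. *)
move=> g gL; pose g' x := if x \in s then g a else g x.
have g'L r x : r \in L -> x \in r -> g' x = g x.
  rewrite /g' => rL xr; case: ifP => // xs.
  have [s2|/vertex_s[b sb]] := boolP (1 < #|` s|).
    by apply: (gL [fset a; x]); rewrite ?abL // !inE eqxx ?orbT.
  by have := s_notin rL; rewrite sb fsub1set; move: xs; rewrite sb inE => /eqP <-; rewrite xr.
have g't x : x \in t -> g' x = g a.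
  by move=> /in_t[->|xs]; rewrite /g' ?xs // (negPf as_).
have g'K r x y : r \in K -> x \in r -> y \in r -> g' x = g' y.
  move=> rK xr yr; case: (KtoL rK) => [rL|rt].
    by rewrite !(g'L r) //; exact: (gL r).
  by rewrite !g't //; exact: (fsubsetP rt).
move=> r q x y rL qL xr yq; rewrite -(g'L r) // -(g'L q) //.
by apply: (cK g' g'K r q) => //; exact: LK.
Qed.

(** On the single simplex t, the cone construction from the apex yields the primitive
    [g a (+) c a x]; it agrees with g on the part of t that belongs to L. *)
Lemma H1_trivial_expand : H1_trivial L -> H1_trivial K.
Proof.
move=> hL c cK; have [g gL] : exists g, cobounds1 L c g.
  by apply: hL => r x y z /LK; exact: cK.
exists (fun x => if x \in s then g a (+) c a x else g x).
set g' := (fun x => _).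
have caa : c a a = false by have := cK _ a a a tK at_ at_ at_; case: (c a a).
have g'L r x : r \in L -> x \in r -> g' x = g x.
  rewrite /g' => rL xr; case: ifP => // xs.
  have [s2|/vertex_s[b sb]] := boolP (1 < #|` s|).
    rewrite (gL [fset a; x]) ?abL ?inE ?eqxx ?orbT //.
    by case: (g a); case: (g x).
  by have := s_notin rL; rewrite sb fsub1set; move: xs; rewrite sb inE => /eqP <-; rewrite xr.
have g't x : x \in t -> g' x = g a (+) c a x.
  by move=> /in_t[->|xs]; rewrite /g' ?xs // (negPf as_) caa addbF.
move=> r x y rK xr yr; case: (KtoL rK) => [rL|rt].
  by rewrite !(g'L r) //; exact: (gL r).
have xt := fsubsetP rt _ xr; have yt := fsubsetP rt _ yr.
rewrite !g't //; have := cK _ a x y tK at_ xt yt.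
by case: (c a x) (c x y) (c a y) (g a) => [] [] [] [].
Qed.

(** A cocycle of L extends over t. If s is an edge, it receives the sum along the path through the
    apex; if s is a vertex, it has disappeared from L and the extension is zero there. By the
    dimension bound s has at most two vertices, so two distinct ones never share a simplex of L and
    no prescribed value is altered. *)
Lemma H1_trivial_collapse : at_most_2dim K -> H1_trivial K -> H1_trivial L.
Proof.
move=> K2 hK c cL.
have caa : c a a = false.
  by have := cL _ a a a aL (fset11 _) (fset11 _) (fset11 _); case: (c a a).
have [s2|/vertex_s[b sb]] := boolP (1 < #|` s|); last first.
  pose c' x y := [&& x != b, y != b & c x y].
  have c'L r x y : r \in L -> x \in r -> y \in r -> c' x y = c x y.
    move=> rL xr yr; rewrite /c'; have := s_notin rL; rewrite sb fsub1set => br.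
    by have [-> ->] : x != b /\ y != b by split; apply: contraNneq br => <-.
  have c't x y : x \in t -> y \in t -> c' x y = false.
    move=> /in_t[->|]; rewrite /c' ?sb ?inE; last by move=> /eqP ->; rewrite eqxx.
    move=> /in_t[->|]; rewrite /c' ?sb ?inE; last by move=> /eqP ->; rewrite eqxx andbF.
    by rewrite caa !andbF.
  have [g gK] : exists g, cobounds1 K c' g.
    apply: hK => r x y z rK xr yr zr; case: (KtoL rK) => [rL|rt].
      by rewrite !(c'L r) //; exact: (cL r).
    by rewrite !c't //; exact: (fsubsetP rt).
  by exists g => r x y rL xr yr; rewrite -(c'L r) //; apply: (gK r) => //; exact: LK.
have s2' : #|` s| <= 2 by have := K2 t tK; rewrite tE cardfsU1 as_.
have csym x : x \in t -> c x a = c a x.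
  move=> /in_t[-> //|xs]; have axL := abL s2 xs.
  have [ain xin] : a \in [fset a; x] /\ x \in [fset a; x] by rewrite !inE !eqxx orbT.
  have := cL _ a x a axL ain xin ain; rewrite caa.
  by case: (c a x) (c x a) => [] [].
pose c' x y := if (x \in s) && (y \in s) then c x a (+) c a y else c x y.
have c'L r x y : r \in L -> x \in r -> y \in r -> c' x y = c x y.
  move=> rL xr yr; rewrite /c'; case: ifP => // /andP[xs ys].
  have [xy|xy] := eqVneq x y; last first.
    have := s_notin rL; rewrite (fset2_of_card_le2 s2' xs ys xy).
    by move=> /fsubsetPn[q]; rewrite !inE => /orP[] /eqP ->; rewrite ?xr ?yr.
  rewrite -{}xy csym; last by rewrite tE !inE xs orbT.
  rewrite addbb; have := cL _ x x x rL xr xr xr; by case: (c x x).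
have c't x y : x \in t -> y \in t -> c' x y = c x a (+) c a y.
  move=> /in_t[->|xs] /in_t[->|ys]; rewrite /c' ?(negPf as_) ?xs ?ys ?caa ?andbF ?addbF //.
have [g gK] : exists g, cobounds1 K c' g.
  apply: hK => r x y z rK xr yr zr; case: (KtoL rK) => [rL|rt].
    by rewrite !(c'L r) //; exact: (cL r).
  have [xt yt zt] := And3 (fsubsetP rt _ xr) (fsubsetP rt _ yr) (fsubsetP rt _ zr).
  rewrite !c't // (csym y) //.
  by case: (c x a) (c a y) (c a z) => [] [] [].
by exists g => r x y rL xr yr; rewrite -(c'L r) //; apply: (gK r) => //; exact: LK.
Qed.

(** A core of K cannot use t: its edge s would lie in a second triangle of the core, although s is
    free. So every core of K lies in L. *)
Lemma coreless_expand : at_most_2dim K -> coreless L -> coreless K.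
Proof.
move=> K2 nL S S1 S2 SK Snext; apply: (nL S) => // x y z Sxyz.
have [xy [r [rK xr yr zr]]] := SK _ _ _ Sxyz; split=> //.
case: (KtoL rK) => [rL|rt]; first by exists r.
have [xz _] := SK _ _ _ (S2 _ _ _ Sxyz).
have [yz _] := SK _ _ _ (S2 _ _ _ (S1 _ _ _ Sxyz)).
have [xt yt zt] := And3 (fsubsetP rt _ xr) (fsubsetP rt _ yr) (fsubsetP rt _ zr).
have t3 := fset3_of_card_le3 (K2 _ tK) xt yt zt xy xz yz.
exfalso.
suff main p q : p \in s -> q \in s -> S p q a -> False.
  have ss u : u != a -> u \in t -> u \in s by move=> ua /in_t[ua'|//]; rewrite ua' eqxx in ua.
  move: (at_); rewrite {1}t3 !inE => /orP[/orP[]|] /eqP aE.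
  - by apply: (main y z); rewrite ?ss ?aE // 1?eq_sym //; apply: S2; apply: S1.
  - by apply: (main x z); rewrite ?ss ?aE // 1?eq_sym //; apply: S2.
  - by apply: (main x y); rewrite ?ss ?aE.
move=> ps qs Spqa; have [z' z'a Spqz'] := Snext _ _ _ Spqa.
have [pq [r' [r'K pr qr z'r]]] := SK _ _ _ Spqz'.
have [pz' _] := SK _ _ _ (S2 _ _ _ Spqz').
have [qz' _] := SK _ _ _ (S2 _ _ _ (S1 _ _ _ Spqz')).
have s2 : #|` s| <= 2 by have := K2 t tK; rewrite tE cardfsU1 as_.
have sE := fset2_of_card_le2 s2 ps qs pq.
have z's : z' \notin s by rewrite sE !inE negb_or ![z' == _]eq_sym pz'.
have r't : r' = t.
  case: fp => _ _ _; apply => //; rewrite fproperEneq; apply/andP; split.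
    by apply: contraNneq z's => ->.
  by rewrite sE; apply/fsubsetP => u; rewrite !inE => /orP[] /eqP ->.
by move: z'r; rewrite r't => /in_t[/eqP|]; rewrite ?(negPf z'a) ?(negPf z's).
Qed.

End FreePair.

Lemma coreless_sub K L : L `<=` K -> coreless K -> coreless L.
Proof.
move=> LK cK S S1 S2 SL Sn; apply: (cK S) => // x y z /SL[xy [s [sL xs ys zs]]].
by split=> //; exists s; split=> //; exact: (fsubsetP LK).
Qed.

Lemma tree_like_expand K s t : face_closed K -> at_most_2dim K -> free_pair K s t ->
  tree_like (K `\` [fset s; t]) -> tree_like K.
Proof.
move=> FK K2 fp [_ _ cL hL nL]; have [a as_ tE] := free_pair_apex FK fp.
split=> //; [exact: edge_connected_expand fp as_ tE cL|
  exact: H1_trivial_expand fp as_ tE hL|exact: coreless_expand fp as_ tE K2 nL].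
Qed.

Lemma tree_like_collapse K s t : free_pair K s t ->
  tree_like K -> tree_like (K `\` [fset s; t]).
Proof.
move=> fp [FK K2 cK hK nK]; have [a as_ tE] := free_pair_apex FK fp.
split; [exact: free_pair_face_closed| |exact: edge_connected_collapse fp as_ tE cK|
  exact: H1_trivial_collapse fp as_ tE K2 hK|apply: coreless_sub nK].
  by move=> r; rewrite mem_collapsed => /and3P[_ _]; exact: K2.
by apply/fsubsetP => r; rewrite mem_collapsed => /and3P[].
Qed.

Lemma tree_like_point x : tree_like [fset [fset x]].
Proof.
split.
- split=> [|s t]; rewrite ?inE.
    by apply/eqP => /fsetP/(_ x); rewrite !inE eqxx.
  move=> /eqP -> tx t0; case/fset0Pn: t0 => y yt.
  have := fsubsetP tx _ yt; rewrite inE => /eqP yx.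
  by rewrite eqEfsubset tx fsub1set -yx yt.
- by move=> s; rewrite inE => /eqP ->; rewrite cardfs1.
- split=> [|g _ s t y z]; first by exists [fset x]; rewrite inE.
  by rewrite !inE => /eqP -> /eqP ->; rewrite !inE => /eqP -> /eqP ->.
- move=> c cc; exists (fun=> false) => s y z; rewrite inE => /eqP ->.
  rewrite !inE => /eqP -> /eqP ->.
  by have := cc _ x x x (fset11 _) (fset11 _) (fset11 _) (fset11 _); case: (c x x).
- move=> S _ _ SK _ y z t /SK[yz [s []]]; rewrite inE => /eqP ->; rewrite !inE.
  by rewrite ?inE => /eqP yx /eqP zx; rewrite yx zx eqxx in yz.
Qed.

End Combinatorial.

(** * Collapsibility in dimension 2 *)

Section Combinatorial2.
Local Open Scope nat_scope.
Local Open Scope fset_scope.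
Context {V : choiceType}.
Implicit Types (s t rho : {fset V}) (K L : {fset {fset V}}) (x y z : V).

(** The set of all ordered triangles of K is nonempty, hence not a core; so some edge lies in
    exactly one triangle, and in dimension 2 such an edge is free. *)
Lemma coreless_free_pair K t : face_closed K -> at_most_2dim K -> coreless K ->
  t \in K -> 2 < #|` t| -> exists s t', free_pair K s t'.
Proof.
move=> FK K2 nK tK t3.
pose S x y z := [/\ x != y, x != z, y != z & [fset x; y; z] \in K].
have [x [y [z [[xy xz yz sK] Sz]]]] :
    exists x y z, S x y z /\ forall z', S x y z' -> z' = z.
  apply: contrapT => noS.
  have : exists x y z, S x y z.
    have [x [y [z [[xt yt zt] [xy xz yz]]]]] := card_gt2_distinct t3.
    by exists x, y, z; split=> //; exact: (face_mem3 FK tK xt yt zt).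
  move=> [x [y [z]]]; apply: (nK S) => {x y z}.
  - move=> x y z [xy xz yz sK]; split; rewrite ?(eq_sym y x) //.
    by rewrite [[fset y; x]]fsetUC.
  - move=> x y z [xy xz yz sK]; split; rewrite ?(eq_sym z y) //.
    by rewrite fsetUAC.
  - move=> x y z [xy xz yz sK]; split=> //; exists [fset x; y; z].
    by rewrite !inE !eqxx ?orbT.
  move=> x y z Sxyz; apply: contrapT => no; apply: noS; exists x, y, z; split=> // z' Sz'.
  by apply/eqP; apply: contrapT => z'z; apply: no; exists z' => //; apply/negP.
exists [fset x; y], [fset x; y; z]; split=> //.
- by apply: (face_mem2 FK sK); rewrite !inE eqxx ?orbT.
- rewrite fproperEneq fsubsetUl andbT; apply/eqP => /fsetP/(_ z).
  by rewrite !inE eqxx orbT ![z == _]eq_sym (negPf xz) (negPf yz).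
move=> rho rK; rewrite fproperE => /andP[xyr /fsubsetPn[z' z'r]].
rewrite !inE negb_or => /andP[z'x z'y].
have [xr yr] : x \in rho /\ y \in rho.
  by split; apply: (fsubsetP xyr); rewrite !inE eqxx ?orbT.
have rE : rho = [fset x; y; z'].
  by apply: fset3_of_card_le3 => //; [exact: K2|rewrite eq_sym|rewrite eq_sym].
by rewrite rE (Sz z') //; split; rewrite // 1?eq_sym // -rE.
Qed.

(** A graph has no triangles, so the indicator cochain of the edge ac is a cocycle. Its primitive
    changes value across ac only, which makes ac a bridge. *)
Lemma graph_edge_bridge K a c : face_closed K -> H1_trivial K ->
  (forall s, s \in K -> #|` s| <= 2) -> [fset a; c] \in K -> a != c ->
  exists2 g : V -> bool, g a != g c &
    forall x y, [fset x; y] \in K -> g x != g y ->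
      (x = a /\ y = c) \/ (x = c /\ y = a).
Proof.
move=> FK hK K1 acK ac.
pose e x y := ((x == a) && (y == c)) || ((x == c) && (y == a)).
have eK : cocycle1 K e.
  have exx x : e x x = false.
    by apply/negbTE/negP => /orP[] /andP[/eqP -> /eqP ca]; rewrite ca eqxx in ac.
  have esym x y : e x y = e y x by rewrite /e orbC [X in X || _]andbC [X in _ || X]andbC.
  move=> s x y z sK xs ys zs.
  have [->|xy] := eqVneq x y; first by rewrite exx /= addbb.
  have := fset2_of_card_le2 (K1 s sK) xs ys xy => sE.
  by move: zs; rewrite sE !inE => /orP[] /eqP ->; rewrite ?exx ?(esym y x) ?addbF ?addbb.
have [g gK] := hK _ eK; exists g.
  have := gK _ a c acK; rewrite !inE !eqxx orbT => /(_ isT isT).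
  by rewrite /e !eqxx /=; case: (g a); case: (g c).
move=> x y xyK gxy; have := gK _ x y xyK; rewrite !inE !eqxx orbT => /(_ isT isT).
have -> : g x (+) g y by case: (g x) (g y) gxy => [] [].
by move=> /orP[] /andP[/eqP -> /eqP ->]; [left|right].
Qed.

(* A side of a bridge with fewest vertices is a single vertex: otherwise
   another edge at its end point is a bridge cutting off a smaller side. *)
Lemma graph_leaf K (U : {fset V}) a c : face_closed K -> H1_trivial K ->
  (forall s, s \in K -> #|` s| <= 2) ->
  a \in U -> c \notin U -> [fset a; c] \in K ->
  (forall x y, x \in U -> y \notin U -> [fset x; y] \in K -> x = a /\ y = c) ->
  exists b d, [/\ b != d, [fset b; d] \in K &
    forall y, y != b -> [fset b; y] \in K -> y = d].
Proof.
move=> FK hK K1; have [n] := ubnP #|` U|.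
elim: n => // n IH in U a c * => Un aU cU acK Uac.
have ac : a != c by apply: contraNneq cU => <-.
have [leaf|] := pselect (forall y, y != a -> [fset a; y] \in K -> y = c).
  by exists a, c.
move=> /existsNP[b /not_implyP[ba /not_implyP[abK bc]]].
have bU : b \in U.
  by apply: contrapT => /negP bU; apply: bc; have [] := Uac a b aU bU abK.
have baK : [fset b; a] \in K by rewrite fsetUC.
have [g gba gbr] := graph_edge_bridge FK hK K1 baK ba.
(* The new side consists of the vertices of U on b's side of the bridge ab. It omits a, hence is
   smaller, and ab is its only exit because the one edge leaving U starts at a. *)
apply: (IH [fset x in U | g x == g b] b a).
- apply: leq_trans (fproper_ltn_card _) (_ : #|` U| <= n) => //.
  rewrite fproperE; apply/andP; split; first by apply/fsubsetP => x; rewrite !inE => /andP[].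
  by apply/fsubsetPn; exists a; rewrite ?inE //= eq_sym (negPf gba) andbF.
- by rewrite !inE /= bU eqxx.
- by rewrite !inE /= eq_sym (negPf gba) andbF.
- by [].
- move=> x y; rewrite !inE /= => /andP[xU /eqP gx]; rewrite negb_and => yU xyK.
  have [yU'|yU'] := boolP (y \in U); last first.
    by have [xa _] := Uac x y xU yU' xyK; move: gx gba; rewrite xa => ->; rewrite eqxx.
  rewrite yU' /= -gx in yU.
  rewrite eq_sym in yU; have [//|[xa _]] := gbr x y xyK yU.
  by move: gx gba; rewrite xa => ->; rewrite eqxx.
Qed.

(** As long as a triangle remains, [coreless] provides a free edge. Without triangles, any edge is a
    bridge and a leaf can be found behind it; without edges, connectedness leaves one vertex. *)
Lemma tree_like_free_pair K : tree_like K ->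
  (exists x, K = [fset [fset x]]) \/ exists s t, free_pair K s t.
Proof.
move=> [FK K2 [[r rK] cK] hK nK].
have [[t tK t3]|noT] := pselect (exists2 t, t \in K & 2 < #|` t|).
  by right; exact: coreless_free_pair tK t3.
have K1 s : s \in K -> #|` s| <= 2.
  by move=> sK; rewrite leqNgt; apply/negP => s3; apply: noT; exists s.
have [[s sK s2]|noE] := pselect (exists2 s, s \in K & 1 < #|` s|); last first.
  left; have [v vr] := face_neq0 FK rK; exists v.
  have pt s x : s \in K -> x \in s -> s = [fset x].
    move=> sK xs; apply/eqP; rewrite eq_sym eqEfcard fsub1set xs cardfs1 /=.
    by rewrite leqNgt; apply/negP => s2; apply: noE; exists s.
  apply/fsetP => s; rewrite inE; apply/idP/eqP => [sK|->]; last by rewrite -(pt r v).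
  have [x xs] := face_neq0 FK sK; rewrite (pt s x) //; congr fset1.
  have gK u q y z : u \in K -> y \in u -> z \in u -> (y == q) = (z == q).
    by move=> uK yu; rewrite (pt u y) // inE => /eqP ->.
  by apply/eqP; rewrite (cK (fun y => y == v) (fun u y z => gK u v y z) s r x v) ?eqxx.
right; have [a as_] := face_neq0 FK sK.
have /fset0Pn[c] : s `\ a != fset0.
  by rewrite -cardfs_gt0; rewrite (cardfsD1 a) as_ in s2.
rewrite !inE => /andP[ca cs].
have acK := face_mem2 FK sK as_ cs; rewrite eq_sym in ca.
have [g gac gbr] := graph_edge_bridge FK hK K1 acK ca.
pose U := [fset x in \bigcup_(s <- K) s | g x == g a].
have vertU q x : q \in K -> x \in q -> x \in \bigcup_(s <- K) s.
  by move=> qK xq; apply/bigfcupP; exists q; rewrite ?qK.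
have [|||b [d [bd bdK leaf]]] := graph_leaf (U := U) FK hK K1 _ _ acK.
- by rewrite !inE /= eqxx andbT; exact: vertU as_.
- by rewrite !inE /= eq_sym (negPf gac) andbF.
- move=> x y; rewrite !inE /= => /andP[_ /eqP gx] yU xyK.
  have gxy : g x != g y.
    move: yU; rewrite (vertU _ _ xyK) ?inE ?eqxx ?orbT //= gx eq_sym //.
  have [//|[xc _]] := gbr x y xyK gxy.
  by move: gac; rewrite -gx xc eqxx.
exists [fset b], [fset b; d]; split=> //.
- by apply: face_mem1 bdK _ => //; rewrite !inE eqxx.
- rewrite fproperEneq fsubsetUl andbT; apply/eqP => /fsetP/(_ d).
  by rewrite !inE eqxx orbT eq_sym (negPf bd).
move=> rho rK'; rewrite fproperE fsub1set => /andP[br /fsubsetPn[y yr]].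
rewrite inE => yb; have yd : y = d by apply: leaf => //; exact: face_mem2 rK' br yr.
by rewrite -yd; apply: fset2_of_card_le2 => //; [exact: K1|rewrite eq_sym].
Qed.

(** * The Mayer-Vietoris argument for an intersection *)

Section MayerVietoris.
Context (K1 K2 : {fset {fset V}}).
Hypotheses (F1 : face_closed K1) (F2 : face_closed K2).
Let K := K1 `|` K2.
Let L := K1 `&` K2.

Lemma face_closedI : face_closed L.
Proof.
split=> [|s t]; first by rewrite inE (negPf F1.1).
by rewrite !inE => /andP[s1 s2] ts t0; rewrite (F1.2 s) // (F2.2 s).
Qed.

Let mem2L s x y : s \in K1 `|` K2 -> s \notin K1 -> x \in s -> y \in s ->
  [fset x; y] \in K1 -> [fset x; y] \in L.
Proof.
move=> sK s1 xs ys xy1; rewrite inE xy1.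
by apply: face_mem2 xs ys => //; move: sK; rewrite inE (negPf s1).
Qed.

Let mem3L s x y z : s \in K1 `|` K2 -> s \notin K1 ->
  x \in s -> y \in s -> z \in s ->
  [fset x; y; z] \in K1 -> [fset x; y; z] \in L.
Proof.
move=> sK s1 xs ys zs xy1; rewrite inE xy1.
by apply: face_mem3 xs ys zs => //; move: sK; rewrite inE (negPf s1).
Qed.

(** This is the connecting homomorphism from H^0 of the intersection to H^1 of the union. For g
    locally constant on L, the cochain c equal to the coboundary of g on K1 and to 0 on K2 is a
    cocycle. Its primitive f is constant on K2, while f + g is constant on K1; so g is constant on
    L. *)
Lemma edge_connected_cap : edge_connected K -> H1_trivial K ->
  edge_connected K1 -> edge_connected K2 -> edge_connected L.
Proof.
move=> [_ cK] hK [[r1 r1K] c1] [[r2 r2K] c2]; split.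
  apply: contrapT => L0.
  (* If the intersection were empty, being a vertex of K1 would be constant on every simplex and
     would disconnect the union. *)
  pose g x := `[< exists2 s, s \in K1 & x \in s >].
  have [[x1 x1r] [x2 x2r]] := (face_neq0 F1 r1K, face_neq0 F2 r2K).
  have g1 s x : s \in K1 -> x \in s -> g x by move=> ? ?; apply/asboolP; exists s.
  have g2 s x : s \in K2 -> x \in s -> g x = false.
    move=> sK xs; apply/asboolP => -[t tK xt]; apply: L0; exists [fset x].
    by rewrite inE (face_mem1 F1 tK) // (face_mem1 F2 sK).
  have := cK g _ r1 r2 x1 x2; rewrite !inE r1K r2K orbT => /(_ _ isT isT x1r x2r).
  rewrite (g1 r1) // (g2 r2) // => H; suff: true = false by [].
  apply: H => s x y; rewrite inE => /orP[] sK xs ys.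
    by rewrite !(g1 s).
  by rewrite !(g2 s).
move=> g gL.
pose c x y := ([fset x; y] \in K1) && (g x (+) g y).
have c0 s x y : s \in K -> s \notin K1 -> x \in s -> y \in s -> c x y = false.
  move=> sK s1 xs ys; apply/negbTE/negP => /andP[xy1].
  rewrite (gL _ x y (mem2L sK s1 xs ys xy1)) ?addbb // !inE eqxx ?orbT //.
have [f fK] : exists f, cobounds1 K c f.
  apply: hK => s x y z sK xs ys zs; have [s1|s1] := boolP (s \in K1); last first.
    by rewrite !(c0 s).
  rewrite /c !(face_mem2 F1 s1) //=.
  by case: (g x) (g y) (g z) => [] [] [].
move=> s t x y; rewrite !inE => /andP[s1 s2] /andP[t1 t2] xs yt.
have fxy : f x = f y.
  apply: (c2 f _ s t) => // q u v qK uq vq.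
  have qK' : q \in K by rewrite inE qK orbT.
  have := fK q u v qK' uq vq; rewrite /c.
  have [uvK|uvK] := boolP ([fset u; v] \in K1).
    rewrite (gL [fset u; v] u v) ?inE ?eqxx ?orbT ?uvK ?(face_mem2 F2 qK) // addbb /=.
    by case: (f u); case: (f v).
  by case: (f u); case: (f v).
have : g x (+) f x = g y (+) f y.
  apply: (c1 (fun x => g x (+) f x) _ s t) => // q u v qK uq vq.
  have qK' : q \in K by rewrite inE qK.
  have := fK q u v qK' uq vq; rewrite /c (face_mem2 F1 qK) //=.
  by case: (f u) (f v) (g u) (g v) => [] [] [] [].
by rewrite fxy; case: (f y); case: (g x); case: (g y).
Qed.

(** The same construction one degree higher: c is extended by zero to c', and its coboundary on K1,
    set to 0 on K2, is a 2-cocycle of the union with a primitive a. Then c' + a is a cocycle on K1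
    and a is one on K2; the sum of their primitives g1 and g2 is a primitive of c on L. *)
Lemma H1_trivial_cap : H2_trivial K ->
  H1_trivial K1 -> H1_trivial K2 -> H1_trivial L.
Proof.
move=> hK h1 h2 c cL.
pose c' x y := ([fset x; y] \in L) && c x y.
have c'L s x y : s \in L -> x \in s -> y \in s -> c' x y = c x y.
  by move=> sL xs ys; rewrite /c' (face_mem2 face_closedI sL).
pose dc x y z := c' x y (+) c' y z (+) c' x z.
pose b x y z := ([fset x; y; z] \in K1) && dc x y z.
have dcL s x y z : s \in L -> x \in s -> y \in s -> z \in s -> dc x y z = false.
  by move=> sL xs ys zs; rewrite /dc !(c'L s) //; exact: (cL s).
have b0 s x y z : s \in K -> s \notin K1 -> x \in s -> y \in s -> z \in s ->
    b x y z = false.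
  move=> sK s1 xs ys zs; apply/negbTE/negP => /andP[xyz1].
  by rewrite (dcL _ x y z (mem3L sK s1 xs ys zs xyz1)) // !inE eqxx ?orbT.
have [a aK] : exists a, cobounds2 K b a.
  apply: hK => s x y z w sK xs ys zs ws; have [s1|s1] := boolP (s \in K1); last first.
    by rewrite !(b0 s).
  rewrite /b !(face_mem3 F1 s1) //= /dc.
  by case: (c' x y) (c' x z) (c' x w) (c' y z) (c' y w) (c' z w) => [] [] [] [] [] [].
have [g1 g1K] : exists g, cobounds1 K1 (fun x y => c' x y (+) a x y) g.
  apply: h1 => s x y z s1 xs ys zs; have sK : s \in K by rewrite inE s1.
  have := aK s x y z sK xs ys zs; rewrite /b (face_mem3 F1 s1) //= /dc.
  by case: (c' x y) (c' x z) (c' y z) (a x y) (a x z) (a y z) => [] [] [] [] [] [].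
have [g2 g2K] : exists g, cobounds1 K2 a g.
  apply: h2 => s x y z s2 xs ys zs; have sK : s \in K by rewrite inE s2 orbT.
  rewrite -(aK s) // /b; have [xyz1|//] := boolP (_ \in K1).
  rewrite (dcL [fset x; y; z]) ?inE ?eqxx ?orbT ?xyz1 //.
  exact: (face_mem3 F2 s2).
exists (fun x => g1 x (+) g2 x) => s x y sL xs ys.
move: (sL); rewrite inE => /andP[s1 s2].
have := g1K s x y s1 xs ys; rewrite (g2K s) // (c'L s) //.
by case: (c x y) (g1 x) (g1 y) (g2 x) (g2 y) => [] [] [] [] [].
Qed.

End MayerVietoris.

Lemma tree_like_cap K1 K2 : edge_connected (K1 `|` K2) ->
  H1_trivial (K1 `|` K2) -> H2_trivial (K1 `|` K2) ->
  tree_like K1 -> tree_like K2 -> tree_like (K1 `&` K2).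
Proof.
move=> cK h1K h2K [F1 D1 c1 h1 n1] [F2 D2 c2 h2 n2]; split.
- exact: face_closedI.
- by move=> s; rewrite inE => /andP[+ _]; exact: D1.
- exact: edge_connected_cap.
- exact: H1_trivial_cap.
- by apply: coreless_sub n1; exact: fsubsetIl.
Qed.

End Combinatorial2.

(** * Images of complexes under injective vertex maps *)

Definition map_complex (V W : choiceType) (f : V -> W) (K : {fset {fset V}}) :
  {fset {fset W}} := [fset f @` (s : {fset V}) | s in K]%fset.

Section Transport.
Local Open Scope nat_scope.
Local Open Scope fset_scope.
Context {V W : choiceType} (f : V -> W) (h : W -> V) (K : {fset {fset V}}).
Hypothesis fK : forall s x, s \in K -> x \in s -> h (f x) = x.
Let M := map_complex f K.

Lemma map_complexP r : reflect (exists2 s, s \in K & r = f @` s) (r \in M).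
Proof. by apply: (iffP (imfsetP _ _ _ _)) => -[s sK ->]; exists s. Qed.

Lemma map_complex_face_closed : face_closed K -> face_closed M.
Proof.
move=> FK; split.
  apply/negP => /map_complexP[s sK /esym/eqP]; have [x xs] := face_neq0 FK sK.
  by apply/negP/fset0Pn; exists (f x); rewrite in_imfset.
move=> _ t /map_complexP[s sK ->] ts t0; apply/map_complexP.
exists [fset x in s | f x \in t].
  apply: (FK.2 s) => //; first by apply/fsubsetP => x; rewrite !inE => /andP[].
  case/fset0Pn: t0 => y yt; have /imfsetP[x /= xs yE] := fsubsetP ts _ yt.
  by apply/fset0Pn; exists x; rewrite !inE /= xs -yE.
apply/fsetP => y; apply/idP/imfsetP => [yt|[x /=]].
  have /imfsetP[x /= xs yE] := fsubsetP ts _ yt.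
  by exists x => //=; rewrite !inE /= xs -yE.
by rewrite !inE => /andP[_ + ->].
Qed.

Lemma card_map_face s : s \in K -> #|` f @` s| = #|` s|.
Proof.
by move=> sK; apply: card_in_imfset => x y /= xs ys /(congr1 h); rewrite !(fK sK).
Qed.

Lemma tree_like_map : tree_like K -> tree_like M.
Proof.
move=> [FK K2 [[r rK] cK] hK nK]; split.
- exact: map_complex_face_closed.
- by move=> _ /map_complexP[s sK ->]; rewrite card_map_face //; exact: K2.
- split; first by exists (f @` r); apply/map_complexP; exists r.
  move=> g gM _ _ x' y' /map_complexP[s sK ->] /map_complexP[t tK ->].
  move=> /imfsetP[x /= xs ->{x'}] /imfsetP[y /= yt ->{y'}].
  apply: (cK (g \o f) _ s t) => // q u v qK uq vq /=.
  by apply: (gM (f @` q)); rewrite ?in_imfset //; apply/map_complexP; exists q.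
- move=> c cM; have [g gK] : exists g, cobounds1 K (fun x y => c (f x) (f y)) g.
    apply: hK => s x y z sK xs ys zs.
    have sM : f @` s \in M by apply/map_complexP; exists s.
    by apply: (cM _ _ _ _ sM); rewrite in_imfset.
  exists (g \o h); move=> r' x' y' /map_complexP[s sK ->{r'}].
  move=> /imfsetP[x /= xs ->{x'}] /imfsetP[y /= ys ->{y'}].
  by rewrite !(fK sK) //; exact: (gK s).
- move=> S S1 S2 SM Sn x y z Sxyz.
  pose T x y z := S (f x) (f y) (f z) /\ (exists s, [/\ s \in K, x \in s, y \in s & z \in s]).
  have lift u v w : S u v w -> T (h u) (h v) (h w).
    move=> Suvw; have [uv [_ [/map_complexP[s sK ->]]]] := SM _ _ _ Suvw.
    move=> /imfsetP[x' /= xs ?] /imfsetP[y' /= ys ?] /imfsetP[z' /= zs ?].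
    by subst; rewrite !(fK sK) //; split=> //; exists s.
  move: (h x) (h y) (h z) (lift _ _ _ Sxyz); clear x y z Sxyz; apply: nK => x y z.
  + by move=> [Sxyz [s []]]; split; [exact: S1|exists s].
  + by move=> [Sxyz [s []]]; split; [exact: S2|exists s].
  + move=> [Sxyz H]; split=> //; have [fxy _] := SM _ _ _ Sxyz.
    by apply: contra_neq fxy => ->.
  + move=> [Sxyz [s [sK xs ys zs]]]; have [w wz Sxyw] := Sn _ _ _ Sxyz.
    have := lift _ _ _ Sxyw; rewrite !(fK sK) // => T'; exists (h w) => //.
    apply: contra_neq wz => hw; have [_ [_ [/map_complexP[q qK ->]]]] := SM _ _ _ Sxyw.
    by move=> _ _ /imfsetP[w' /= w'q wE]; rewrite -hw wE (fK qK).
Qed.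

End Transport.

(** * Barycentric coordinates and affine forms *)

Section Barycentric.
Local Open Scope fset_scope.
Local Open Scope ring_scope.
Context {R : realType} {d : nat}.
Implicit Types (s t : {fset 'rV[R]_d}) (K : {fset {fset 'rV[R]_d}}).
Implicit Types (u v x y p : 'rV[R]_d) (w : 'rV[R]_d -> R).

(** In contrast to [hull], the weights vanish outside s, so coordinates taken in different simplices
    can be compared as functions. *)
Definition barycentric s w x : Prop :=
  [/\ forall v, 0 <= w v, forall v, v \notin s -> w v = 0,
      \sum_(v <- s) w v = 1 & \sum_(v <- s) w v *: v = x].

(** For a face-closed K this single condition replaces affine independence and the intersection
    condition together; it is easier to transfer to subdivisions, images and cones. *)
Definition unique_coordinates K : Prop :=
  forall s t w w' x, s \in K -> t \in K ->
    barycentric s w x -> barycentric t w' x -> w = w'.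

Lemma hullP s x : hull s x <-> exists w, barycentric s w x.
Proof.
split=> [[w [w0 w1 ->]]|[w [w0 _ w1 <-]]]; last by exists w.
have E (M : lmodType R) (f : 'rV[R]_d -> M) :
    \sum_(v <- s) (if v \in s then w v else 0) *: f v = \sum_(v <- s) w v *: f v.
  by apply: eq_big_seq => v ->.
exists (fun v => if v \in s then w v else 0); split=> [v|v /negPf -> //||].
- by case: ifP => // /w0.
- by have := E R^o (fun=> 1); under eq_bigr do rewrite [_ *: _]mulr1;
    under [in RHS]eq_bigr do rewrite [_ *: _]mulr1; rewrite w1.
- exact: E.
Qed.

Lemma barycentric_carrier s t w x : (forall v, w v != 0 -> v \in t) ->
  barycentric s w x -> barycentric t w x.
Proof.
move=> wt [w0 ws w1 wx]; have wt' v : v \notin t -> w v = 0.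
  by move=> vt; apply: contraNeq vt => /wt.
split=> //.
- rewrite -w1 (big_fset_incl _ (fsubsetUl t s)) ?(big_fset_incl _ (fsubsetUr t s)) //.
  + by move=> v _ /ws.
  + by move=> v _ /wt'.
- rewrite -wx (big_fset_incl _ (fsubsetUl t s)) ?(big_fset_incl _ (fsubsetUr t s)) //.
  + by move=> v _ /ws ->; rewrite scale0r.
  + by move=> v _ /wt' ->; rewrite scale0r.
Qed.

Lemma barycentric_support s w x v : barycentric s w x -> w v != 0 -> v \in s.
Proof. by move=> [_ ws _ _]; apply: contra_neqT => /ws. Qed.

Lemma barycentric_sub s t w x : s `<=` t -> barycentric s w x -> barycentric t w x.
Proof.
move=> st wx; apply: (barycentric_carrier _ wx) => v /(barycentric_support wx).
exact: (fsubsetP st).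
Qed.

Lemma barycentric_neq0 s w x : barycentric s w x -> exists2 v, v \in s & 0 < w v.
Proof.
move=> [w0 ws w1 _]; apply: contrapT => no.
have : \sum_(v <- s) w v = 0.
  rewrite big_seq big1 // => v vs; apply/eqP; rewrite eq_le w0 andbT leNgt.
  by apply/negP => wv; apply: no; exists v.
by rewrite w1 => /eqP; rewrite oner_eq0.
Qed.

Lemma barycentric_point v : barycentric [fset v] (fun u => (u == v)%:R) v.
Proof.
split=> [u|u|| ]; first by rewrite ler0n.
- by rewrite inE => /negPf ->.
- by rewrite big_seq_fset1 eqxx.
- by rewrite big_seq_fset1 eqxx scale1r.
Qed.

Lemma hull_vertex s v : v \in s -> hull s v.
Proof.
move=> vs; apply/hullP; exists (fun u => (u == v)%:R).
by apply: barycentric_sub (barycentric_point v); rewrite fsub1set.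
Qed.

Lemma barycentric_comp s t w x (c : 'rV[R]_d -> 'rV[R]_d -> R) :
  barycentric s w x -> (forall v, v \in s -> barycentric t (c v) v) ->
  barycentric t (fun u => \sum_(v <- s) w v * c v u) x.
Proof.
move=> [w0 ws w1 wx] ct; split=> [u|u ut||].
- rewrite big_seq; apply: sumr_ge0 => v vs; apply: mulr_ge0 => //.
  by have [] := ct v vs.
- rewrite big_seq big1 // => v vs; have [_ -> //] := ct v vs.
  by rewrite mulr0.
- rewrite exchange_big /= -w1; apply: eq_big_seq => v vs.
  by rewrite -mulr_sumr; have [_ _ -> _] := ct v vs; rewrite mulr1.
- rewrite -wx; under eq_bigr do rewrite scaler_suml.
  rewrite exchange_big /=; apply: eq_big_seq => v vs.
  under eq_bigr do rewrite -scalerA.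
  by rewrite -scaler_sumr; have [_ _ _ ->] := ct v vs.
Qed.

Lemma hull_trans s t x : (forall v, v \in s -> hull t v) -> hull s x -> hull t x.
Proof.
move=> st /hullP[w wx].
have /choice[c cP] : forall v, exists w', v \in s -> barycentric t w' v.
  move=> v; have [/st/hullP[w' w'v]|] := boolP (v \in s); first by exists w'.
  by exists w.
by apply/hullP; eexists; exact: (barycentric_comp wx cP).
Qed.

Lemma hull_sub s t x : s `<=` t -> hull s x -> hull t x.
Proof. by move=> /fsubsetP st; apply: hull_trans => v /st; exact: hull_vertex. Qed.

Lemma barycentric_convex s w w' x y (a : R) : 0 <= a <= 1 ->
  barycentric s w x -> barycentric s w' y ->
  barycentric s (fun v => (1 - a) * w v + a * w' v) ((1 - a) *: x + a *: y).
Proof.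
move=> /andP[a0 a1] [w0 ws w1 wx] [w0' ws' w1' wx']; split=> [v|v vs||].
- by rewrite addr_ge0 // mulr_ge0 // subr_ge0.
- by rewrite ws // ws' // !mulr0 addr0.
- by rewrite big_split /= -!mulr_sumr w1 w1' !mulr1 subrK.
- under eq_bigr do rewrite scalerDl -!scalerA.
  by rewrite big_split /= -!scaler_sumr wx wx'.
Qed.

Lemma hull_convex s x y (a : R) : 0 <= a <= 1 -> hull s x -> hull s y ->
  hull s ((1 - a) *: x + a *: y).
Proof.
move=> a01 /hullP[w wx] /hullP[w' wy]; apply/hullP; eexists.
exact: barycentric_convex a01 wx wy.
Qed.

Lemma affinely_independent_coordinates s w w' x : affinely_independent s ->
  barycentric s w x -> barycentric s w' x -> w = w'.
Proof.
move=> si [_ ws w1 wx] [_ ws' w1' wx']; apply/funext => v.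
have [vs|vs] := boolP (v \in s); last by rewrite ws // ws'.
apply/eqP; rewrite -subr_eq0; apply/eqP.
apply: (si (fun u => w u - w' u)) => //; first by rewrite sumrB w1 w1' subrr.
by under eq_bigr do rewrite scalerBl; rewrite sumrB wx wx' subrr.
Qed.

Definition barycenter_weight s : 'rV[R]_d -> R :=
  fun v => if v \in s then #|` s|%:R^-1 else 0.

Lemma barycentric_barycenter s : s != fset0 ->
  barycentric s (barycenter_weight s) (\sum_(v <- s) barycenter_weight s v *: v).
Proof.
rewrite -cardfs_gt0 => s0; rewrite /barycenter_weight; split=> [v|v /negPf -> //||//].
  by case: ifP.
rewrite big_seq; under eq_bigr => v vs do rewrite vs.
rewrite -big_seq big_const_seq count_predT iter_addr_0 -[X in X = _]mulr_natr mulVf //.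
by rewrite pnatr_eq0 -lt0n.
Qed.

(** From right to left, an affine dependence, scaled down, perturbs the coordinates of the
    barycenter into other coordinates of the same point. Two simplices meet in their common face
    because the coordinates of a common point are supported in both. *)
Lemma simplicial_complexP K :
  simplicial_complex K <-> face_closed K /\ unique_coordinates K.
Proof.
split=> [[K0 KF Ki KI]|[FK KU]].
  split=> [|s t w w' x sK tK wx w'x]; first by split.
  have : hull (s `&` t) x.
    by rewrite -KI //; split; apply/hullP; [exists w|exists w'].
  move=> /hullP[c cx].
  rewrite (affinely_independent_coordinates (Ki _ sK) wx (barycentric_sub (fsubsetIl _ _) cx)).
  by rewrite (affinely_independent_coordinates (Ki _ tK) w'x (barycentric_sub (fsubsetIr _ _) cx)).
split; [exact: FK.1|exact: FK.2| |].
  move=> s sK w w0 wx v vs.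
  have s0 : s != fset0 by apply: contraNneq FK.1 => <-.
  have n0 : (0 : R) < #|` s|%:R^-1 by rewrite invr_gt0 ltr0n cardfs_gt0.
  (* M is positive and bounds every weight of the dependence, so adding e = 1 / (#|[s| M) times that
     dependence keeps the weights 1 / #|] s| of the barycenter nonnegative. *)
  pose M := 1 + \sum_(u <- s) `|w u|.
  have M0 : 0 < M by rewrite ltr_pwDl // sumr_ge0.
  have Mw u : u \in s -> `|w u| <= M.
    move=> us; rewrite /M (big_fsetD1 u) //= addrCA lerDl addr_ge0 //.
    by rewrite sumr_ge0.
  pose e := (#|` s|%:R * M)^-1.
  have e0 : 0 < e by rewrite invr_gt0 mulr_gt0 // ltr0n cardfs_gt0.
  have bb := barycentric_barycenter s0.
  set b := (X in barycentric _ _ X) in bb.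
  have : barycentric s (fun u => barycenter_weight s u + if u \in s then e * w u else 0) b.
    case: bb => b0 bs b1 bx; split=> [u|u us||].
    - rewrite /barycenter_weight; case: ifP => us; rewrite ?addr0 //.
      have : `|e * w u| <= #|` s|%:R^-1.
        rewrite normrM gtr0_norm // /e invfM -mulrA ler_piMr //.
        by rewrite ler_pdivrMl // mulr1 Mw.
      by rewrite ler_norml => /andP[+ _]; rewrite -subr_ge0 opprK addrC.
    - by rewrite bs // (negPf us) addr0.
    - rewrite big_split /= b1 big_seq; under eq_bigr => u us do rewrite us.
      by rewrite -big_seq -mulr_sumr w0 mulr0 addr0.
    - under eq_bigr do rewrite scalerDl; rewrite big_split /= bx.
      rewrite [X in _ + X](_ : _ = 0) ?addr0 // big_seq.
      under eq_bigr => u us do rewrite us -scalerA.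
      by rewrite -big_seq -scaler_sumr wx scaler0.
  move=> /(KU _ _ _ _ _ sK sK bb)/(congr1 (@^~ v)) /=.
  rewrite vs => /eqP.
  rewrite -subr_eq0 opprD addrA subrr add0r oppr_eq0 mulf_eq0 (gt_eqF e0) /=.
  by move=> /eqP.
move=> s t sK tK; apply/seteqP; split=> x.
  move=> [/hullP[w wx] /hullP[w' w'x]]; apply/hullP; exists w.
  apply: (barycentric_carrier _ wx) => v wv; rewrite inE (barycentric_support wx wv).
  by move: wv; rewrite (KU _ _ _ _ _ sK tK wx w'x) => /(barycentric_support w'x).
by move=> xst; split; apply: hull_sub xst; [exact: fsubsetIl|exact: fsubsetIr].
Qed.

Definition affine_form (f : 'cV[R]_d * R) x : R := (x *m f.1) 0 0 + f.2.

Lemma affine_form_barycentric f s w x : barycentric s w x ->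
  affine_form f x = \sum_(v <- s) w v * affine_form f v.
Proof.
move=> [_ _ w1 <-]; rewrite /affine_form mulmx_suml summxE.
under [in RHS]eq_bigr do rewrite mulrDr.
rewrite big_split /= -mulr_suml w1 mul1r; congr (_ + _).
by apply: eq_bigr => v _; rewrite -scalemxAl mxE.
Qed.

Definition sign_coherent K f : Prop :=
  forall s x y, s \in K -> x \in s -> y \in s ->
    affine_form f x < 0 -> 0 < affine_form f y -> False.

(** If a vertex of positive weight had a negative value, coherence would make all values on s
    nonpositive, and their mean at x would be negative. *)
Lemma sign_coherent_ge0 K f s w x : sign_coherent K f -> s \in K ->
  barycentric s w x -> 0 <= affine_form f x ->
  forall v, 0 < w v -> 0 <= affine_form f v.
Proof.
move=> cK sK wx; apply: contraPP => /existsNP[v /not_implyP[wv /negP]].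
rewrite -ltNge => fv; have vs : v \in s by apply: (barycentric_support wx); rewrite gt_eqF.
apply/negP; rewrite -ltNge (affine_form_barycentric f wx) (big_fsetD1 v) //=.
rewrite ltr_nwDl ?pmulr_rlt0 // big_seq sumr_le0 // => u.
rewrite !inE => /andP[_ us]; rewrite mulr_ge0_le0 //; first by case: wx.
by rewrite leNgt; apply/negP; exact: (cK s v u).
Qed.

Lemma sum_fset_nth (M : nmodType) s (f : 'rV[R]_d -> M) :
  \sum_(v <- s) f v = \sum_(i < #|` s|) f (s`_i).
Proof. by rewrite (big_nth 0) big_mkord. Qed.

Lemma fset_nth_inj s : injective (fun i : 'I_(#|` s|) => s`_i).
Proof.
by move=> i j /eqP; rewrite nth_uniq ?fset_uniq ?ltn_ord // => /eqP /val_inj.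
Qed.

(* Affine independence of s is linear independence of these rows. *)
Definition homogeneous s : 'M[R]_(#|` s|, d + 1) := \matrix_i row_mx (s`_i) 1.

Lemma mul_homogeneous s (c : 'rV[R]_(#|` s|)) :
  c *m homogeneous s = row_mx (\sum_i c 0 i *: s`_i) (\sum_i c 0 i)%:M.
Proof.
rewrite mulmx_sum_row; apply/rowP => j; rewrite summxE; case: (split_ordP j) => k ->.
  rewrite row_mxEl summxE; apply: eq_bigr => i _.
  by rewrite rowK [LHS]mxE [RHS]mxE row_mxEl.
rewrite row_mxEr ord1 [RHS]mxE eqxx mulr1n; apply: eq_bigr => i _.
by rewrite rowK [LHS]mxE row_mxEr [X in _ * X]mxE eqxx mulr1.
Qed.

Lemma spread_nth s (c : 'rV[R]_(#|` s|)) (i : 'I_(#|` s|)) :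
  \sum_(j < #|` s| | s`_j == s`_i) c 0 j = c 0 i.
Proof.
by rewrite (eq_bigl (pred1 i)) ?big_pred1_eq // => j /=;
  rewrite (inj_eq (@fset_nth_inj s)).
Qed.

Lemma affinely_independent_free s : affinely_independent s -> row_free (homogeneous s).
Proof.
move=> si; rewrite -kermx_eq0; apply/rowV0P => c /sub_kermxP.
rewrite mul_homogeneous -[RHS]row_mx0 => /eq_row_mx[cv /matrixP/(_ 0 0)].
rewrite !mxE eqxx mulr1n => c1.
pose w v := \sum_(i < #|` s| | s`_i == v) c 0 i.
have we (i : 'I_(#|` s|)) : w s`_i = c 0 i by exact: spread_nth.
apply/rowP => i; rewrite mxE -we; apply: si; last by rewrite mem_nth.
  by rewrite sum_fset_nth; under eq_bigr do rewrite we.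
by rewrite sum_fset_nth; under eq_bigr do rewrite we.
Qed.

Definition column_form m (B : 'M[R]_(d + 1, m)) j : 'cV[R]_d * R :=
  (usubmx (col j B), dsubmx (col j B) 0 0).

Lemma column_formE m (B : 'M[R]_(d + 1, m)) j x :
  affine_form (column_form B j) x = (row_mx x 1 *m B) 0 j.
Proof.
rewrite /affine_form /= -[in RHS](vsubmxK B) mul_row_col mul1mx !mxE.
by congr (_ + _); apply: eq_bigr => k _; rewrite !mxE.
Qed.

(** Multiplying (x, 1) by the pseudo-inverse of the homogeneous matrix A gives the barycentric
    coordinates, which must be nonnegative. The columns of Q and -Q express that (x, 1) lies in the
    row space of A, that is, x in the affine hull of s. *)
Lemma hull_halfspaces s : affinely_independent s ->
  exists F : seq ('cV[R]_d * R), forall x, hull s x <-> all (fun f => 0 <= affine_form f x) F.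
Proof.
move=> /affinely_independent_free sf; pose A := homogeneous s.
have AV : A *m pinvmx A = 1%:M by exact: mulmxVp.
pose Q := 1%:M - pinvmx A *m A.
exists ([seq column_form (pinvmx A) j | j <- enum 'I_(#|` s|)] ++
  [seq column_form Q j | j <- enum 'I_(d + 1)] ++
  [seq column_form (- Q) j | j <- enum 'I_(d + 1)]).
move=> x; split=> [[w [w0 w1 xE]]|].
  pose c : 'rV[R]_(#|` s|) := \row_i w s`_i.
  have xA : row_mx x 1 = c *m A.
    rewrite mul_homogeneous; congr row_mx.
      by rewrite xE sum_fset_nth; apply: eq_bigr => i _; rewrite mxE.
    rewrite (_ : \sum_i _ = 1) // -[RHS]w1 sum_fset_nth.
    by apply: eq_bigr => i _; rewrite mxE.
  rewrite !all_cat; apply/and3P; split; apply/allP => _ /mapP[j _ ->];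
    rewrite column_formE xA.
  - by rewrite -mulmxA AV mulmx1 mxE w0 // mem_nth.
  - by rewrite mulmxBr mulmx1 mulmxA -(mulmxA c) AV mulmx1 subrr mxE.
  - by rewrite mulmxN mulmxBr mulmx1 mulmxA -(mulmxA c) AV mulmx1 subrr oppr0 mxE.
rewrite !all_cat => /and3P[/allP a1 /allP a2 /allP a3].
pose c := row_mx x 1 *m pinvmx A.
have c0 i : 0 <= c 0 i.
  by rewrite -column_formE; apply: a1; apply: map_f; rewrite mem_enum.
have : row_mx x 1 = c *m A.
  apply/eqP; rewrite -subr_eq0 /c -mulmxA -{1}[row_mx x 1]mulmx1 -mulmxBr -/Q.
  apply/eqP/rowP => j; rewrite [RHS]mxE; apply/eqP; rewrite eq_le; apply/andP; split.
    have : 0 <= affine_form (column_form (- Q) j) x.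
      by apply: a3; apply: map_f; rewrite mem_enum.
    by rewrite column_formE mulmxN mxE oppr_ge0.
  have : 0 <= affine_form (column_form Q j) x by apply: a2; apply: map_f; rewrite mem_enum.
  by rewrite column_formE.
rewrite mul_homogeneous => /eq_row_mx[xE /matrixP/(_ 0 0)].
rewrite !mxE eqxx mulr1n => c1.
exists (fun v => \sum_(i < #|` s| | s`_i == v) c 0 i); split.
- by move=> v _; rewrite sumr_ge0.
- by rewrite sum_fset_nth; under eq_bigr do rewrite spread_nth.
- by rewrite sum_fset_nth; under eq_bigr do rewrite spread_nth.
Qed.

End Barycentric.

(** * Edge-stellar subdivisions *)

Section EdgeSplit.
Local Open Scope nat_scope.
Local Open Scope fset_scope.
Context {V : choiceType}.
Implicit Types (s t r : {fset V}) (K L : {fset {fset V}}) (x y z u v p : V).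

(* [L] is the stellar subdivision of [K] at the new vertex [p] of the edge uv. *)
Definition edge_split u v p K L : Prop :=
  [/\ u != v, [fset u; v] \in K, forall s, s \in K -> p \notin s &
      forall s, (s \in L) = [&& s != fset0, ~~ ((u \in s) && (v \in s)) &
        (if p \in s then [fset u; v] `|` (s `\ p) else s) \in K]].

(** The simplex of K that carries a simplex s of the subdivision, p being interior to the edge
    uv. *)
Definition carrier u v p s := if p \in s then [fset u; v] `|` (s `\ p) else s.

Section Split.
Context (u v p : V) (K L : {fset {fset V}}).
Hypotheses (FK : face_closed K) (KL : edge_split u v p K L).

Lemma edge_split_exists : u != v -> [fset u; v] \in K ->
  (forall s, s \in K -> p \notin s) -> exists M, edge_split u v p K M.
Proof.
move=> uv uvK pK.
pose M := [fset s in fpowerset (p |` \bigcup_(s <- K) s) |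
  [&& s != fset0, ~~ ((u \in s) && (v \in s)) & carrier u v p s \in K]].
exists M; split=> // s; rewrite /M !inE /= fpowersetE -/(carrier u v p s).
rewrite andb_idl // => /and3P[_ _ sK].
apply/fsubsetP => x xs; rewrite inE in_fset1; case: eqVneq => //= xp.
apply/bigfcupP; exists (carrier u v p s); rewrite ?sK // /carrier.
by case: ifP => // ps; rewrite !inE xp xs orbT.
Qed.

Let uv : u != v. Proof. by case: KL. Qed.
Let uvK : [fset u; v] \in K. Proof. by case: KL. Qed.
Let pK s : s \in K -> p \notin s. Proof. by case: KL => _ _ + _; apply. Qed.
Let up : (u == p) = false.
Proof. by apply: contraNF (pK uvK) => /eqP <-; rewrite !inE eqxx. Qed.
Let vp : (v == p) = false.
Proof. by apply: contraNF (pK uvK) => /eqP <-; rewrite !inE eqxx orbT. Qed.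

Lemma edge_splitP s : reflect [/\ s != fset0, ~ (u \in s /\ v \in s) &
  carrier u v p s \in K] (s \in L).
Proof.
case: KL => _ _ _ ->; apply: (iffP and3P) => -[s0 suv sK]; split=> //.
  by apply/andP.
by apply/andP.
Qed.

Lemma split_old r : r \in K -> ~ (u \in r /\ v \in r) -> r \in L.
Proof.
move=> rK ruv; apply/edge_splitP; split=> //; first by apply: contraNneq FK.1 => <-.
by rewrite /carrier (negPf (pK rK)).
Qed.

Lemma split_new q r : r \in K -> u \in r -> v \in r -> q = u \/ q = v ->
  p |` (r `\ q) \in L.
Proof.
move=> rK ur vr quv; apply/edge_splitP; split.
- by apply/fset0Pn; exists p; rewrite !inE eqxx.
- by rewrite !inE up vp /=; case: quv => ->; rewrite eqxx => -[].
have -> // : carrier u v p (p |` (r `\ q)) = r.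
rewrite /carrier !inE eqxx /=; apply/fsetP => x; rewrite !inE.
have [->|xp] := eqVneq x p.
  by rewrite (negPf (pK rK)) !andbF eq_sym up eq_sym vp.
have [->|xu] := eqVneq x u; first by rewrite ur.
have [->|xv] := eqVneq x v; first by rewrite vr.
by rewrite /=; case: quv => ->; rewrite ?xu ?xv.
Qed.

Lemma split_new_mem q r x : x \in r -> x != q -> x \in p |` (r `\ q).
Proof. by move=> xr xq; rewrite !inE xq xr orbT. Qed.

Lemma split_apex_mem q r : p \in p |` (r `\ q).
Proof. by rewrite !inE eqxx. Qed.

Lemma split_pair r x y : r \in K -> u \in r -> v \in r -> x \in r -> y \in r ->
  (x = u /\ y = v) \/ (x = v /\ y = u) \/
  exists s, [/\ s \in L, p \in s, x \in s & y \in s].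
Proof.
move=> rK ur vr xr yr.
have wit q : q = u \/ q = v -> x != q -> y != q ->
    exists s, [/\ s \in L, p \in s, x \in s & y \in s].
  move=> quv xq yq; exists (p |` (r `\ q)).
  by rewrite split_new // split_apex_mem !split_new_mem.
have vu : v != u by rewrite eq_sym.
have [xu|xu] := eqVneq x u; have [yv|yv] := eqVneq y v; first by left.
- by right; right; apply: (wit v) => //; [right|rewrite xu].
- by right; right; apply: (wit u) => //; [left|rewrite yv].
- have [xv|xv] := eqVneq x v; last by right; right; apply: (wit v) => //; right.
  have [yu|yu] := eqVneq y u; first by right; left.
  by right; right; apply: (wit u) => //; left.
Qed.

Lemma carrier_mem s x : x \in s -> x != p -> x \in carrier u v p s.
Proof. by rewrite /carrier => xs xp; case: ifP => // ps; rewrite !inE xp xs orbT. Qed.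

Lemma carrier_uv s : p \in s -> u \in carrier u v p s /\ v \in carrier u v p s.
Proof. by rewrite /carrier => ->; rewrite !inE !eqxx /= orbT. Qed.

Lemma split_face_closed : face_closed L.
Proof.
split; first by apply/negP => /edge_splitP[]; rewrite eqxx.
move=> s t /edge_splitP[s0 suv sK] /fsubsetP ts t0; apply/edge_splitP; split=> //.
  by move=> [/ts us /ts vs]; apply: suv.
apply: (FK.2 _ _ sK); rewrite /carrier.
  case: ifP => [pt|pt]; first by rewrite ts // fsetUS // fsetSD //; apply/fsubsetP.
  case: ifP => ps; last exact/fsubsetP.
  apply/fsubsetP => x xt; rewrite !inE ts // andbT.
  by have -> : x != p by [apply: contraFneq pt => <-]; rewrite orbT.
case: ifP => // _; apply/fset0Pn; exists u; by rewrite !inE eqxx.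
Qed.

Lemma split_card n : (forall s, s \in K -> #|` s| <= n) ->
  forall s, s \in L -> #|` s| <= n.
Proof.
move=> Kn s /edge_splitP[s0 suv sK]; apply: leq_trans (Kn _ sK).
rewrite /carrier; case: ifP => // ps; rewrite (cardfsD1 p) ps add1n.
have [us|us] := boolP (u \in s).
  have vs : v \notin s by apply/negP => vs; apply: suv.
  apply: (@leq_trans #|` v |` (s `\ p)|).
    by rewrite cardfsU1 !inE (negPf vs) andbF.
  by apply: fsubset_leq_card; apply/fsubsetP => x; rewrite !inE => /orP[->|->]; rewrite !orbT.
apply: (@leq_trans #|` u |` (s `\ p)|).
  by rewrite cardfsU1 !inE (negPf us) andbF.
by apply: fsubset_leq_card; apply/fsubsetP => x; rewrite !inE => /orP[->|->]; rewrite ?orbT.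
Qed.

Lemma split_edge_connected : edge_connected K -> edge_connected L.
Proof.
move=> [_ cK]; split; first by exists (p |` ([fset u; v] `\ u)); apply: split_new;
  rewrite ?inE ?eqxx ?orbT //; left.
move=> g gL.
have gK r x : r \in K -> x \in r -> u \in r -> v \in r -> g x = g p.
  move=> rK xr ur vr.
  have [xu|xu] := eqVneq x u.
    apply: (gL (p |` (r `\ v))); rewrite ?split_apex_mem ?split_new_mem ?xu //.
    by apply: split_new => //; right.
  apply: (gL (p |` (r `\ u))); rewrite ?split_apex_mem ?split_new_mem //.
  by apply: split_new => //; left.
have gK' r x y : r \in K -> x \in r -> y \in r -> g x = g y.
  move=> rK xr yr; have [[ur vr]|ruv] := pselect (u \in r /\ v \in r).
    by rewrite (gK r x) ?(gK r y).
  exact: (gL r x y (split_old rK ruv)).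
have gp s x : s \in L -> x \in s -> exists2 r, r \in K & exists2 y, y \in r & g x = g y.
  move=> sL xs; have [_ _ sK] := edge_splitP s sL; exists (carrier u v p s) => //.
  have [xp|xp] := eqVneq x p; last by exists x => //; exact: carrier_mem.
  rewrite xp in xs *; have [us vs] := carrier_uv xs.
  by exists u => //; rewrite (gK _ u sK).
move=> s t x y sL tL xs yt; have [r rK [x' x'r ->]] := gp s x sL xs.
have [r' r'K [y' y'r' ->]] := gp t y tL yt.
exact: (cK g gK' r r').
Qed.

Let isuv x y := (x == u) && (y == v) || (x == v) && (y == u).

Let isuv_old r x y : ~ (u \in r /\ v \in r) -> x \in r -> y \in r -> isuv x y = false.
Proof.
move=> ruv xr yr; apply/negP => /orP[] /andP[/eqP xu /eqP yv]; apply: ruv.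
  by rewrite -xu -yv.
by rewrite -xu -yv.
Qed.

(** The edge uv, lost in L, is given the value of the path through p. On simplices containing uv the
    resulting c' is the coboundary of the values [c x p], hence a cocycle, and a primitive g of it
    extends to p by [g u (+) c u p]. *)
Lemma split_H1_trivial : H1_trivial K -> H1_trivial L.
Proof.
move=> hK c cL.
pose c' x y := if isuv x y then c x p (+) c y p else c x y.
have cpp s : s \in L -> p \in s -> c p p = false.
  by move=> sL ps; have := cL s p p p sL ps ps ps; case: (c p p).
have c'old r x y : ~ (u \in r /\ v \in r) -> x \in r -> y \in r -> c' x y = c x y.
  by move=> ruv xr yr; rewrite /c' (isuv_old ruv).
have c'new r x y : r \in K -> u \in r -> v \in r -> x \in r -> y \in r ->
    c' x y = c x p (+) c y p.
  move=> rK ur vr xr yr; rewrite /c'; case: ifP => // xy.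
  have [[xu yv]|[[xv yu]|[s [sL ps xs ys]]]] := split_pair rK ur vr xr yr.
  - by move: xy; rewrite /isuv xu yv !eqxx.
  - by move: xy; rewrite /isuv xv yu !eqxx orbT.
  - have := cL s x y p sL xs ys ps.
    by case: (c x y) (c x p) (c y p) => [] [] [].
have [g gK] : exists g, cobounds1 K c' g.
  apply: hK => r x y z rK xr yr zr; have [[ur vr]|ruv] := pselect (u \in r /\ v \in r).
    by rewrite !(c'new r) //; case: (c x p) (c y p) (c z p) => [] [] [].
  by rewrite !(c'old r) //; exact: (cL r x y z (split_old rK ruv)).
exists (fun x => if x == p then g u (+) c u p else g x).
set g' := (fun x => _).
have key s x : s \in L -> p \in s -> x \in s -> c x p = g' x (+) g' p.
  move=> sL ps xs; rewrite /g' eqxx; have [->|xp] := eqVneq x p.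
    by rewrite addbb (cpp s).
  have [_ suv sK] := edge_splitP s sL; have [us vs] := carrier_uv ps.
  have xs' := carrier_mem xs xp.
  have := gK _ u x sK us xs'; rewrite (c'new _ u x sK) //.
  by case: (c u p) (c x p) (g u) (g x) => [] [] [] [].
move=> s x y sL xs ys; have [ps|ps] := boolP (p \in s).
  have := cL s x y p sL xs ys ps; rewrite !(key s) //.
  by case: (c x y) (g' x) (g' y) (g' p) => [] [] [] [].
have [_ suv] := edge_splitP s sL; rewrite /carrier (negPf ps) => sK.
have neq z : z \in s -> (z == p) = false by move=> zs; apply: contraNF ps => /eqP <-.
by rewrite /g' !neq // -(gK s) // (c'old s).
Qed.

(* The triangles puz and pvz at p belong to a core together, since they are the only ones
   at the edge pz; so a core of L comes from one of K. *)
Lemma split_coreless : at_most_2dim K -> coreless K -> coreless L.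
Proof.
move=> K2 nK S S1 S2 SL Sn.
have S3 x y z : S x y z -> S z y x by move=> /S1 /S2 /S1.
have dist x y z : S x y z -> [/\ x != y, x != z & y != z].
  move=> Sxyz; split; first by have [] := SL _ _ _ Sxyz.
    by have [] := SL _ _ _ (S2 _ _ _ Sxyz).
  by have [] := SL _ _ _ (S2 _ _ _ (S1 _ _ _ Sxyz)).
have noUV x : ~ S u v x.
  by move=> Suvx; have [_ [s [/edge_splitP[_ suv _] us vs _]]] := SL _ _ _ Suvx; apply: suv.
have pface x y : S p x y -> exists r, [/\ r \in K, x \in r, y \in r, u \in r & v \in r].
  move=> Spxy; have [px py _] := dist _ _ _ Spxy.
  have [_ [s [/edge_splitP[_ _ sK] ps xs ys]]] := SL _ _ _ Spxy.
  have [us vs] := carrier_uv ps.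
  by exists (carrier u v p s); split=> //; apply: carrier_mem; rewrite // eq_sym.
have swap q q' z : (q = u /\ q' = v) \/ (q = v /\ q' = u) -> S p q z -> S p q' z.
  move=> qq Spqz; have [w wq Spzw] := Sn _ _ _ (S2 _ _ _ Spqz).
  have [pz pw zw] := dist _ _ _ Spzw.
  have [pq _ qz] := dist _ _ _ Spqz.
  have q'z : q' != z.
    apply/eqP => q'z; rewrite -q'z in Spqz.
    by case: qq Spqz => -[-> ->] /S3; [move=> /S1/(@noUV p)|move=> /(@noUV p)].
  have qq' : q != q' by case: qq => -[-> ->]; rewrite // eq_sym.
  have [r [rK zr wr ur vr]] := pface _ _ Spzw.
  have [qr q'r] : q \in r /\ q' \in r by case: qq => -[-> ->].
  have rE := fset3_of_card_le3 (K2 r rK) qr q'r zr qq' qz q'z.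
  move: wr; rewrite rE !inE (negPf wq) [w == z]eq_sym (negPf zw) orbF /= => /eqP wE.
  by apply: S2; rewrite -wE.
have onuv x y : S p x y -> [\/ x = u, x = v, y = u | y = v].
  move=> Spxy; have [px py xy] := dist _ _ _ Spxy.
  have [r [rK xr yr ur vr]] := pface _ _ Spxy.
  have [xu|xu] := eqVneq x u; first by constructor 1.
  have [xv|xv] := eqVneq x v; first by constructor 2.
  rewrite eq_sym in xu; rewrite eq_sym in xv.
  have rE := fset3_of_card_le3 (K2 r rK) ur vr xr uv xu xv.
  move: yr; rewrite rE !inE [y == x]eq_sym (negPf xy) orbF => /orP[] /eqP ->.
    by constructor 3.
  by constructor 4.
(* T keeps the triangles without p and replaces each pair puz, pvz by the triangle uvz of K. Asking
   for puz alone suffices because of [swap]. *)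
pose T x y z := [\/ [/\ S x y z, x != p, y != p & z != p],
  isuv x y /\ S p u z, isuv y z /\ S p u x | isuv x z /\ S p u y].
have isuvC x y : isuv x y = isuv y x by rewrite /isuv orbC ![(_ == v) && _]andbC.
have T1 x y z : T x y z -> T y x z.
  case=> [[? ? ? ?]|[]|[]|[]]; first by constructor 1; split=> //; exact: S1.
  - by rewrite isuvC => *; constructor 2.
  - by move=> *; constructor 4.
  - by move=> *; constructor 3.
have T2 x y z : T x y z -> T x z y.
  case=> [[? ? ? ?]|[]|[]|[]]; first by constructor 1; split=> //; exact: S2.
  - by move=> *; constructor 4.
  - by rewrite isuvC => *; constructor 3.
  - by move=> *; constructor 2.
have TK x y z : T x y z -> x != y /\ exists s, [/\ s \in K, x \in s, y \in s & z \in s].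
  have puz w : S p u w -> [/\ u != w, v != w & exists s, [/\ s \in K, u \in s, v \in s & w \in s]].
    move=> Spuw; have [_ _ uw] := dist _ _ _ Spuw.
    split=> //; first by apply/eqP => vw; rewrite -vw in Spuw; move/S3/S1: Spuw; exact: noUV.
    by have [r [rK _ wr ur vr]] := pface _ _ Spuw; exists r.
  case=> [[Sxyz xp yp zp]|[/orP[]/andP[/eqP -> /eqP ->]]|[/orP[]/andP[/eqP -> /eqP ->]]|[/orP[]/andP[/eqP -> /eqP ->]]].
  - have [xy [s [/edge_splitP[_ _ sK] xs ys zs]]] := SL _ _ _ Sxyz; split=> //.
    by exists (carrier u v p s); rewrite !carrier_mem.
  - by move=> /puz[uz vz [s [sK us vs zs]]]; split=> //; exists s.
  - by move=> /puz[uz vz [s [sK us vs zs]]]; split; [rewrite eq_sym|exists s].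
  - by move=> /puz[uz vz [s [sK us vs zs]]]; split; [rewrite eq_sym|exists s].
  - by move=> /puz[uz vz [s [sK us vs zs]]]; split; [rewrite eq_sym|exists s].
  - by move=> /puz[uz vz [s [sK us vs zs]]]; split=> //; exists s.
  - by move=> /puz[uz vz [s [sK us vs zs]]]; split=> //; exists s.
have uvu : isuv u v by rewrite /isuv !eqxx.
have vuv : isuv v u by rewrite isuvC.
have Svu w : S p v w -> S p u w by apply: swap; right.
have Suv w : S p u w -> S p v w by apply: swap; left.
have noU x : S x u v -> False by move=> /S3/S1; exact: noUV.
have noV x : S x v u -> False by move=> /S3; exact: noUV.
(* At its edge ux, the triangle uvx of T is continued by the triangle of S other than pux. It avoids
   p by choice, and v because u and v are not joined in L; the edge vx is similar. *)
have Tside x y z : isuv y z -> S p u x -> exists2 z', z' != z & T x y z'.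
  move=> /orP[] /andP[/eqP -> /eqP ->] Spux.
    have [_ px _] := dist _ _ _ Spux.
    have [w wp Sxuw] := Sn _ _ _ (S2 _ _ _ (S3 _ _ _ (S1 _ _ _ (S2 _ _ _ Spux)))).
    move/S1: Sxuw => Sxuw; exists w; first by apply/eqP => wv; rewrite wv in Sxuw; exact: noU Sxuw.
    by constructor 1; split; rewrite ?up // eq_sym.
  have Spvx := Suv _ Spux; have [_ px _] := dist _ _ _ Spvx.
  have [w wp Sxvw] := Sn _ _ _ (S2 _ _ _ (S3 _ _ _ (S1 _ _ _ (S2 _ _ _ Spvx)))).
  move/S1: Sxvw => Sxvw; exists w; first by apply/eqP => wv; rewrite wv in Sxvw; exact: noV Sxvw.
  by constructor 1; split; rewrite ?vp // eq_sym.
have Tn x y z : T x y z -> exists2 z', z' != z & T x y z'.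
  case=> [[Sxyz xp yp zp]|[xyuv Spuz]|[yzuv Spux]|[xzuv Spuy]]; last first.
  - by have [z' z'z Tyxz'] := Tside _ _ _ xzuv Spuy; exists z' => //; exact: T1.
  - exact: Tside yzuv Spux.
  - by have [z' z'z Spuz'] := Sn _ _ _ Spuz; exists z' => //; constructor 2.
  have [w wz Sxyw] := Sn _ _ _ Sxyz; have [wp|wp] := eqVneq w p; last first.
    by exists w => //; constructor 1.
  (* When the neighbour in S is pxy, one of x and y is u or v, and the triangle of T obtained by
     adding the other end of uv takes its place. *)
  rewrite wp in Sxyw; have Spxy : S p x y by apply: S1; apply: S2.
  case: (onuv _ _ Spxy) => E; subst.
  - exists v; first by apply: contraPneq Sxyz => <- /S2; exact: noUV.
    by constructor 4; split.
  - exists u; first by apply: contraPneq Sxyz => <- /S2 /S1; exact: noUV.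
    by constructor 4; split=> //; exact: Svu.
  - exists v; first by apply: contraPneq Sxyz => <-; exact: noU.
    by constructor 3; split=> //; exact: S2.
  - exists u; first by apply: contraPneq Sxyz => <-; exact: noV.
    by constructor 3; split=> //; apply: Svu; exact: S2.
have noT := nK T T1 T2 TK Tn.
have noSp x y : ~ S p x y.
  move=> Spxy; case: (onuv _ _ Spxy) => E; subst.
  - by apply: (noT u v y); constructor 2.
  - by apply: (noT u v y); constructor 2; split=> //; exact: Svu.
  - by apply: (noT u v x); constructor 2; split=> //; exact: S2.
  - by apply: (noT u v x); constructor 2; split=> //; apply: Svu; exact: S2.
move=> x y z Sxyz; apply: (noT x y z); constructor 1; split=> //.
- by apply/eqP => xp; rewrite xp in Sxyz; exact: noSp Sxyz.
- by apply/eqP => yp; rewrite yp in Sxyz; apply: noSp; exact: S1 Sxyz.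
- by apply/eqP => zp; rewrite zp in Sxyz; apply: noSp; exact: S3 Sxyz.
Qed.

Lemma split_tree_like : tree_like K -> tree_like L.
Proof.
move=> [_ K2 cK hK nK]; split.
- exact: split_face_closed.
- by apply: split_card.
- exact: split_edge_connected.
- exact: split_H1_trivial.
- exact: split_coreless.
Qed.

(** A simplicial approximation, from the subdivision to K, of the identity. *)
Definition split_map x := if x == p then u else x.

Lemma split_map_carrier s x : x \in s -> split_map x \in carrier u v p s.
Proof.
move=> xs; rewrite /split_map; have [xp|xp] := eqVneq x p; last exact: carrier_mem.
by rewrite xp in xs; have [] := carrier_uv xs.
Qed.

(** Pullback along [split_map] is injective on H^2. On the edge uv absent from L, the primitive is
    defined by the equation which a triangle uvp would impose, its image being the degenerate triple
    u, v, u. *)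
Lemma split_cobounds2 b a : cocycle2 K b ->
  cobounds2 L (fun x y z => b (split_map x) (split_map y) (split_map z)) a ->
  exists a', cobounds2 K b a'.
Proof.
move=> bK aL.
exists (fun x y => if isuv x y then b x y u (+) a x p (+) a y p else a x y).
set a' := (fun x y => _).
have smp : split_map p = u by rewrite /split_map eqxx.
have sm r x : r \in K -> x \in r -> split_map x = x.
  by move=> rK xr; rewrite /split_map; case: eqVneq => // xp; move: (pK rK); rewrite -xp xr.
have a'new r x y : r \in K -> u \in r -> v \in r -> x \in r -> y \in r ->
    a' x y = b x y u (+) a x p (+) a y p.
  move=> rK ur vr xr yr; rewrite /a'; case: ifP => // xy.
  have [[xu yv]|[[xv yu]|[s [sL ps xs ys]]]] := split_pair rK ur vr xr yr.
  - by move: xy; rewrite /isuv xu yv !eqxx.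
  - by move: xy; rewrite /isuv xv yu !eqxx orbT.
  - have := aL s x y p sL xs ys ps; rewrite smp !(sm r) // => ->.
    by case: (a x y) (a x p) (a y p) => [] [] [].
move=> r x y z rK xr yr zr; have [[ur vr]|ruv] := pselect (u \in r /\ v \in r).
  rewrite !(a'new r) //; have := bK r x y z u rK xr yr zr ur.
  by case: (b y z u) (b x z u) (b x y u) (b x y z) (a x p) (a y p) (a z p)
    => [] [] [] [] [] [] [].
rewrite /a' !(isuv_old ruv) //; have := aL r x y z (split_old rK ruv) xr yr zr.
by rewrite !(sm r).
Qed.

End Split.
End EdgeSplit.

Section Stellar.
Local Open Scope fset_scope.
Local Open Scope ring_scope.
Context {R : realType} {d : nat}.
Local Notation point := 'rV[R]_d.
Implicit Types (s t r : {fset point}) (K L M : {fset {fset point}}).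
Implicit Types (u v x y p : point) (w : point -> R) (a : R).

Definition refines L K : Prop :=
  (forall s, s \in L -> exists2 r, r \in K & forall x, x \in s -> hull r x) /\
  (forall r x, r \in K -> hull r x -> exists s,
     [/\ s \in L, hull s x & forall y, y \in s -> hull r y]).

Lemma refines_refl K : refines K K.
Proof.
split=> [s sK|r x rK rx]; first by exists s => // x; exact: hull_vertex.
by exists r; split=> // y; exact: hull_vertex.
Qed.

Lemma refines_trans L K M : refines M L -> refines L K -> refines M K.
Proof.
move=> [ML ML'] [LK LK']; split=> [s /ML[t /LK[r rK tr] st]|r x rK /(LK' _ _ rK)].
  by exists r => // x /st; exact: hull_trans.
move=> [t [tL tx tr]]; have [s [sM sx st]] := ML' t x tL tx.
by exists s; split=> // y /st; exact: hull_trans.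
Qed.

Lemma refines_space L K : refines L K -> space L = space K.
Proof.
move=> [LK LK']; apply/seteqP; split=> x [s sK sx].
  by have [r rK sr] := LK s sK; exists r => //; exact: hull_trans sx.
by have [t [tL tx _]] := LK' s x sK sx; exists t.
Qed.

Definition segment_weight u v a x : R := (1 - a) * (x == u)%:R + a * (x == v)%:R.

Lemma barycentric_segment u v a : 0 <= a <= 1 ->
  barycentric [fset u; v] (segment_weight u v a) ((1 - a) *: u + a *: v).
Proof.
move=> a01; apply: (barycentric_convex a01).
  by apply: barycentric_sub (barycentric_point u); exact: fsubsetUl.
by apply: barycentric_sub (barycentric_point v); exact: fsubsetUr.
Qed.

Definition edge_subdivision K L : Prop :=
  exists u v a, 0 < a < 1 /\ edge_split u v ((1 - a) *: u + a *: v) K L.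

(** The point has positive weight at both u and v, whereas a vertex has a single nonzero
    coordinate. *)
Lemma fresh_edge_point K u v a : unique_coordinates K -> [fset u; v] \in K ->
  u != v -> 0 < a < 1 -> forall s, s \in K -> (1 - a) *: u + a *: v \notin s.
Proof.
move=> UK uvK uv /andP[a0 a1] s sK; set p := (X in X \notin _); apply/negP => ps.
have pp : barycentric s (fun x => (x == p)%:R) p.
  by apply: barycentric_sub (barycentric_point p); rewrite fsub1set.
have a01 : 0 <= a <= 1 by rewrite !ltW.
have E := UK _ _ _ _ _ uvK sK (barycentric_segment u v a01) pp.
have := congr1 (@^~ u) E; have := congr1 (@^~ v) E.
rewrite /segment_weight /= !eqxx (negPf uv) eq_sym (negPf uv).
case: eqVneq => [vp|_]; rewrite /= ?(mulr0n, mulr1n); last by lra.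
by case: eqVneq => [up|_]; [rewrite up vp eqxx in uv|rewrite /= ?(mulr0n, mulr1n); lra].
Qed.

Section Step.
Context (K L : {fset {fset point}}) (u v : point) (a : R).
Hypotheses (FK : face_closed K) (UK : unique_coordinates K) (a01 : 0 < a < 1).
Let p := (1 - a) *: u + a *: v.
Hypothesis KL : edge_split u v p K L.

Let uv : u != v. Proof. by case: KL. Qed.
Let uvK : [fset u; v] \in K. Proof. by case: KL. Qed.
Let pK s : s \in K -> p \notin s. Proof. by case: KL => _ _ + _; apply. Qed.
Let up : (u == p) = false.
Proof. by apply: contraNF (pK uvK) => /eqP <-; rewrite !inE eqxx. Qed.
Let vp : (v == p) = false.
Proof. by apply: contraNF (pK uvK) => /eqP <-; rewrite !inE eqxx orbT. Qed.
Let a01' : 0 <= a <= 1. Proof. by case/andP: a01 => *; rewrite !ltW. Qed.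

Lemma carrier_hull s x : x \in s -> hull (carrier u v p s) x.
Proof.
move=> xs; have [xp|xp] := eqVneq x p; last exact/hull_vertex/carrier_mem.
rewrite xp in xs *; have [us vs] := carrier_uv u v xs.
by apply: hull_convex => //; exact: hull_vertex.
Qed.

(* Moves the mass at p back to u and v. *)
Let pull w x := w x + w p * (segment_weight u v a x - (x == p)%:R).

Let pull_barycentric s w x : s \in L -> barycentric s w x ->
  barycentric (carrier u v p s) (pull w) x.
Proof.
move=> sL wx.
pose c y z := if y == p then segment_weight u v a z else (z == y)%:R : R.
suff -> : pull w = (fun z => \sum_(y <- s) w y * c y z).
  apply: barycentric_comp wx _ => y ys; rewrite /c.
  have [yp|yp] := eqVneq y p; last first.
    apply: barycentric_sub (barycentric_point y).
    by rewrite fsub1set carrier_mem.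
  rewrite yp in ys *; have [us vs] := carrier_uv u v ys.
  apply: barycentric_sub (barycentric_segment u v a01').
  by apply/fsubsetP => z; rewrite !inE => /orP[] /eqP ->.
have ws : forall y, y \notin s -> w y = 0 by case: wx.
have delta q (k : R) : \sum_(y <- s) w y * ((y == q)%:R * k) = w q * k.
  have [qs|qs] := boolP (q \in s).
    rewrite (big_fsetD1 q) //= eqxx mul1r big_seq big1 ?addr0 // => y.
    by rewrite !inE => /andP[/negPf -> _]; rewrite mul0r mulr0.
  rewrite ws // mul0r big_seq big1 // => y ys.
  by rewrite (_ : y == q = false) ?mul0r ?mulr0 //; apply: contraNF qs => /eqP <-.
apply/funext => z; rewrite /pull -[w z]mulr1 -!delta -big_split /=.
apply: eq_bigr => y _; rewrite -mulrDr; congr (_ * _); rewrite /c.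
have [->|yp] := eqVneq y p; last by rewrite mul0r addr0 mulr1 eq_sym.
by rewrite mul1r mulr1 [z == p]eq_sym addrC subrK.
Qed.

(** A simplex of L omits u or v, so one of these weights vanishes. The mass at p is therefore
    recovered from [pull w] as the largest that can be drawn from u and v in the ratio (1 - a) :
    a. *)
Let pull_inj s t w w' x y : s \in L -> t \in L ->
  barycentric s w x -> barycentric t w' y -> pull w = pull w' -> w = w'.
Proof.
move=> sL tL wx wy E.
have Eu := congr1 (@^~ u) E; have Ev := congr1 (@^~ v) E.
move: Eu Ev; rewrite /pull /segment_weight up vp !eqxx (negPf uv) [v == u]eq_sym (negPf uv).
have zero r c z : r \in L -> barycentric r c z -> c u = 0 \/ c v = 0.
  move=> rL cz; have [_ ruv _] := edge_splitP KL r rL.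
  have [cu|cu] := eqVneq (c u) 0; [by left|right].
  apply/eqP; apply: contrapT => /negP cv; apply: ruv.
  by split; apply: (barycentric_support cz).
have pos r c z : barycentric r c z -> [/\ 0 <= c u, 0 <= c v & 0 <= c p].
  by case=> c0.
have [w0u w0v w0p] := pos _ _ _ wx; have [w1u w1v w1p] := pos _ _ _ wy.
have z0 := zero _ _ _ sL wx; have z1 := zero _ _ _ tL wy.
case/andP: (a01) => a0 a1; rewrite /= ?(mulr0n, mulr1n) => Eu Ev.
have pp : w p = w' p by case: z0 z1 => [z0|z0] [z1|z1]; nra.
apply/funext => z; have := congr1 (@^~ z) E; rewrite /pull pp.
by move=> /addIr.
Qed.

Lemma split_unique_coordinates : unique_coordinates L.
Proof.
move=> s t w w' x sL tL wx w'x.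
apply: (pull_inj sL tL wx w'x).
have [_ _ sK] := edge_splitP KL s sL; have [_ _ tK] := edge_splitP KL t tL.
exact: UK sK tK (pull_barycentric sL wx) (pull_barycentric tL w'x).
Qed.

(** The whole mass of u is exchanged for the mass c = w u / (1 - a) at p. This costs a c at v, and
    the inequality says that v has that much. *)
Lemma split_cover_side r x w : r \in K -> u \in r -> v \in r -> barycentric r w x ->
  w u * a <= w v * (1 - a) -> hull (p |` (r `\ u)) x.
Proof.
move=> rK ur vr [w0 ws w1 wx] wuv; case/andP: (a01) => a0 a1.
pose c := w u / (1 - a).
have c0 : 0 <= c by rewrite divr_ge0 // subr_ge0 ltW.
have cE : c * (1 - a) = w u by rewrite divfK // gt_eqF // subr_gt0.
pose w' y := if y == p then c else if y == v then w v - a * c else w y.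
(* Used with f constant for the total weight and with f the identity for the point. *)
have sumE (M : lmodType R) (f : point -> M) :
    \sum_(y <- p |` (r `\ u)) w' y *: f y =
    \sum_(y <- r) w y *: f y + c *: (f p - ((1 - a) *: f u + a *: f v)).
  rewrite big_fsetU1 /=; last by rewrite !inE (negPf (pK rK)) andbF.
  rewrite (big_fsetD1 v) /=; last by rewrite !inE vr eq_sym uv.
  rewrite [in RHS](big_fsetD1 u) //= [in RHS](big_fsetD1 v) /=; last first.
    by rewrite !inE vr eq_sym uv.
  rewrite (eq_big_seq (fun y => w y *: f y)); last first.
    move=> y; rewrite !inE /w' => /and3P[/negPf -> yu yr].
    by case: eqVneq => // yp; move: (pK rK); rewrite -yp yr.
  rewrite /w' eqxx vp eqxx; set S := \sum_(i <- _) _.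
  rewrite -cE scalerBr scalerDr !scalerA scalerBl [a * c]mulrC.
  rewrite opprD [in RHS]addrC -[RHS]addrA [in RHS]addrA.
  set P := c *: f p; set A := _ *: f u; set B := (c * a) *: f v; set X := w v *: f v.
  rewrite [X - B + S]addrAC [LHS]addrCA -[RHS]addrA [P + (- A - B)]addrCA. by rewrite addNKr.
exists w'; split=> [y _||].
- rewrite /w'; case: ifP => // _; case: ifP => // _; rewrite subr_ge0 mulrC.
  by rewrite -(ler_pM2r (_ : 0 < 1 - a)) ?subr_gt0 // mulrAC cE.
- have := sumE R^o (fun=> 1); under eq_bigr do rewrite [_ *: _]mulr1.
  under [in RHS]eq_bigr do rewrite [_ *: _]mulr1.
  by move=> ->; rewrite w1 -scalerDl subrK scale1r subrr scaler0 addr0.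
- by rewrite (sumE _ id) wx subrr scaler0 addr0.
Qed.

End Step.

Lemma edge_split_sym u v p K L : edge_split u v p K L -> edge_split v u p K L.
Proof.
move=> [uv uvK pK KL]; split=> //; [by rewrite eq_sym|by rewrite fsetUC|].
by move=> s; rewrite KL [[fset v; u]]fsetUC [(v \in s) && _]andbC.
Qed.

Lemma split_refines K L u v a : face_closed K -> 0 < a < 1 ->
  edge_split u v ((1 - a) *: u + a *: v) K L -> refines L K.
Proof.
move=> FK a01 KL; have uvK : [fset u; v] \in K by case: KL.
split=> [s sL|r x rK rx].
  have [_ _ sK] := edge_splitP KL s sL; exists (carrier u v ((1 - a) *: u + a *: v) s) => //.
  by move=> x; exact: carrier_hull.
have [[ur vr]|ruv] := pselect (u \in r /\ v \in r); last first.
  exists r; split=> //; first exact: (split_old FK KL rK ruv).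
  by move=> y; exact: hull_vertex.
have pr : hull r ((1 - a) *: u + a *: v).
  by case/andP: a01 => *; apply: hull_convex; rewrite ?ltW //; exact: hull_vertex.
have inr q y : y \in ((1 - a) *: u + a *: v) |` (r `\ q) -> hull r y.
  by rewrite !inE => /orP[/eqP -> //|/andP[_]]; exact: hull_vertex.
have [w wx] := (hullP r x).1 rx.
have [le|/ltW le] := leP (w u * a) (w v * (1 - a)).
  exists (((1 - a) *: u + a *: v) |` (r `\ u)); split.
  - by apply: (split_new KL) => //; left.
  - exact: (split_cover_side a01 KL rK ur vr wx).
  - exact: inr.
exists (((1 - a) *: u + a *: v) |` (r `\ v)); split.
- by apply: (split_new KL) => //; right.
- have pE : (1 - a) *: u + a *: v = (1 - (1 - a)) *: v + (1 - a) *: u.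
    by rewrite subKr addrC.
  move: KL; rewrite pE => /edge_split_sym KL'.
  apply: (split_cover_side _ KL' rK vr ur wx); last by rewrite subKr.
  by case/andP: a01 => *; rewrite subr_gt0 ltrBlDr ltrDl; apply/andP.
- exact: inr.
Qed.

End Stellar.

(** * Subdivisions compatible with given simplices *)

Section Tower.
Local Open Scope fset_scope.
Local Open Scope ring_scope.
Context {R : realType} {d : nat}.
Local Notation point := 'rV[R]_d.
Implicit Types (s t r : {fset point}) (A K L M : {fset {fset point}}).
Implicit Types (u v x y p : point) (w : point -> R) (a : R) (f : 'cV[R]_d * R).

Inductive stellar_subdivision K : {fset {fset point}} -> Prop :=
| stellar_refl : stellar_subdivision K K
| stellar_step L M : stellar_subdivision K L -> edge_subdivision L M ->
    stellar_subdivision K M.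

Lemma stellar_trans K L M : stellar_subdivision K L -> stellar_subdivision L M ->
  stellar_subdivision K M.
Proof. by move=> KL; elim=> // L' M' _ KL' L'M'; exact: stellar_step L'M'. Qed.

Lemma stellar_simplicial K L : stellar_subdivision K L ->
  simplicial_complex K -> simplicial_complex L.
Proof.
elim=> // {}L M _ IH [u [v [a [a01 LM]]]] /IH /simplicial_complexP[FL UL].
apply/simplicial_complexP; split; first exact: split_face_closed LM.
exact: split_unique_coordinates a01 LM.
Qed.

Lemma stellar_refines K L : stellar_subdivision K L -> simplicial_complex K ->
  refines L K.
Proof.
move=> KL cK; elim: KL => [|{}L M KL IH [u [v [a [a01 LM]]]]]; first exact: refines_refl.
have [FL UL] := (simplicial_complexP L).1 (stellar_simplicial KL cK).
exact: refines_trans (split_refines FL a01 LM) IH.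
Qed.

Lemma stellar_card K L n : stellar_subdivision K L ->
  (forall s, s \in K -> #|` s| <= n)%N -> forall s, s \in L -> (#|` s| <= n)%N.
Proof. by elim=> // {}L M _ IH [u [v [a [_ LM]]]] /IH; exact: (split_card LM). Qed.

Lemma stellar_tree_like K L : stellar_subdivision K L -> tree_like K -> tree_like L.
Proof.
elim=> // {}L M _ IH [u [v [a [_ LM]]]] /IH tL.
by apply: (split_tree_like _ LM) => //; case: tL.
Qed.

(** Each new vertex is sent in turn to an end of the edge it splits. The first property makes psi
    contiguous to any other approximation of the identity; the second brings the vanishing of a
    class in H^2 back from L to K. *)
Lemma stellar_simplicial_map K L : stellar_subdivision K L -> simplicial_complex K ->
  exists psi : point -> point,
    (forall s, s \in L -> exists2 r, r \in K & forall x, x \in s -> hull r x /\ psi x \in r) /\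
    forall b, cocycle2 K b ->
      (exists c, cobounds2 L (fun x y z => b (psi x) (psi y) (psi z)) c) ->
      exists c, cobounds2 K b c.
Proof.
move=> KL cK; elim: KL => [|{}L M KL [psi [psiL psib]] [u [v [a [a01 LM]]]]].
  exists id; split=> // s sK; exists s => // x xs; split=> //; exact: hull_vertex.
set p := (1 - a) *: u + a *: v in LM.
have [FL UL] := (simplicial_complexP L).1 (stellar_simplicial KL cK).
exists (psi \o split_map u p); split=> [s sM|b bK [c cM]].
  have [_ _ sL] := edge_splitP LM s sM.
  have [r rK tr] := psiL _ sL; exists r => // x xs; split.
    have : hull (carrier u v p s) x by apply: carrier_hull.
    by apply: hull_trans => y yt; have [] := tr y yt.
  by have [] := tr _ (split_map_carrier u v p xs).
apply: psib => //.
apply: (split_cobounds2 FL LM (a := c)) => //.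
move=> s x y z w sL xs ys zs ws; have [r rK tr] := psiL _ sL.
by apply: (bK r) => //; [have [] := tr x xs|have [] := tr y ys|
  have [] := tr z zs|have [] := tr w ws].
Qed.

Lemma affine_form_convex f a u v :
  affine_form f ((1 - a) *: u + a *: v) = (1 - a) * affine_form f u + a * affine_form f v.
Proof.
rewrite /affine_form mulmxDl -!scalemxAl !mxE; ring.
Qed.

(** The value at the new vertex lies between those at u and v, so a strict sign there already occurs
    at a vertex of the carrier. *)
Lemma split_sign_coherent K L f : edge_subdivision K L -> sign_coherent K f ->
  sign_coherent L f.
Proof.
move=> [u [v [a [/andP[a0 a1] KL]]]] cK s x y sL xs ys fx fy.
set p := (1 - a) *: u + a *: v in KL.
have [_ _ sK] := edge_splitP KL s sL.
have fp : affine_form f p = (1 - a) * affine_form f u + a * affine_form f v.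
  exact: affine_form_convex.
have [xp|xp] := eqVneq x p; have [yp|yp] := eqVneq y p.
- by have := lt_trans fx fy; rewrite xp yp ltxx.
- rewrite xp in xs fx; have [us vs] := carrier_uv u v xs.
  have [fu|fu] := ltP (affine_form f u) 0; first exact: (cK _ u y sK us (carrier_mem u v ys yp)).
  have [fv|fv] := ltP (affine_form f v) 0; first exact: (cK _ v y sK vs (carrier_mem u v ys yp)).
  by nra.
- rewrite yp in ys fy; have [us vs] := carrier_uv u v ys.
  have [fu|fu] := ltP 0 (affine_form f u); first exact: (cK _ x u sK (carrier_mem u v xs xp) us).
  have [fv|fv] := ltP 0 (affine_form f v); first exact: (cK _ x v sK (carrier_mem u v xs xp) vs).
  by nra.
- exact: (cK _ x y sK (carrier_mem u v xs xp) (carrier_mem u v ys yp)).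
Qed.

Lemma stellar_sign_coherent K L f : stellar_subdivision K L -> sign_coherent K f ->
  sign_coherent L f.
Proof. by elim=> // {}L M _ IH LM /IH; exact: split_sign_coherent LM. Qed.

Definition crossing f s : bool :=
  `[< #|` s| = 2 /\ exists x y, [/\ x \in s, y \in s, affine_form f x < 0 & 0 < affine_form f y] >].

(* Splitting a crossing edge where it meets the hyperplane creates no new one. *)
Lemma stellar_cut K f : simplicial_complex K ->
  exists2 L, stellar_subdivision K L & sign_coherent L f.
Proof.
have [n] := ubnP #|` [fset s in K | crossing f s]|.
elim: n => // n IH in K * => Kn cK; have [FK UK] := (simplicial_complexP K).1 cK.
have [coh|] := pselect (sign_coherent K f).
  by exists K => //; exact: stellar_refl.
move=> /existsNP[s /existsNP[u /existsNP[v]]] /not_implyP[sK] /not_implyP[us] /not_implyP[vs].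
move=> /not_implyP[fu /not_implyP[fv _]].
have uv : u != v by apply: contraTneq fu => ->; rewrite -leNgt ltW.
have uvK := face_mem2 FK sK us vs.
pose a := - affine_form f u / (affine_form f v - affine_form f u).
have dpos : 0 < affine_form f v - affine_form f u by rewrite subr_gt0 (lt_trans fu).
have a01 : 0 < a < 1.
  rewrite /a divr_gt0 ?oppr_gt0 //= ltr_pdivrMr // mul1r.
  by rewrite -subr_gt0 opprK subrK.
pose p := (1 - a) *: u + a *: v.
have fp : affine_form f p = 0.
  rewrite affine_form_convex mulrBl mul1r addrAC -addrA -mulrBr /a divfK ?gt_eqF //.
  by rewrite subrr.
have [L KL] := edge_split_exists uv uvK (fresh_edge_point UK uvK uv a01).
have KLs : edge_subdivision K L by exists u, v, a.
have KLs' := stellar_step (stellar_refl K) KLs.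
have [] := IH L.
- apply: leq_trans (fproper_ltn_card _) (_ : #|` [fset s in K | crossing f s]| <= n)%N => //.
  rewrite fproperE; apply/andP; split.
    apply/fsubsetP => t; rewrite !inE /= => /andP[tL ft]; rewrite ft andbT.
    have [_ _] := edge_splitP KL t tL; rewrite /carrier -/p; case: ifP => // pt _.
    exfalso; move/asboolP: ft => [t2 [x [y [xt yt fx fy]]]].
    have xp : x != p by apply: contraTneq fx => ->; rewrite fp ltxx.
    have yp : y != p by apply: contraTneq fy => ->; rewrite fp ltxx.
    have xy : x != y by apply: contraTneq fx => ->; rewrite -leNgt ltW.
    by move: pt; rewrite (fset2_of_card_le2 _ xt yt xy) ?t2 // !inE ![p == _]eq_sym
      (negPf xp) (negPf yp).
  apply/fsubsetPn; exists [fset u; v]; rewrite !inE /=.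
    rewrite uvK /=; apply/asboolP; split; first by rewrite cardfs2 uv.
    by exists u, v; rewrite !inE !eqxx orbT.
  rewrite negb_and; apply/orP; left; apply/negP => /(edge_splitP KL)[_ + _].
  by apply; rewrite !inE !eqxx orbT.
- exact: stellar_simplicial KLs' cK.
- by move=> M LM cM; exists M => //; exact: stellar_trans LM.
Qed.

Lemma stellar_cuts K (F : seq ('cV[R]_d * R)) : simplicial_complex K ->
  exists2 L, stellar_subdivision K L & forall f, f \in F -> sign_coherent L f.
Proof.
elim: F K => [|f F IH] K cK; first by exists K => //; exact: stellar_refl.
have [L KL cL] := stellar_cut f cK.
have [M LM cM] := IH L (stellar_simplicial KL cK).
exists M; first exact: stellar_trans LM.
by move=> g; rewrite inE => /orP[/eqP -> |/cM //]; exact: stellar_sign_coherent LM cL.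
Qed.

(* A simplex of L whose relative interior meets hull r is contained in it. *)
Definition compatible L r : Prop :=
  forall s w x, s \in L -> barycentric s w x -> hull r x ->
    forall v, 0 < w v -> hull r v.

(** Every hull in question is a finite intersection of half-spaces. After cutting along all their
    boundaries, an inequality that holds at a point of a simplex holds at every vertex of positive
    weight. *)
Lemma stellar_compatible K (A : {fset {fset point}}) : simplicial_complex K ->
  (forall r, r \in A -> affinely_independent r) ->
  exists2 L, stellar_subdivision K L & forall r, r \in A -> compatible L r.
Proof.
move=> cK Ai.
have /choice[F FP] : forall r, exists F : seq ('cV[R]_d * R), r \in A ->
    forall x, hull r x <-> all (fun f => 0 <= affine_form f x) F.
  move=> r; have [rA|] := boolP (r \in A); last by exists [::].
  by have [F FP] := hull_halfspaces (Ai r rA); exists F.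
have [L KL cL] := stellar_cuts (flatten [seq F r | r <- A]) cK.
exists L => // r rA s w x sL wx /(FP r rA) /allP Fx v wv; apply/(FP r rA)/allP => f fF.
apply: (sign_coherent_ge0 _ sL wx) wv; last exact: Fx.
by apply: cL; apply/flatten_mapP; exists r.
Qed.

Lemma compatible_interior L r s : compatible L r -> s \in L -> s != fset0 ->
  forall x, x = \sum_(v <- s) barycenter_weight s v *: v -> hull r x ->
  forall v, v \in s -> hull r v.
Proof.
move=> Lr sL s0 x xE rx v vs; have := barycentric_barycenter s0; rewrite -xE => wx.
apply: (Lr s _ x sL wx rx); rewrite /barycenter_weight vs.
by rewrite invr_gt0 ltr0n cardfs_gt0.
Qed.

Lemma barycentric_face L s w x : face_closed L -> s \in L -> barycentric s w x ->
  exists2 t, t \in L & barycentric t w x /\ forall v, v \in t -> 0 < w v.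
Proof.
move=> FL sL wx; pose t := [fset v in s | w v != 0].
have wt : barycentric t w x.
  apply: (barycentric_carrier _ wx) => v wv; rewrite !inE /= wv.
  by rewrite (barycentric_support wx).
exists t; last first.
  split=> // v; rewrite !inE /= => /andP[_ wv]; rewrite lt_neqAle eq_sym wv /=.
  by case: wx.
apply: (FL.2 s) => //; first by apply/fsubsetP => v; rewrite !inE => /andP[].
by have [v vt _] := barycentric_neq0 wt; apply/fset0Pn; exists v.
Qed.

Definition inside (A L : {fset {fset point}}) : {fset {fset point}} :=
  [fset s in L | `[< exists2 r, r \in A & forall v, v \in s -> hull r v >]].

Lemma insideP A L s : reflect (s \in L /\ exists2 r, r \in A & forall v, v \in s -> hull r v)
  (s \in inside A L).
Proof.
rewrite !inE /=; apply: (iffP andP) => -[sL]; first by move=> /asboolP.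
by move=> H; split=> //; apply/asboolP.
Qed.

Lemma inside_sub A L : inside A L `<=` L.
Proof. by apply/fsubsetP => s /insideP[]. Qed.

Lemma face_closed_inside A L : face_closed L -> face_closed (inside A L).
Proof.
move=> FL; split; first by apply/negP => /insideP[+ _]; apply/negP; exact: FL.1.
move=> s t /insideP[sL [r rA sr]] ts t0; apply/insideP; split.
  exact: (FL.2 s).
by exists r => // v /(fsubsetP ts); exact: sr.
Qed.

Lemma simplicial_complex_sub L M : simplicial_complex L -> M `<=` L -> face_closed M ->
  simplicial_complex M.
Proof.
move=> /simplicial_complexP[FL UL] /fsubsetP ML FM; apply/simplicial_complexP; split=> //.
by move=> s t w w' x /ML sL /ML tL; exact: UL.
Qed.

(** A point of hull r has positive weight at every vertex of some face of L, and compatibility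
    places this whole face inside r. *)
Lemma refines_inside A L : face_closed L ->
  (forall r, r \in A -> compatible L r) ->
  (forall r x, r \in A -> hull r x -> space L x) -> refines (inside A L) A.
Proof.
move=> FL LA AL; split=> [s /insideP[_ []] r|r x rA rx]; first by exists r.
have [s sL /hullP[w wx]] := AL r x rA rx.
have [t tL [wt wt0]] := barycentric_face FL sL wx.
have tr v : v \in t -> hull r v.
  by move=> /wt0; apply: (LA r rA t w x tL wt rx).
exists t; split=> //; first by apply/insideP; split=> //; exists r.
by apply/hullP; exists w.
Qed.

(** It suffices to locate the barycenter of each simplex of L, since all its weights are
    positive. *)
Lemma inside_all A L : face_closed L ->
  (forall r, r \in A -> compatible L r) ->
  (space L `<=` space A)%classic -> inside A L = L.
Proof.
move=> FL LA SL; apply/eqP; rewrite eqEfsubset inside_sub; apply/fsubsetP => s sL.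
have s0 : s != fset0 by apply: contraNneq FL.1 => <-.
have : space L (\sum_(v <- s) barycenter_weight s v *: v).
  by exists s => //; apply/hullP; eexists; exact: barycentric_barycenter.
move=> /SL[r rA rx]; apply/insideP; split=> //; exists r => //.
exact: (compatible_interior (LA r rA) sL s0 (erefl _) rx).
Qed.

End Tower.

(** * Passing from a subdivision to the complex *)

Lemma positive_nonroot (R : realType) (p : {poly R}) : p != 0 ->
  exists2 x, 0 < x & p.[x] != 0.
Proof.
move=> p0; apply: contrapT => no.
have := max_poly_roots p0 (rs := [seq k.+1%:R | k <- iota 0 (size p)]).
rewrite size_map size_iota ltnn => H; suff: false by []; apply: H.
  apply/allP => _ /mapP[k _ ->]; apply: contrapT => /negP kr; apply: no.
  by exists k.+1%:R.
rewrite map_inj_uniq ?iota_uniq // => i j /eqP; rewrite eqr_nat => /eqP[]. done.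
Qed.

Lemma seq_argmax (R : realType) (T : eqType) (h : T -> R) (s : seq T) x0 :
  x0 \in s -> exists2 x, x \in s & forall y, y \in s -> h y <= h x.
Proof.
elim: s x0 => // a [|b s] IH x0 _; first by exists a; rewrite ?inE // => y; rewrite inE => /eqP ->.
have [x xs xmax] := IH b (mem_head _ _).
have [le|lt] := leP (h a) (h x).
  by exists x => [|y]; rewrite in_cons ?xs ?orbT // => /orP[/eqP ->|/xmax].
exists a; rewrite ?mem_head // => y; rewrite inE => /orP[/eqP -> //|/xmax le].
exact: le_trans le (ltW lt).
Qed.

Lemma small_uniform (R : realType) (T : eqType) (P : T -> R -> Prop) (s : seq T) :
  (forall x, x \in s -> exists2 e0, 0 < e0 & forall e, 0 < e <= e0 -> P x e) ->
  exists2 e0, 0 < e0 & forall e, 0 < e <= e0 -> forall x, x \in s -> P x e.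
Proof.
elim: s => [|a s IH] H; first by exists 1.
have [|e1 e10 P1] := IH; first by move=> x xs; apply: H; rewrite inE xs orbT.
have [e2 e20 P2] := H a (mem_head _ _).
exists (Num.min e1 e2) => [|e /andP[e0]]; first by rewrite lt_min e10.
rewrite le_min => /andP[ee1 ee2] x; rewrite inE => /orP[/eqP ->|].
  by apply: P2; rewrite e0.
by apply: P1; rewrite e0.
Qed.

Section Dimension.
Local Open Scope fset_scope.
Local Open Scope ring_scope.
Context {R : realType} {d : nat}.
Local Notation point := 'rV[R]_d.
Implicit Types (s t r : {fset point}) (A K L M : {fset {fset point}}).
Implicit Types (u v x y p : point) (w : point -> R) (a e : R) (f : 'cV[R]_d * R).

(** The homogeneous matrix of r has larger rank than that of t, so some column of the cokernel of
    the latter does not vanish on r; this column is the form. *)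
Lemma separating_form r t : affinely_independent r -> (#|` t| < #|` r|)%N ->
  exists2 f, exists2 i, (i < #|` r|)%N & affine_form f r`_i != 0 &
    forall v, v \in t -> affine_form f v = 0.
Proof.
move=> ri tr; pose C := cokermx (homogeneous t).
have : ~~ (homogeneous r <= homogeneous t)%MS.
  apply/negP => /mxrankS; move/eqP: (affinely_independent_free ri) => ->.
  by rewrite leqNgt => /negP; apply; exact: leq_ltn_trans (rank_leq_row _) tr.
rewrite submxE -/C => /eqP/matrixP nz.
have [i [j ij]] : exists i j, (homogeneous r *m C) i j != 0.
  apply: contrapT => no; apply: nz => i j; rewrite [RHS]mxE; apply/eqP.
  by apply: contrapT => /negP ij; apply: no; exists i, j.
have rowE s (k : 'I_(#|` s|)) : row_mx s`_k 1 *m C = row k (homogeneous s *m C).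
  by rewrite row_mul rowK.
exists (column_form C j).
  by exists i => //; rewrite column_formE rowE mxE.
move=> v vt; have vi : (index v t < #|` t|)%N by rewrite index_mem.
by rewrite -(nth_index 0 vt) column_formE (rowE t (Ordinal vi)) mulmx_coker !mxE.
Qed.

(* The points sum_i x^i r_i / sum_i x^i, for x > 0, form a curve in the simplex
   r meeting every affine subspace of smaller dimension finitely often. *)
Lemma hull_cover_card n r (T : {fset {fset point}}) : affinely_independent r ->
  (forall t, t \in T -> #|` t| <= n)%N ->
  (forall x, hull r x -> exists2 t, t \in T & hull t x) -> (#|` r| <= n)%N.
Proof.
move=> ri Tn rT; rewrite leqNgt; apply/negP => nr.
have /choice[F FP] : forall t, exists f, t \in T ->
    (exists2 i, (i < #|` r|)%N & affine_form f r`_i != 0) /\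
    forall v, v \in t -> affine_form f v = 0.
  move=> t; have [tT|] := boolP (t \in T); last by exists (0, 0).
  have [f f1 f2] := separating_form ri (leq_ltn_trans (Tn t tT) nr).
  by exists f.
pose P t := \poly_(i < #|` r|) affine_form (F t) r`_i.
have P0 t : t \in T -> P t != 0.
  move=> /FP[[i ir fi] _]; apply: contra_neq fi => Pt.
  by have := coef_poly #|` r| (fun i => affine_form (F t) r`_i) i;
    rewrite -/(P t) Pt coef0 ir.
(* At a positive parameter that is a root of none of the polynomials, the point of the curve lies on
   none of the hyperplanes containing the simplices t. *)
have [x x0 xP] : exists2 x, 0 < x & (\prod_(t <- T) P t).[x] != 0.
  by apply: positive_nonroot; rewrite prodf_seq_neq0; apply/allP => t /P0 ->.
pose D := \sum_(i < #|` r|) x ^+ i.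
have D0 : 0 < D.
  rewrite /D; case: (#|` r|) nr => // m _; rewrite big_ord_recl /= expr0.
  by rewrite ltr_pwDl // sumr_ge0 // => i _; rewrite exprn_ge0 // ltW.
pose w v := if v \in r then x ^+ index v r / D else 0.
have wi (i : 'I_(#|` r|)) : w r`_i = x ^+ i / D.
  by rewrite /w mem_nth // index_uniq ?fset_uniq.
have wq : barycentric r w (\sum_(v <- r) w v *: v).
  split=> [v|v /negPf vr||//].
  - by rewrite /w; case: ifP => // _; rewrite divr_ge0 ?exprn_ge0 // ltW.
  - by rewrite /w vr.
  - rewrite sum_fset_nth; under eq_bigr do rewrite wi.
    by rewrite -mulr_suml divff ?gt_eqF.
have [|t tT /hullP[w' w'q]] := rT (\sum_(v <- r) w v *: v); first by apply/hullP; exists w.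
have : affine_form (F t) (\sum_(v <- r) w v *: v) = 0.
  rewrite (affine_form_barycentric _ w'q) big_seq big1 // => v vt.
  by have [_ -> //] := FP t tT; rewrite mulr0.
rewrite (affine_form_barycentric _ wq) sum_fset_nth => E.
move: xP; rewrite horner_prod prodf_seq_neq0 => /allP/(_ t tT) /=.
rewrite horner_poly; apply/negP; rewrite negbK.
move/eqP: E; under eq_bigr do rewrite wi mulrAC.
rewrite -mulr_suml mulf_eq0 invr_eq0 (gt_eqF D0) orbF => /eqP E.
by apply/eqP; rewrite -[RHS]E; apply: eq_bigr => i _; rewrite mulrC.
Qed.

Lemma unit_form u v : u != v -> exists f, affine_form f u = 0 /\ affine_form f v = 1.
Proof.
move=> uv; have [j uvj] : exists j, u 0 j != v 0 j.
  apply: contrapT => no; move/eqP: uv; apply; apply/rowP => j.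
  by apply/eqP; apply: contrapT => /negP uvj; apply: no; exists j.
pose k := (v 0 j - u 0 j)^-1; exists (k *: delta_mx j 0, - (k * u 0 j)).
have E x : affine_form (k *: delta_mx j 0, - (k * u 0 j)) x = k * (x 0 j - u 0 j).
  rewrite /affine_form /= -scalemxAr mxE mulrBr; congr (_ * _ - _).
  rewrite mxE (bigD1 j) //= mxE !eqxx mulr1 big1 ?addr0 // => i ij.
  by rewrite mxE (negPf ij) mulr0.
by rewrite !E subrr mulr0 mulVf // subr_eq0 eq_sym.
Qed.

Section Refinement.
Context (L K : {fset {fset point}}).
Hypotheses (cL : simplicial_complex L) (cK : simplicial_complex K) (LK : refines L K).

Let FL : face_closed L. Proof. exact: ((simplicial_complexP L).1 cL).1. Qed.
Let UL : unique_coordinates L. Proof. exact: ((simplicial_complexP L).1 cL).2. Qed.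
Let FK : face_closed K. Proof. exact: ((simplicial_complexP K).1 cK).1. Qed.
Let UK : unique_coordinates K. Proof. exact: ((simplicial_complexP K).1 cK).2. Qed.

Lemma hull1 v x : hull [fset v] x -> x = v.
Proof. by move=> /hullP[w [_ _]]; rewrite !big_seq_fset1 => -> <-; rewrite scale1r. Qed.

Lemma refines_vertex v : [fset v] \in K -> [fset v] \in L.
Proof.
move=> vK; have [s [sL sv sub]] := LK.2 _ _ vK (hull_vertex (fset11 v)).
have [x xs] := face_neq0 FL sL.
suff -> : [fset v] = s by [].
apply/eqP; rewrite eqEfsubset; apply/andP; split.
  by rewrite fsub1set; have := hull1 (sub x xs) => <-.
by apply/fsubsetP => y /sub /hull1 ->; rewrite inE.
Qed.

Lemma hull_mem s v : s \in L -> [fset v] \in L -> hull s v -> v \in s.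
Proof.
move=> sL vL /hullP[w wv]; apply: (barycentric_support wv).
by rewrite (UL sL vL wv (barycentric_point v)) eqxx oner_neq0.
Qed.

(** Simplices of L that miss x also miss all nearby points of the segment towards y, being closed
    and finite in number. Hence a simplex containing a point close enough to x contains x: L has a
    simplex at x that points towards y. *)
Lemma refines_direction r x y : r \in K -> hull r x -> hull r y ->
  exists s e, [/\ s \in L, 0 < e < 1, hull s x,
    hull s ((1 - e) *: x + e *: y) & forall v, v \in s -> hull r v].
Proof.
move=> rK rx ry.
have [|e0 e00 eP] := @small_uniform R _ (fun s e => hull s ((1 - e) *: x + e *: y) -> hull s x) L.
  move=> s sL; have [sx|sx] := pselect (hull s x); first by exists 1.
  have si : affinely_independent s by case: cL => _ _ + _; apply.
  have [F FP] := hull_halfspaces si.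
  move/FP/negP/allPn: (sx) => [f fF]; rewrite -ltNge => fx.
  pose D := 1 + `|affine_form f y - affine_form f x|.
  have D0 : 0 < D by rewrite ltr_pwDl.
  exists (- affine_form f x / (2 * D)); first by rewrite divr_gt0 ?oppr_gt0 // mulr_gt0.
  move=> e /andP[e0]; rewrite ler_pdivlMr ?mulr_gt0 // => eD.
  move=> /FP/allP/(_ f fF); rewrite affine_form_convex => fe; exfalso.
  have : e * (affine_form f y - affine_form f x) <= e * D.
    by rewrite ler_pM2l // /D (le_trans (ler_norm _)) // lerDr.
  by nra.
pose e := Num.min e0 2^-1.
have e01 : 0 < e < 1.
  by rewrite /e lt_min e00 invr_gt0 ltr0n /= gt_min invf_lt1 ?ltr1n ?orbT.
have rz : hull r ((1 - e) *: x + e *: y).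
  by apply: hull_convex => //; case/andP: e01 => *; rewrite !ltW.
have [s [sL sz sr]] := LK.2 _ _ rK rz.
exists s, e; split=> //; apply: (eP e) sL sz.
by case/andP: e01 => -> _; rewrite /e ge_min lexx.
Qed.

(** By uniqueness of coordinates, a vertex of positive weight at x belongs to every simplex of K
    containing x. On the vertices of a subdivision such a choice is a simplicial approximation of
    the identity. *)
Lemma carrier_vertex_map : exists phi : point -> point,
  forall r x, r \in K -> hull r x -> phi x \in r.
Proof.
have /choice[phi phiP] : forall x, exists v, forall r, r \in K -> hull r x -> v \in r.
  move=> x; have [[r0 r0K /hullP[w wx]]|no] := pselect (space K x); last first.
    by exists x => r rK rx; exfalso; apply: no; exists r.
  have [v vr0 wv] := barycentric_neq0 wx; exists v => r rK /hullP[w' w'x].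
  apply: (barycentric_support w'x); rewrite (UK rK r0K w'x wx).
  by rewrite gt_eqF.
by exists phi => r x; exact: phiP.
Qed.

Section CarrierMap.
Variable phi : point -> point.
Hypothesis phiP : forall r x, r \in K -> hull r x -> phi x \in r.

Let phi_vertex v : [fset v] \in K -> phi v = v.
Proof. by move=> vK; have := phiP vK (hull_vertex (fset11 v)); rewrite inE => /eqP. Qed.

(** L subdivides each edge uv of K; summing the equations of g along the pieces from u to v gives
    the equation for uv, phi being the identity at both ends. *)
Lemma refines_cobounds1 c g : cocycle1 K c ->
  cobounds1 L (fun x y => c (phi x) (phi y)) g -> cobounds1 K c g.
Proof.
move=> cc gL r u v rK ur vr.
have [<-|uv] := eqVneq u v.
  by rewrite addbb; have := cc r u u u rK ur ur ur; case: (c u u).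
have uvK := face_mem2 FK rK ur vr; set e := [fset u; v] in uvK.
have [ue ve] : u \in e /\ v \in e by rewrite !inE !eqxx orbT.
have [f [fu fv]] := unit_form uv.
have vtx q : q \in e -> [fset q] \in K by exact: face_mem1.
(* The walk from u to v is replaced by an extremal choice: among the vertices of L on uv at which
   the equation from u holds, the one farthest along must be v. *)
pose X := [fset x in \bigcup_(s <- L) s |
  `[< [/\ [fset x] \in L, hull e x & g u (+) g x = c u (phi x)] >]].
have XP x : x \in X <-> [/\ [fset x] \in L, hull e x & g u (+) g x = c u (phi x)].
  rewrite !inE /=; split=> [/andP[_ /asboolP //]|H]; rewrite asboolT // andbT.
  by apply/bigfcupP; exists [fset x]; rewrite ?inE //; case: H => ->.
have uX : u \in X.
  apply/XP; split; [exact/refines_vertex/vtx|exact: hull_vertex|].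
  rewrite phi_vertex ?vtx // addbb.
  by have := cc r u u u rK ur ur ur; case: (c u u).
have [x xX xmax] := seq_argmax (affine_form f) uX.
have [xL ex gx] := (XP x).1 xX.
have [xv|xv] := eqVneq x v.
  by move: gx; rewrite xv phi_vertex ?vtx.
(* Otherwise a simplex of L inside uv starts at x in the direction of v; it has a vertex farther
   along, to which the equation extends. *)
have [s [eps [sL /andP[e0 e1] sx sxv se]]] := refines_direction uvK ex (hull_vertex ve).
have xs := hull_mem sL xL sx.
have fx : affine_form f x < 1.
  have /hullP[w wx] := ex; have [w0 _ w1 xE] := wx.
  rewrite /e big_fsetU1 ?inE //= big_seq_fset1 in w1.
  rewrite /e big_fsetU1 ?inE //= big_seq_fset1 in xE.
  rewrite (affine_form_barycentric f wx) /e big_fsetU1 ?inE //= big_seq_fset1.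
  rewrite fu fv mulr0 add0r mulr1 lt_neqAle; apply/andP; split; last by rewrite -w1 lerDr.
  apply: contra_neq xv => wv; have wu : w u = 0 by move: w1; rewrite wv; lra.
  by rewrite -xE wu wv scale0r scale1r add0r.
have [y ys fy] : exists2 y, y \in s & affine_form f x < affine_form f y.
  apply: contrapT => no; move/hullP: sxv => [w wxv].
  have [w0 _ w1 _] := wxv.
  have : affine_form f ((1 - eps) *: x + eps *: v) <= affine_form f x.
    rewrite (affine_form_barycentric f wxv) -[leRHS]mul1r -w1 mulr_suml.
    rewrite big_seq [leRHS]big_seq; apply: ler_sum => y ys; rewrite ler_wpM2l //.
    by rewrite leNgt; apply/negP => fy; apply: no; exists y.
  by rewrite affine_form_convex fv; nra.
suff /xmax : y \in X by rewrite leNgt fy.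
apply/XP; split; [exact: face_mem1 ys|exact: se|].
have := gL s x y sL xs ys; have := cc e u (phi x) (phi y) uvK ue (phiP uvK ex) (phiP uvK (se y ys)).
move: gx; by case: (c u (phi x)) (c (phi x) (phi y)) (c u (phi y)) (g u) (g x) (g y)
  => [] [] [] [] [] [].
Qed.

Lemma cocycle1_pull c : cocycle1 K c -> cocycle1 L (fun x y => c (phi x) (phi y)).
Proof.
move=> cc s x y z sL xs ys zs; have [r rK sr] := LK.1 s sL.
by apply: (cc r) => //; apply: phiP => //; exact: sr.
Qed.

Lemma refines_edge_connected : edge_connected L -> edge_connected K.
Proof.
move=> [[s sL] conL]; split; first by have [r rK _] := LK.1 s sL; exists r.
move=> g gK r t x y rK tK xr yt.
have [xK yK] := (face_mem1 FK rK xr, face_mem1 FK tK yt).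
rewrite -(phi_vertex xK) -(phi_vertex yK).
apply: (conL (g \o phi) _ [fset x] [fset y]); rewrite ?inE //; try exact: refines_vertex.
move=> q a b qL aq bq /=; have [r' r'K qr'] := LK.1 q qL.
by apply: (gK r') => //; apply: phiP => //; exact: qr'.
Qed.

End CarrierMap.

Lemma refines_H1_trivial : H1_trivial L -> H1_trivial K.
Proof.
have [phi phiP] := carrier_vertex_map; move=> hL c cc.
have [g gL] := hL _ (cocycle1_pull phiP cc).
by exists g; exact: refines_cobounds1 gL.
Qed.

End Refinement.
End Dimension.

Section RefinementCore.
Local Open Scope fset_scope.
Local Open Scope ring_scope.
Context {R : realType} {d : nat}.
Local Notation point := 'rV[R]_d.
Implicit Types (s t r : {fset point}) (A K L M : {fset {fset point}}).
Implicit Types (u v x y p : point) (w : point -> R) (e : R).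

Lemma barycentric_le1 s w x v : barycentric s w x -> w v <= 1.
Proof.
move=> [w0 ws w1 _]; have [vs|vs] := boolP (v \in s); last by rewrite ws.
by rewrite -w1 (big_fsetD1 v) //= lerDl sumr_ge0.
Qed.

(** From a core S of K one obtains a core U of L: the triangles of L contained in triangles of S. U
    is nonempty when S is, since a triangle is not covered by finitely many edges and vertices
    ([hull_cover_card]). *)
Lemma refines_coreless L K : simplicial_complex L -> simplicial_complex K ->
  refines L K -> at_most_2dim L -> at_most_2dim K -> coreless L -> coreless K.
Proof.
move=> cL cK LK L2 K2 nL S S1 S2 SK Sn.
have [FL UL] := (simplicial_complexP L).1 cL.
have [FK UK] := (simplicial_complexP K).1 cK.
have dist x y z : S x y z -> [/\ x != y, x != z & y != z].
  move=> Sxyz; split; first by have [] := SK _ _ _ Sxyz.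
    by have [] := SK _ _ _ (S2 _ _ _ Sxyz).
  by have [] := SK _ _ _ (S2 _ _ _ (S1 _ _ _ Sxyz)).
pose T r := r \in K /\ exists a b c, S a b c /\ r = [fset a; b; c].
have ST a b c : S a b c -> T [fset a; b; c].
  move=> Sabc; split; last by exists a, b, c.
  by have [_ [r [rK ar br cr]]] := SK _ _ _ Sabc; exact: (face_mem3 FK rK).
have Tvtx r c : T r -> c \in r -> exists a b, S a b c /\ r = [fset a; b; c].
  move=> [_ [a [b [c' [Sabc ->]]]]]; rewrite !inE => /orP[/orP[]|] /eqP ->.
  - exists b, c'; split; first exact/S2/S1.
    by rewrite -fsetUA fsetUC.
  - exists a, c'; split; first exact/S2.
    by rewrite fsetUAC.
  - by exists a, b.
pose U x y z := [/\ [/\ x != y, x != z & y != z],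
  exists s, [/\ s \in L, x \in s, y \in s & z \in s] &
  exists r, [/\ T r, hull r x, hull r y & hull r z]].
suff noU x y z : ~ U x y z.
  move=> a b c Sabc; have [rK _] := ST _ _ _ Sabc; set r := [fset a; b; c] in rK.
  have r3 : #|` r| = 3 by apply: card_fset3; case: (dist _ _ _ Sabc).
  have ri : affinely_independent r by case: cK => _ _ + _; apply.
  have [[s [[sL sr] s3]]|no] := pselect (exists s, (s \in L /\ forall v, v \in s -> hull r v) /\
      (2 < #|` s|)%N).
    have [x [y [z [[xs ys zs] dxyz]]]] := card_gt2_distinct s3.
    apply: (noU x y z); split=> //; first by exists s.
    by exists r; split; [exact: ST|exact: sr|exact: sr|exact: sr].
  suff : (#|` r| <= 2)%N by rewrite r3.
  apply: (hull_cover_card (T := inside [fset r] L) ri).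
    move=> s /insideP[sL [r']]; rewrite inE => /eqP -> sr; rewrite leqNgt.
    by apply/negP => s3; apply: no; exists s.
  move=> x rx; have [s [sL sx sr]] := LK.2 r x rK rx; exists s => //.
  by apply/insideP; split=> //; exists r; rewrite ?inE.
move: x y z; apply: nL.
- move=> x y z [[xy xz yz] [s [sL xs ys zs]] [r [Tr rx ry rz]]]; split.
  + by split; rewrite // eq_sym.
  + by exists s.
  + by exists r.
- move=> x y z [[xy xz yz] [s [sL xs ys zs]] [r [Tr rx ry rz]]]; split.
  + by split; rewrite // eq_sym.
  + by exists s.
  + by exists r.
- by move=> x y z [[xy xz yz] Es _].
move=> x y z [[xy xz yz] [s [sL xs ys zs]] [r [Tr rx ry rz]]].
have sE := fset3_of_card_le3 (L2 s sL) xs ys zs xy xz yz.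
have sr v : v \in s -> hull r v by rewrite sE !inE => /orP[/orP[]|] /eqP ->.
have xyL := face_mem2 FL sL xs ys.
have h0 : 0 < (2^-1 : R) by rewrite invr_gt0 ltr0n.
have h1 : 0 < 1 - (2^-1 : R) by lra.
have h01 : 0 <= (2^-1 : R) <= 1 by apply/andP; split; lra.
(* The midpoint has positive weight at x and y, so every simplex of L containing it has the edge xy;
   it has weight zero at z. *)
set m := (1 - 2^-1) *: x + 2^-1 *: y.
have mw : barycentric [fset x; y] (segment_weight x y 2^-1) m by exact: barycentric_segment.
have mz : segment_weight x y 2^-1 z = 0.
  by rewrite /segment_weight ![z == _]eq_sym (negPf xz) (negPf yz) !mulr0 addr0.
have xy_mem t : t \in L -> hull t m -> x \in t /\ y \in t.
  move=> tL /hullP[w wm]; have E := UL _ _ _ _ _ xyL tL mw wm; rewrite -{}E in wm.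
  split; apply: (barycentric_support wm); rewrite /segment_weight eqxx.
    by rewrite (negPf xy) mulr0 addr0 mulr1 gt_eqF.
  by rewrite [y == x]eq_sym (negPf xy) mulr0 add0r mulr1 gt_eqF.
(* t is found next to the midpoint m of xy: beyond xy as seen from z if m is interior
   to r, and otherwise in another triangle of the core at the edge of r containing m. *)
suff [t [r' [[tL Tr' tr'] tm ts]]] : exists t r',
    [/\ [/\ t \in L, T r' & forall v, v \in t -> hull r' v], hull t m &
    ~ (t `<=` s)].
  have [xt yt] := xy_mem t tL tm.
  move/negP/fsubsetPn: ts => [z' z't]; rewrite sE !inE !negb_or => /andP[/andP[zx zy] zz].
  exists z' => //; split; [by split; rewrite // eq_sym|by exists t|].
  by exists r'; split; [|exact: tr'|exact: tr'|exact: tr'].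
have [rK _] := Tr; have rm : hull r m by exact: hull_convex.
have /hullP[w wm] := rm; have [w0 ws w1 _] := wm.
have [[c cr wc]|pos] := pselect (exists2 c, c \in r & w c = 0).
  (* Here m lies on the edge ab of r. The core has a second triangle abc' there, and L has a simplex
     t in it leaving m towards c'. If t were contained in s, hence in r, then c' would be a vertex
     of r. *)
  have [a [b [Sabc rE]]] := Tvtx r c Tr cr.
  have [c' c'c Sabc'] := Sn _ _ _ Sabc.
  have Tr' := ST _ _ _ Sabc'; set r' := [fset a; b; c'] in Tr'.
  have [r'K _] := Tr'.
  have wm' : barycentric r' w m.
    apply: (barycentric_carrier _ wm) => v wv; have := barycentric_support wm wv.
    rewrite rE !inE => /orP[->//|/eqP vc]; by rewrite vc wc eqxx in wv.
  have c'r' : c' \in r' by rewrite !inE eqxx orbT.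
  have r'm : hull r' m by apply/hullP; exists w.
  have [t [e [tL /andP[e0 e1] tm tq tr']]] := refines_direction cL LK r'K r'm (hull_vertex c'r').
  exists t, r'; split=> // ts.
  have rq : hull r ((1 - e) *: m + e *: c').
    by apply: hull_trans tq => v /(fsubsetP ts); exact: sr.
  have /hullP[w' w'q] := rq.
  have c'p : barycentric r' (fun u => (u == c')%:R) c'.
    by apply: barycentric_sub (barycentric_point c'); rewrite fsub1set.
  have e01 : 0 <= e <= 1 by rewrite !ltW.
  have wq := barycentric_convex e01 wm' c'p.
  have [ac bc _] := dist _ _ _ (S2 _ _ _ Sabc'); have [_ _ bc'] := dist _ _ _ Sabc'.
  have : c' \in r.
    apply: (barycentric_support w'q); rewrite (UK _ _ _ _ _ rK r'K w'q wq) eqxx mulr1.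
    by rewrite gt_eqF // ltr_wpDl // mulr_ge0 // subr_ge0 ltW.
  by rewrite rE !inE (negPf c'c) ![c' == _]eq_sym (negPf ac) (negPf bc').
have [|mu mu0 muP] := @small_uniform R _ (fun v e => e <= w v) r.
  move=> v vr; exists (w v); last by move=> e /andP[].
  by rewrite lt_neqAle w0 andbT eq_sym; apply/eqP => wv; apply: pos; exists v.
have {}muP v : v \in r -> mu <= w v by apply: muP; rewrite mu0 lexx.
have /hullP[wz wzz] := rz.
(* The point beyond m on the line from z. As all weights of m are at least mu and those of z at most
   1, it stays in r. *)
pose y0 := (1 + mu) *: m - mu *: z.
have ry0 : hull r y0.
  apply/hullP; exists (fun v => (1 + mu) * w v - mu * wz v).
  have [z0 zs' z1 zE] := wzz; split=> [v|v vr||].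
  - have [vr|vr] := boolP (v \in r); last by rewrite ws // zs' // !mulr0 subr0.
    by have := muP v vr; have := barycentric_le1 v wzz; have := w0 v; have := z0 v; nra.
  - by rewrite ws // zs' // !mulr0 subr0.
  - by rewrite sumrB -!mulr_sumr w1 z1 !mulr1 addrK.
  - under eq_bigr do rewrite scalerBl -!scalerA.
    by rewrite sumrB -!scaler_sumr zE; case: wm => _ _ _ ->.
have [t [e [tL /andP[e0 e1] tm tq tr]]] := refines_direction cL LK rK rm ry0.
exists t, r; split=> // ts.
have /hullP[wq wqq] : hull s ((1 - e) *: m + e *: y0) by exact: hull_sub tq.
(* With this k, m is the combination (1 - k) q + k z of q = (1 - e) m + e y0 and z. If q were in s,
   the weight of m at z would be at least k > 0. *)
pose k := e * mu / (1 + e * mu).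
have emu : 0 < e * mu by exact: mulr_gt0.
have k0 : 0 < k by rewrite divr_gt0 // ltr_wpDl.
have k1 : k <= 1 by rewrite ler_pdivrMr ?mul1r ?lerDr // ltr_wpDl.
have zp : barycentric s (fun u => (u == z)%:R) z.
  by apply: barycentric_sub (barycentric_point z); rewrite fsub1set.
have k01 : 0 <= k <= 1 by rewrite k1 ltW.
have := barycentric_convex k01 wqq zp.
rewrite (_ : _ + _ = m); last first.
  have ne : 1 + e * mu != 0 by rewrite gt_eqF // ltr_wpDl.
  by apply/rowP => i; rewrite /k /y0 !mxE; field.
move=> /(UL _ _ _ _ _ xyL sL mw)/(congr1 (@^~ z)) /=.
rewrite mz eqxx mulr1 => E.
have : 0 <= wq z by case: wqq.
by nra.
Qed.

Lemma refines_tree_like L K : simplicial_complex L -> simplicial_complex K ->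
  refines L K -> at_most_2dim K -> tree_like L -> tree_like K.
Proof.
move=> cL cK LK K2 [_ L2 conL hL nL]; have [FK _] := (simplicial_complexP K).1 cK.
split=> //.
- by have [phi phiP] := carrier_vertex_map cK; exact: refines_edge_connected phiP conL.
- exact: refines_H1_trivial hL.
- exact: refines_coreless nL.
Qed.

End RefinementCore.

(** * Collapses and cones *)

Section Collapse.
Local Open Scope fset_scope.
Local Open Scope ring_scope.
Context {R : realType} {d : nat}.
Local Notation point := 'rV[R]_d.
Implicit Types (s t r : {fset point}) (A B K L M : {fset {fset point}}) (v : point).

Lemma elementary_collapseP K L : elementary_collapse K L <->
  exists s t, free_pair K s t /\ L = K `\` [fset s; t].
Proof.
split=> [/existsP[s /existsP[t /and3P[st /forallP free /eqP ->]]]|[s [t [[sK tK st free] ->]]]].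
  exists (val s), (val t); split=> //; split=> //; try exact: valP.
  move=> r rK sr; have /implyP/(_ sr)/eqP <- := free [` rK].
  by [].
apply/existsP; exists [` sK]; apply/existsP; exists [` tK] => /=.
rewrite st eqxx andbT /=; apply/forallP => r; apply/implyP => sr.
by apply/eqP/val_inj/free => //; exact: valP.
Qed.

Lemma collapses_refl K : collapses K K.
Proof. by exists [::]. Qed.

Lemma collapses_step K L M : elementary_collapse K L -> collapses L M -> collapses K M.
Proof. by move=> KL [s pathL lastL]; exists (L :: s) => //=; rewrite KL. Qed.

Lemma collapses_trans K L M : collapses K L -> collapses L M -> collapses K M.
Proof.
move=> [s ps <-] [t pt <-]; exists (s ++ t); first by rewrite cat_path ps.
by rewrite last_cat.
Qed.

Lemma free_pair_collapses K s t M : free_pair K s t ->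
  collapses (K `\` [fset s; t]) M -> collapses K M.
Proof. by move=> fp; apply: collapses_step; apply/elementary_collapseP; exists s, t. Qed.

Lemma collapses_ind (P : {fset {fset point}} -> Prop) L :
  P L -> (forall K s t, free_pair K s t -> collapses (K `\` [fset s; t]) L ->
    P (K `\` [fset s; t]) -> P K) ->
  forall K, collapses K L -> P K.
Proof.
move=> PL Pstep K [s]; elim: s K => [|M s IH] K /=; first by move=> _ ->.
move=> /andP[/elementary_collapseP[s1 [t1 [fp ->]]] ps] ls.
by apply: Pstep fp _ _; [exists s|exact: IH].
Qed.

Lemma tree_like_collapsible K : tree_like K -> collapsible K.
Proof.
have [n] := ubnP #|` K|; elim: n => // n IH in K *.
rewrite ltnS => Kn tK; have [[v ->]|[s [t fp]]] := tree_like_free_pair tK.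
  by exists v; exact: collapses_refl.
have [|v cv] := IH _ _ (tree_like_collapse fp tK).
  apply: leq_trans Kn; apply: fproper_ltn_card.
  rewrite fproperE fsubsetDl; apply/fsubsetPn; exists s; first by case: fp.
  by rewrite mem_collapsed eqxx.
by exists v; exact: free_pair_collapses fp cv.
Qed.

Lemma collapsible_tree_like K : face_closed K -> at_most_2dim K -> collapsible K ->
  tree_like K.
Proof.
move=> FK K2 [v cK]; move: FK K2; elim/collapses_ind: K / cK => [_ _|K s t fp _ IH FK K2].
  exact: tree_like_point.
apply: (tree_like_expand FK K2 fp); apply: IH; first exact: free_pair_face_closed.
by move=> r; rewrite mem_collapsed => /and3P[_ _]; exact: K2.
Qed.

Lemma complex_dim_le n K : (forall s, s \in K -> #|` s| <= n.+1)%N -> (complex_dim K <= n)%N.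
Proof.
move=> Kn; rewrite /complex_dim big_seq; apply: (big_ind (fun m => (m <= n)%N)) => // [i j|s sK].
  by rewrite geq_max => -> ->.
by have := Kn s sK; case: #|` s|.
Qed.

Lemma card_le_complex_dim K s : s \in K -> (#|` s| <= (complex_dim K).+1)%N.
Proof.
move=> sK; rewrite (leq_trans (leqSpred _)) // ltnS /complex_dim.
by rewrite (big_fsetD1 s) //= leq_maxl.
Qed.

Lemma deforms_trans n K L M : deforms n K L -> deforms n L M -> deforms n K M.
Proof.
move=> [s [vs ps <-]] [t [vt pt <-]]; exists (s ++ t); split.
- move=> N; rewrite -cat_cons mem_cat => /orP[/vs //|Nt].
  by apply: vt; rewrite inE Nt orbT.
- by rewrite cat_path ps.
- by rewrite last_cat.
Qed.

Lemma deforms_sym n K L : deforms n K L -> deforms n L K.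
Proof.
move=> [s [vs ps <-]]; exists (rev (belast K s)); split.
- move=> M; rewrite inE mem_rev => H; apply: vs; rewrite lastI mem_rcons inE.
  by [].
- rewrite rev_path; apply: sub_path ps => M N /=.
  by rewrite orbC.
- by case: s {vs ps} => //= M s; rewrite rev_cons last_rcons.
Qed.

Lemma collapses_deforms n K L : simplicial_complex K -> (complex_dim K <= n)%N ->
  collapses K L -> deforms n K L.
Proof.
move=> + + KL; elim/collapses_ind: K / KL => [cL Ln|K s t fp _ IH cK Kn].
  by exists [::]; split=> // M; rewrite inE => /eqP ->.
have [FK _] := (simplicial_complexP K).1 cK.
have sub : K `\` [fset s; t] `<=` K by exact: fsubsetDl.
apply: (@deforms_trans _ _ (K `\` [fset s; t])).
  exists [:: K `\` [fset s; t]]; split=> //=; last first.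
    by rewrite andbT; apply/orP; left; apply/elementary_collapseP; exists s, t.
  move=> M; rewrite !inE => /orP[/eqP -> //|/eqP ->]; split.
    exact: simplicial_complex_sub cK sub (free_pair_face_closed FK fp).
  apply: complex_dim_le => r /(fsubsetP sub) rK.
  by apply: leq_trans (card_le_complex_dim rK) _; rewrite ltnS.
apply: IH; first exact: simplicial_complex_sub cK sub (free_pair_face_closed FK fp).
apply: complex_dim_le => r /(fsubsetP sub) rK.
by apply: leq_trans (card_le_complex_dim rK) _; rewrite ltnS.
Qed.

Section Cone.
Context (v : point).

(** Only the simplices containing v are added, those of B being meant to come from A. Thus B can be
    collapsed inside the cone while A stays fixed. *)
Definition attach_cone A B : {fset {fset point}} :=
  A `|` ([fset v] |` [fset v |` (s : {fset point}) | s in B]).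

Definition avoids A : Prop := forall s, s \in A -> v \notin s.

Lemma in_attach_cone A B r : avoids B -> (r \in attach_cone A B) =
  (r \in A) || (v \in r) && ((r `\ v == fset0) || (r `\ v \in B)).
Proof.
move=> vB; rewrite !inE; congr (_ || _); apply/idP/idP.
  move=> /orP[/eqP ->|/imfsetP[s /= sB ->]].
    by rewrite inE eqxx /=; apply/orP; left; apply/eqP/fsetP => q; rewrite !inE andNb.
  rewrite !inE eqxx /= fsetU1K ?vB // sB orbT //.
move=> /andP[vr /orP[/eqP r0|rB]].
  by apply/orP; left; apply/eqP; rewrite -(fsetD1K vr) r0 fsetU0.
by apply/orP; right; apply/imfsetP; exists (r `\ v) => //=; rewrite fsetD1K.
Qed.

(** A coface of v * s contains v, so it is not in A, and removing v from it turns it into a coface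
    of s in B. *)
Lemma cone_free_pair A B s t : face_closed A -> face_closed B -> avoids A -> avoids B ->
  free_pair B s t ->
  free_pair (attach_cone A B) (v |` s) (v |` t) /\
  attach_cone A B `\` [fset (v |` s); (v |` t)] = attach_cone A (B `\` [fset s; t]).
Proof.
move=> FA FB vA vB [sB tB st free].
have vs := vB _ sB; have vt := vB _ tB.
have vB' : avoids (B `\` [fset s; t]).
  by move=> r; rewrite mem_collapsed => /and3P[_ _ /vB].
split; first split.
- by rewrite in_attach_cone // !inE eqxx /= fsetU1K // sB !orbT.
- by rewrite in_attach_cone // !inE eqxx /= fsetU1K // tB !orbT.
- move: (st); rewrite fproperE => /andP[_ ts]; rewrite fproperE.
  apply/andP; split; first exact/fsetUS/fproper_sub.
  by apply: contra ts => /(fsetSD [fset v]); rewrite !fsetU1K.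
- move=> r; rewrite in_attach_cone // fproperE => /orP[rA|/andP[vr /orP[/eqP r0|rB]]] /andP[sr rs].
  + by have := vA r rA; rewrite (fsubsetP sr) // !inE eqxx.
  + have [x xs] := face_neq0 FB sB.
    have : x \in r `\ v.
      rewrite !inE (fsubsetP sr) ?inE ?xs ?orbT // andbT.
      by apply: contraNneq vs => <-.
    by rewrite r0 inE.
  + rewrite -(fsetD1K vr); congr (_ |` _); apply: free => //.
    rewrite fproperE -{1}(fsetU1K vs) fsetSD //=.
    by apply: contra rs => rs; rewrite -(fsetD1K vr) fsetUS.
apply/fsetP => r; rewrite mem_collapsed !in_attach_cone // mem_collapsed.
have [vr|vr] := boolP (v \in r); last first.
  have neq q : r != v |` q by apply: contraNneq vr => ->; rewrite !inE eqxx.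
  by rewrite !neq.
have rA : r \in A = false by apply/negP => /vA; rewrite vr.
have E q : v \notin q -> (r == v |` q) = (r `\ v == q).
  move=> vq; apply/eqP/eqP => [->|<-]; first by rewrite fsetU1K.
  by rewrite fsetD1K.
rewrite rA /= !E //; have [r0|_] //= := eqVneq (r `\ v) fset0.
rewrite r0 !(eq_sym fset0).
have [x xs] := face_neq0 FB sB; have [y yt] := face_neq0 FB tB.
rewrite andbT; apply/andP; split; apply/fset0Pn; [by exists x|by exists y].
Qed.

(** The collapse of B is lifted pair by pair to the cone. What remains is the edge from v to the
    last vertex q, whose free face is v. *)
Lemma cone_collapses A B : face_closed A -> avoids A -> face_closed B -> avoids B ->
  collapsible B -> collapses (attach_cone A B) A.
Proof.
move=> FA vA FB vB [q cB]; move: FB vB; elim/collapses_ind: B / cB => [FB vB|B s t fp _ IH FB vB].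
  have vq : v != q by have := vB [fset q]; rewrite !inE eqxx => /(_ isT).
  have mem := in_attach_cone A _ vB.
  have qE : [fset v; q] `\ v = [fset q].
    by rewrite fsetU1K // inE.
  have vE : [fset v] `\ v = fset0 :> {fset point} by rewrite fsetDv.
  apply: (@free_pair_collapses _ [fset v] [fset v; q]).
    split; first by rewrite mem vE inE !eqxx orbT.
    - by rewrite mem qE !inE !eqxx !orbT.
    - rewrite fproperEneq fsubsetUl andbT; apply/eqP => /fsetP/(_ q).
      by rewrite !inE eqxx orbT eq_sym (negPf vq).
    - move=> r; rewrite mem fproperE fsub1set => /orP[rA|/andP[vr /orP[/eqP r0|rq]]] /andP[vr' rv].
      + by have := vA r rA; rewrite vr'.
      + by move: rv; rewrite -(fsetD1K vr) r0 fsetU0 fsubset_refl.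
      + by rewrite -(fsetD1K vr); move: rq; rewrite inE => /eqP ->.
  have -> : attach_cone A [fset [fset q]] `\` [fset [fset v]; [fset v; q]] = A.
    apply/fsetP => r; rewrite mem_collapsed mem.
    have [vr|vr] := boolP (v \in r); last first.
      have -> : r != [fset v] by apply: contraNneq vr => ->; rewrite !inE eqxx.
      have -> : r != [fset v; q] by apply: contraNneq vr => ->; rewrite !inE eqxx.
      by rewrite /= orbF.
    have -> : (r \in A) = false by apply/negP => /vA; rewrite vr.
    apply/negbTE/negP => /and3P[rv rvq /= /orP[/eqP r0|]].
      by move/eqP: rv; apply; rewrite -(fsetD1K vr) r0 fsetU0.
    by rewrite inE => /eqP rq; move/eqP: rvq; apply; rewrite -(fsetD1K vr) rq.
  exact: collapses_refl.
have [fp' E] := cone_free_pair FA FB vA vB fp.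
apply: free_pair_collapses fp' _; rewrite E; apply: IH; first exact: free_pair_face_closed.
by move=> r; rewrite mem_collapsed => /and3P[_ _ /vB].
Qed.

(* Push the cone on B in from the simplices of B outside A, largest first. *)
Lemma cone_sweep A B : face_closed A -> face_closed B -> avoids A -> avoids B ->
  collapses (attach_cone (A `|` B) B) (attach_cone A (A `&` B)).
Proof.
move=> FA + vA; have [n] := ubnP #|` B|; elim: n => // n IH in B *.
rewrite ltnS => Bn FB vB; have [BA|] := boolP (B `<=` A).
  by rewrite (fsetUidPl _ _ BA) (fsetIidPr BA); exact: collapses_refl.
move=> /fsubsetPn[s0 s0B s0A].
have s0X : s0 \in B `\` A by rewrite inE s0A.
have [s sX smax] := seq_argmax (fun s : {fset point} => #|` s|%:R : R) s0X.
move: (sX); rewrite inE => /andP[sA sB].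
have max r : r \in B -> s `<=` r -> r = s.
  move=> rB sr; apply/eqP; rewrite eq_sym eqEfcard sr -(ler_nat R) smax // inE rB andbT.
  by apply: contra sA => rA; apply: FA.2 rA sr _; apply: contraNneq FB.1 => <-.
have vs := vB s sB; pose B' := B `\ s.
have FB' : face_closed B'.
  split; first by rewrite !inE (negPf FB.1) andbF.
  move=> r t; rewrite !inE => /andP[rs rB] tr t0; rewrite (FB.2 r) // andbT.
  by apply: contra_neq rs => ts; apply: max => //; rewrite -ts.
have vB' : avoids B' by move=> r; rewrite !inE => /andP[_ /vB].
have IB' : A `&` B = A `&` B'.
  by apply/fsetP => r; rewrite !inE; case: eqVneq => // ->; rewrite (negPf sA).
have sE : (v |` s) `\ v = s by rewrite fsetU1K.
apply: (@free_pair_collapses _ s (v |` s)).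
  split.
  - by rewrite in_attach_cone // inE sB orbT.
  - by rewrite in_attach_cone // sE sB !inE eqxx !orbT.
  - rewrite fproperEneq fsubsetUr andbT; apply: contraNneq vs => ->.
    by rewrite !inE eqxx.
  - move=> r; rewrite in_attach_cone // fproperE inE.
    move=> /orP[/orP[rA|rB]|/andP[vr /orP[/eqP r0|rB]]] /andP[sr rs].
    + exfalso; move/negP: sA; apply; apply: FA.2 rA sr _.
      by apply: contraNneq FB.1 => <-.
    + by move: rs; rewrite (max r rB sr) fsubset_refl.
    + have [x xs] := face_neq0 FB sB; have : x \in r `\ v.
        by rewrite !inE (fsubsetP sr) // andbT; apply: contraNneq vs => <-.
      by rewrite r0 inE.
    + rewrite -(fsetD1K vr); congr (_ |` _); apply: max => //.
      apply/fsubsetP => x xs; rewrite !inE (fsubsetP sr) // andbT.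
      by apply: contraNneq vs => <-.
rewrite IB'; have -> : attach_cone (A `|` B) B `\` [fset s; v |` s] = attach_cone (A `|` B') B'.
  apply/fsetP => r; rewrite mem_collapsed !in_attach_cone // !in_fsetU.
  have [vr|vr] := boolP (v \in r); last first.
    rewrite /= !orbF !inE; have -> : r != v |` s.
      by apply: contraNneq vr => ->; rewrite !inE eqxx.
    have [->|rs] //= := eqVneq r s; by rewrite (negPf sA).
  have -> : (r \in A) = false by apply/negP => /vA; rewrite vr.
  have -> : (r \in B) = false by apply/negP => /vB; rewrite vr.
  have -> : (r \in B') = false by apply/negP => /vB'; rewrite vr.
  have -> : r != s by apply: contraNneq vs => <-.
  have -> : (r == v |` s) = (r `\ v == s).
    by apply/eqP/eqP => [->|<-]; rewrite ?fsetD1K.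
  rewrite /= !inE; have [r0|_] //= := eqVneq (r `\ v) fset0.
  rewrite r0 andbT; have [x xs] := face_neq0 FB sB.
  by rewrite eq_sym; apply/fset0Pn; exists x.
apply: IH => //; apply: leq_trans Bn.
by rewrite [leqRHS](cardfsD1 s) sB.
Qed.

Lemma attach_cone_face_closed A B : face_closed A -> avoids B -> B `<=` A -> face_closed B ->
  face_closed (attach_cone A B).
Proof.
move=> FA vB BA FB; split; first by rewrite in_attach_cone // inE (negPf FA.1).
move=> s t; rewrite !in_attach_cone // => sC ts t0.
have tD : t `\ v `<=` s `\ v by exact: fsetSD.
case/orP: sC => [sA|/andP[vs sB]]; first by rewrite (FA.2 s).
have tB : t `\ v != fset0 -> t `\ v \in B.
  move=> tv0; case/orP: sB => [/eqP s0|sB]; last exact: FB.2 sB tD tv0.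
  by move: tv0; rewrite -fsubset0 -s0 tD.
have [vt|vt] := boolP (v \in t).
  by apply/orP; right => /=; case: eqVneq => //= /tB.
apply/orP; left; apply: (fsubsetP BA); have tE : t `\ v = t.
  by apply/fsetP => x; rewrite !inE; case: eqVneq => // ->; rewrite (negPf vt).
by move: tB; rewrite tE; apply.
Qed.

Lemma attach_cone_card A B n : avoids B -> (forall s, s \in A -> #|` s| <= n)%N -> B `<=` A ->
  (forall s, s \in attach_cone A B -> #|` s| <= n.+1)%N.
Proof.
move=> vB An BA s; rewrite in_attach_cone // => /orP[/An /leqW //|/andP[vs]].
rewrite (cardfsD1 v) vs add1n ltnS => /orP[/eqP ->|/(fsubsetP BA) /An //].
by rewrite cardfs0.
Qed.

(** The form f reads off the weight of v at a point. If this weight is not 1, projecting from v to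
    the hyperplane f = 0 gives a point of A, whose coordinates are unique; if it is 1, no other
    vertex has weight. *)
Lemma attach_cone_simplicial A B (f : 'cV[R]_d * R) : simplicial_complex A ->
  B `<=` A -> face_closed B ->
  affine_form f v = 1 ->
  (forall s x, s \in A -> x \in s -> affine_form f x = 0) ->
  simplicial_complex (attach_cone A B).
Proof.
move=> /simplicial_complexP[FA UA] /fsubsetP BA FB fv fA.
have vA : avoids A.
  by move=> s sA; apply/negP => vs; have := fA s v sA vs; rewrite fv => /eqP; rewrite oner_eq0.
have vB : avoids B by move=> s /BA; exact: vA.
apply/simplicial_complexP; split.
  by apply: attach_cone_face_closed => //; exact/fsubsetP.
have base r w x : r \in attach_cone A B -> barycentric r w x ->
    affine_form f x = w v /\ (w v != 1 -> exists2 s, s \in A &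
      barycentric s (fun u => if u == v then 0 else w u / (1 - w v)) ((1 - w v)^-1 *: (x - w v *: v))).
  move=> rC wx; have rA x' : x' \in r -> x' != v -> affine_form f x' = 0.
    move=> x'r x'v; move: rC; rewrite in_attach_cone // => /orP[rA|/andP[vr /orP[/eqP r0|rB]]].
    - exact: fA rA x'r.
    - by have : x' \in r `\ v by [rewrite !inE x'v]; rewrite r0 inE.
    - by apply: (fA (r `\ v)); [exact: BA|rewrite !inE x'v].
  have [w0 ws w1 wE] := wx.
  have split_sum (M : zmodType) (g : point -> M) : (forall u, w u = 0 -> g u = 0) ->
      \sum_(u <- r) g u = g v + \sum_(u <- r `\ v) g u.
    move=> g0; have [vr|vr] := boolP (v \in r); first by rewrite (big_fsetD1 v).
    rewrite g0 ?ws // add0r; congr (\sum_(u <- _) _); congr enum_fset.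
    by apply/fsetP => u; rewrite !inE; case: eqVneq => // ->; rewrite (negPf vr).
  split.
    rewrite (affine_form_barycentric f wx) split_sum; last by move=> u ->; rewrite mul0r.
    rewrite fv mulr1 big_seq big1 ?addr0 // => u; rewrite !inE => /andP[uv ur].
    by rewrite rA // mulr0.
  move=> wv; have wv0 : 1 - w v != 0 by rewrite subr_eq0 eq_sym.
  have wv1 : w v <= 1 by exact: barycentric_le1 wx.
  have S1 : \sum_(u <- r `\ v) w u = 1 - w v.
    by rewrite -w1 split_sum // addrAC subrr add0r.
  have Sx : \sum_(u <- r `\ v) w u *: u = x - w v *: v.
    by rewrite -wE split_sum ?[_ + \sum_(_ <- _) _]addrC ?addrK // => u ->; rewrite scale0r.
  exists (r `\ v).
    move: rC; rewrite in_attach_cone // => /orP[rA'|/andP[_ /orP[/eqP r0|/BA //]]].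
      apply: (FA.2 r) => //; first exact: fsubD1set.
      by apply: contra_neq wv0 => r0; rewrite -S1 r0 big_seq_fset0.
    by move: wv0; rewrite -S1 r0 big_seq_fset0 eqxx.
  split.
  - by move=> u; case: ifP => // _; rewrite divr_ge0 // subr_ge0.
  - by move=> u; rewrite !inE negb_and negbK => /orP[->//|/ws ->]; rewrite mul0r if_same.
  - rewrite -[RHS](divff wv0) -S1 mulr_suml; apply: eq_big_seq => u.
    by rewrite !inE => /andP[/negPf -> _].
  - rewrite -Sx scaler_sumr; apply: eq_big_seq => u.
    by rewrite !inE => /andP[/negPf -> _]; rewrite scalerA mulrC.
move=> r t w w' x rC tC wx w'x.
have [fx Hw] := base r w x rC wx; have [fx' Hw'] := base t w' x tC w'x.
have wv : w v = w' v by rewrite -fx.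
have [w1|w1] := eqVneq (w v) 1; last first.
  have [s sA sw] := Hw w1; have [|s' s'A sw'] := Hw'; first by rewrite -wv.
  rewrite -wv in sw'; have := UA _ _ _ _ _ sA s'A sw sw' => E.
  apply/funext => u; have [->//|uv] := eqVneq u v.
  have := congr1 (@^~ u) E; rewrite /= (negPf uv) => /mulIf; apply.
  by rewrite invr_eq0 subr_eq0 eq_sym.
have apex q c : barycentric q c x -> c v = 1 -> forall u, u != v -> c u = 0.
  move=> [c0 cs c1 _] cv u uv; have [uq|uq] := boolP (u \in q); last exact: cs.
  have vq : v \in q.
    by apply: contraT => /cs; rewrite cv => /eqP; rewrite oner_eq0.
  move: c1; rewrite (big_fsetD1 v) //= cv => /eqP.
  rewrite -subr_eq0 addrAC subrr add0r (big_fsetD1 u) /=; last by rewrite !inE uv.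
  rewrite paddr_eq0 ?sumr_ge0 // => /andP[/eqP //].
apply/funext => u; have [->//|uv] := eqVneq u v.
by rewrite (apex _ _ wx w1 u uv) (apex _ _ w'x _ u uv) // -wv.
Qed.

End Cone.
End Collapse.

(** * Piecewise linear maps *)

Section AffineMaps.
Local Open Scope fset_scope.
Local Open Scope ring_scope.
Context {R : realType} {d e : nat}.
Implicit Types (s t r : {fset 'rV[R]_d}) (K L N : {fset {fset 'rV[R]_d}}).
Implicit Types (f : 'rV[R]_d -> 'rV[R]_e) (h : 'rV[R]_e -> 'rV[R]_d).

Lemma affine_on_barycentric s f w x : affine_on s f -> barycentric s w x ->
  f x = \sum_(v <- s) w v *: f v.
Proof. by move=> sf [w0 _ w1 <-]; exact: sf. Qed.

Lemma affine_on_sub s r f : (forall v, v \in s -> hull r v) ->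
  affine_on r f -> affine_on s f.
Proof.
move=> sr rf w w0 w1.
have [w' w'x] : exists w', barycentric s w' (\sum_(v <- s) w v *: v).
  by apply/hullP; exists w.
pose w2 v := if v \in s then w v else 0.
have E (M : zmodType) (g : 'rV[R]_d -> R -> M) :
    \sum_(v <- s) g v (w v) = \sum_(v <- s) g v (w2 v).
  by apply: eq_big_seq => v vs; rewrite /w2 vs.
have w2x : barycentric s w2 (\sum_(v <- s) w v *: v).
  split; [| |by rewrite -(E _ (fun _ a => a))|by rewrite -(E _ (fun v a => a *: v))].
    by move=> v; rewrite /w2; case: ifP => // /w0.
  by move=> v; rewrite /w2 => /negPf ->.
have /choice[c cP] : forall v, exists c, v \in s -> barycentric r c v.
  move=> v; have [/sr/hullP[c cv]|_] := boolP (v \in s); first by exists c.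
  by exists w.
rewrite (affine_on_barycentric rf (barycentric_comp w2x cP)).
rewrite (E _ (fun v a => a *: f v)); under eq_bigr do rewrite scaler_suml.
rewrite exchange_big /=; apply: eq_big_seq => v vs.
rewrite (affine_on_barycentric rf (cP v vs)) scaler_sumr.
by apply: eq_bigr => u _; rewrite scalerA.
Qed.

Section Injective.
Context (K : {fset {fset 'rV[R]_d}}) (f : 'rV[R]_d -> 'rV[R]_e) (h : 'rV[R]_e -> 'rV[R]_d).
Hypotheses (cK : simplicial_complex K) (Kf : forall s, s \in K -> affine_on s f).
Hypothesis fK : forall x, space K x -> h (f x) = x.

Let FK : face_closed K. Proof. exact: ((simplicial_complexP K).1 cK).1. Qed.
Let UK : unique_coordinates K. Proof. exact: ((simplicial_complexP K).1 cK).2. Qed.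

Let hK s x : s \in K -> x \in s -> h (f x) = x.
Proof. by move=> sK xs; apply: fK; exists s => //; exact: hull_vertex. Qed.

Let finj s : s \in K -> {in s &, injective f}.
Proof. by move=> sK x y xs ys /(congr1 h); rewrite !(hK sK). Qed.

Lemma map_vertex_face_closed : face_closed (map_complex f K).
Proof. exact: map_complex_face_closed. Qed.

Let pull s (w : 'rV[R]_e -> R) v := if v \in s then w (f v) else 0.

Let pull_sum (M : zmodType) s w (g : 'rV[R]_e -> R -> M) : s \in K ->
  \sum_(y <- f @` s) g y (w y) = \sum_(v <- s) g (f v) (pull s w v).
Proof.
move=> sK; rewrite big_imfset /=; last exact: finj.
by apply: eq_big_seq => v vs; rewrite /pull vs.
Qed.

Let pull_barycentric s w y : s \in K -> barycentric (f @` s) w y ->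
  exists2 x, barycentric s (pull s w) x & f x = y.
Proof.
move=> sK [w0 ws w1 wy]; exists (\sum_(v <- s) pull s w v *: v).
  split=> //; first by move=> v; rewrite /pull; case: ifP.
    by move=> v; rewrite /pull => /negPf ->.
  by rewrite -w1 -(pull_sum w (fun _ a => a)).
rewrite Kf //.
- by rewrite -wy (pull_sum w (fun v a => a *: v)).
- by move=> v vs; rewrite /pull vs.
- by rewrite -w1 -(pull_sum w (fun _ a => a)).
Qed.

(** Coordinates in the image pull back to coordinates in K of points with equal images; the left
    inverse h identifies these points, and uniqueness in K applies. *)
Lemma map_simplicial : simplicial_complex (map_complex f K).
Proof.
apply/simplicial_complexP; split; first exact: map_vertex_face_closed.
move=> _ _ w w' y /map_complexP[s sK ->] /map_complexP[t tK ->] wy w'y.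
have [x wx fx] := pull_barycentric sK wy; have [x' w'x fx'] := pull_barycentric tK w'y.
have xx' : x = x'.
  rewrite -[x]fK; last by exists s => //; apply/hullP; eexists; exact: wx.
  rewrite fx -fx' fK //; exists t => //; apply/hullP; eexists; exact: w'x.
rewrite -xx' in w'x; have E := UK sK tK wx w'x.
have [_ ws _ _] := wy; have [_ ws' _ _] := w'y.
have key q q' c c' v : q \in K -> q' \in K -> v \in q ->
    (forall y, y \notin f @` q' -> c' y = 0) -> pull q c v = pull q' c' v -> c (f v) = c' (f v).
  move=> qK q'K vq c0; rewrite {1}/pull vq => ->; rewrite /pull; case: ifP => // vq'.
  rewrite c0 //; apply: contraFN vq' => /imfsetP[v' /= v'q' /(congr1 h)].
  by rewrite (hK qK) // (hK q'K) // => ->.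
apply/funext => p; have [/imfsetP[v /= vs ->]|ps] := boolP (p \in f @` s).
  by apply: (key s t) => //; rewrite E.
have [/imfsetP[v /= vt ->]|pt] := boolP (p \in f @` t); last by rewrite ws // ws'.
by apply/esym/(key t s) => //; rewrite E.
Qed.

Lemma map_hull s y : s \in K -> hull (f @` s) y <-> exists2 x, hull s x & f x = y.
Proof.
move=> sK; split=> [/hullP[w wy]|[x /hullP[w wx] <-]].
  by have [x wx fx] := pull_barycentric sK wy; exists x => //; apply/hullP; eexists; exact: wx.
rewrite (affine_on_barycentric (Kf sK) wx).
have [w0 ws w1 _] := wx; exists (w \o h); split.
- by move=> v _ /=.
- rewrite -w1 big_imfset /=; last exact: finj.
  by apply: eq_big_seq => v vs; rewrite (hK sK).
- rewrite big_imfset /=; last exact: finj.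
  by apply: eq_big_seq => v vs; rewrite (hK sK).
Qed.

Lemma map_space : space (map_complex f K) = (f @` space K)%classic.
Proof.
apply/seteqP; split=> [y [_ /map_complexP[s sK ->] /(map_hull _ sK)[x sx <-]]|_ [x [s sK sx] <-]].
  by exists x => //; exists s.
exists (f @` s); first by apply/map_complexP; exists s.
by apply/(map_hull _ sK); exists x.
Qed.

Lemma map_tree_like : tree_like K -> tree_like (map_complex f K).
Proof. by apply: (tree_like_map (h := h)) => s x; exact: hK. Qed.

End Injective.

Lemma refines_affine_on L N f : refines L N -> (forall s, s \in N -> affine_on s f) ->
  forall s, s \in L -> affine_on s f.
Proof. by move=> [LN _] Nf s /LN[r /Nf rf sr]; exact: affine_on_sub sr rf. Qed.

(** K is cut along all simplices of N; since the spaces agree, every simplex of the result lies in a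
    simplex of N. This connects arbitrary triangulations of a space to stellar subdivisions. *)
Lemma refines_stellar K N : simplicial_complex K -> simplicial_complex N ->
  space K = space N -> exists2 L, stellar_subdivision K L & refines L N.
Proof.
move=> cK cN KN; have [_ _ Ni _] := cN.
have [L KL LN] := stellar_compatible cK Ni.
exists L => //; have [FL _] := (simplicial_complexP L).1 (stellar_simplicial KL cK).
have LK := refines_space (stellar_refines KL cK).
rewrite -{1}(inside_all FL LN); last by rewrite LK KN.
by apply: refines_inside => // r x rN rx; rewrite LK KN; exists r.
Qed.

Lemma simplicial_space_card n K N : simplicial_complex K ->
  (space K `<=` space N)%classic -> (forall s, s \in N -> #|` s| <= n)%N ->
  forall s, s \in K -> (#|` s| <= n)%N.
Proof.
move=> [_ _ Ki _] KN Nn s sK; apply: (hull_cover_card (Ki s sK) Nn) => x sx.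
by apply: KN; exists s.
Qed.

End AffineMaps.

(** * Triangulations of a polyhedron and of the pieces of its cover *)

Section Polyhedra.
Local Open Scope fset_scope.
Local Open Scope ring_scope.
Context {R : realType}.

(** The map h is affine only on the simplices of some other complex with the same space. A stellar
    subdivision of M refining that complex is carried by h to straight simplices in the space of P,
    and being stellar it inherits [tree_like] from M. *)
Lemma pl_homeomorphism_refinement d e (M : {fset {fset 'rV[R]_e}})
    (h : 'rV[R]_e -> 'rV[R]_d) (P : set 'rV[R]_d) : triangulation M h P ->
  exists N, [/\ stellar_subdivision M N, space N = space M,
    simplicial_complex (map_complex h N), space (map_complex h N) = P &
    (forall s, s \in N -> #|` h @` s| = #|` s|) /\
    (tree_like N -> tree_like (map_complex h N))].
Proof.
move=> [cM [[N [cN NM Nh]] hM [k _ kh]]].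
have [L ML LN] := refines_stellar cM cN (esym NM).
have cL := stellar_simplicial ML cM.
have LM := refines_space (stellar_refines ML cM).
have Lh := refines_affine_on LN Nh.
have khL x : space L x -> k (h x) = x by rewrite LM; exact: kh.
exists L; split=> //.
- exact: map_simplicial cL Lh khL.
- by rewrite (map_space Lh khL) LM hM.
split=> [s sL|]; last exact: map_tree_like khL.
apply: (card_map_face (h := k) (K := L)) => // q x qL xq.
by apply: khL; exists q => //; exact: hull_vertex.
Qed.

Lemma polyhedron_dim_card d (K : {fset {fset 'rV[R]_d}}) n : simplicial_complex K ->
  polyhedron_dim (space K) n -> forall s, s \in K -> (#|` s| <= n.+1)%N.
Proof.
move=> cK [e [M [h [Mh Mn]]]].
have [N [MN _ cA AP [cardA _]]] := pl_homeomorphism_refinement Mh.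
apply: (simplicial_space_card (N := map_complex h N) cK); first by rewrite AP.
move=> _ /map_complexP[s sN ->]; rewrite cardA //.
apply: (stellar_card MN) sN => r rM.
by apply: leq_trans (card_le_complex_dim rM) _; rewrite Mn.
Qed.

Lemma pl_collapsible_tree_like d (K : {fset {fset 'rV[R]_d}}) (Q : set 'rV[R]_d) :
  simplicial_complex K -> at_most_2dim K -> (Q `<=` space K)%classic -> pl_collapsible Q ->
  exists A, [/\ simplicial_complex A, tree_like A & space A = Q].
Proof.
move=> cK K2 QK [e [M [h [Mh cM]]]].
have [N [MN NM cA AQ [cardA treeA]]] := pl_homeomorphism_refinement Mh.
have sM : simplicial_complex M by case: Mh.
(* The dimension bound starts from the ambient K: it passes to the image in Q, then to N, whose
   simplices have equally many vertices, then to M, which has the space of N. *)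
have A2 : at_most_2dim (map_complex h N).
  by apply: (simplicial_space_card (N := K) cA) K2; rewrite AQ.
have N2 : at_most_2dim N.
  move=> s sN; rewrite -cardA //; apply: A2; apply/map_complexP; by exists s.
have M2 : at_most_2dim M.
  by apply: (simplicial_space_card (N := N) sM) N2; rewrite NM.
have [FM _] := (simplicial_complexP M).1 sM.
exists (map_complex h N); split=> //; apply: treeA.
exact: stellar_tree_like MN (collapsible_tree_like FM M2 cM).
Qed.

(** One descends from A to a stellar subdivision that refines K and then climbs back to K: in
    dimension 2 the property depends only on the space. *)
Lemma tree_like_of_space d (K A : {fset {fset 'rV[R]_d}}) : simplicial_complex K ->
  simplicial_complex A -> space K = space A -> tree_like A -> tree_like K.
Proof.
move=> cK cA KA tA; have [B AB BK] := refines_stellar cA cK (esym KA).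
have A2 : at_most_2dim A by case: tA.
apply: (refines_tree_like (stellar_simplicial AB cA) cK BK).
  by apply: (simplicial_space_card (N := A) cK) A2; rewrite KA.
exact: stellar_tree_like tA.
Qed.

Lemma tree_like_cover d (K0 : {fset {fset 'rV[R]_d}}) (P1 P2 : set 'rV[R]_d) :
  simplicial_complex K0 -> at_most_2dim K0 -> space K0 = (P1 `|` P2)%classic ->
  pl_collapsible P1 -> pl_collapsible P2 ->
  exists K1 K2 : {fset {fset 'rV[R]_d}},
    [/\ simplicial_complex (K1 `|` K2), space (K1 `|` K2) = space K0,
        at_most_2dim (K1 `|` K2), tree_like K1 & tree_like K2].
Proof.
move=> cK0 K02 K0E c1 c2.
have [|A1 [cA1 tA1 A1P]] := pl_collapsible_tree_like cK0 K02 _ c1.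
  by rewrite K0E; exact: subsetUl.
have [|A2 [cA2 tA2 A2P]] := pl_collapsible_tree_like cK0 K02 _ c2.
  by rewrite K0E; exact: subsetUr.
(* The union of A1 and A2 serves as a family of simplices to cut along; it need not be a complex, as
   simplices of A1 may cross those of A2. *)
have [|K K0K KA] := @stellar_compatible _ _ K0 (A1 `|` A2) cK0.
  by move=> r; rewrite inE => /orP[]; [case: cA1 => _ _ + _|case: cA2 => _ _ + _]; apply.
have cK := stellar_simplicial K0K cK0.
have KK0 := refines_space (stellar_refines K0K cK0).
have [FK _] := (simplicial_complexP K).1 cK.
have sub A : (space A `<=` space K)%classic -> A `<=` A1 `|` A2 -> simplicial_complex A ->
    tree_like A -> simplicial_complex (inside A K) -> tree_like (inside A K).
  move=> AK /fsubsetP AA cA tA cI; apply: tree_like_of_space cA _ tA => //.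
  apply/refines_space/refines_inside => //; first by move=> r /AA; exact: KA.
  by move=> r x rA rx; apply: AK; exists r.
have cI A : simplicial_complex (inside A K).
  exact: simplicial_complex_sub cK (inside_sub A K) (face_closed_inside A FK).
have KE : inside A1 K `|` inside A2 K = K.
  rewrite -[RHS](@inside_all _ _ (A1 `|` A2)) //.
    apply/fsetP => s; rewrite in_fsetU; apply/orP/insideP.
      by move=> [] /insideP[sK [r rA sr]]; split=> //; exists r; rewrite // inE rA ?orbT.
    move=> [sK [r]]; rewrite inE => /orP[] rA sr; [left|right]; apply/insideP;
      by split=> //; exists r.
  move=> x; rewrite KK0 K0E -A1P -A2P => -[] [r rA rx]; exists r; rewrite // inE rA ?orbT //.
exists (inside A1 K), (inside A2 K); rewrite KE; split=> //.
- exact: stellar_card K0K K02.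
- by apply: sub => //; [rewrite A1P KK0 K0E; exact: subsetUl|exact: fsubsetUl].
- by apply: sub => //; [rewrite A2P KK0 K0E; exact: subsetUr|exact: fsubsetUr].
Qed.

(** Makes room for the cone vertex: the complex is placed at height 0 and the apex will be at height
    1. *)
Definition height_embedding d (x : 'rV[R]_d) : 'rV[R]_(d + 1) := row_mx x 0.

Definition height_form d : 'cV[R]_(d + 1) * R := (delta_mx (rshift d 0) 0, 0).

Lemma height_formE d (x : 'rV[R]_(d + 1)) :
  affine_form (height_form d) x = x 0 (rshift d 0).
Proof.
rewrite /affine_form addr0 /= mxE (bigD1 (rshift d 0)) //= mxE !eqxx mulr1 big1 ?addr0 //.
by move=> i ij; rewrite mxE (negPf ij) mulr0.
Qed.

Lemma linear_affine_on d e (f : {linear 'rV[R]_d -> 'rV[R]_e}) s : affine_on s f.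
Proof.
move=> w _ _; rewrite linear_sum; apply: eq_bigr => v _; exact: linearZ.
Qed.

Lemma height_embedding_affine d (s : {fset 'rV[R]_d}) : affine_on s (@height_embedding d).
Proof.
move=> w _ _; rewrite /height_embedding.
rewrite -[row_mx _ 0]/(row_mx (\sum_(v <- s) w v *: v) (0 : 'rV[R]_1)).
under [RHS]eq_bigr do rewrite scale_row_mx scaler0.
apply/rowP => j; rewrite summxE; case: (split_ordP j) => k ->.
  by rewrite row_mxEl summxE; apply: eq_bigr => v _; rewrite row_mxEl.
by rewrite row_mxEr mxE big1 // => v _; rewrite row_mxEr mxE.
Qed.

Lemma lsubmx_affine d (s : {fset 'rV[R]_(d + 1)}) : affine_on s (@lsubmx R 1 d 1).
Proof. exact: (@linear_affine_on _ _ (@lsubmx R 1 d 1)). Qed.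

Lemma point_complex d (x : 'rV[R]_d) : simplicial_complex [fset [fset x]].
Proof.
apply/simplicial_complexP; split; first by have [] := tree_like_point x.
move=> s t w w' y; rewrite !inE => /eqP -> /eqP -> wy wy'.
apply: affinely_independent_coordinates wy wy' => c.
by rewrite !big_seq_fset1 => c0 _ v; rewrite inE => /eqP ->.
Qed.

Lemma point_space d (x : 'rV[R]_d) : space [fset [fset x]] = [set x].
Proof.
apply/seteqP; split=> [y [s]|_ ->]; first by rewrite inE => /eqP -> /hull1.
by exists [fset x]; [rewrite inE|exact/hull_vertex/fset11].
Qed.

Lemma point_triangulation d e (x : 'rV[R]_d) (y : 'rV[R]_e) :
  triangulation [fset [fset y]] (fun=> x) [set x].
Proof.
split; first exact: point_complex.
rewrite point_space; split.
- exists [fset [fset y]]; rewrite point_space; split=> //; first exact: point_complex.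
  by move=> s _ w _ w1; rewrite -scaler_suml w1 scale1r.
- by apply/seteqP; split=> [_ [? _ <-]|_ ->] //=; exists y.
exists (fun=> y) => [|_ -> //]; exists [fset [fset x]]; rewrite point_space; split=> //.
  exact: point_complex.
by move=> s _ w _ w1; rewrite -scaler_suml w1 scale1r.
Qed.

(** All complexes of a deformation share one ambient space, so the polyhedron has to be triangulated
    by the copy at height 0, with the projection as its map. *)
Lemma height_triangulation d (K : {fset {fset 'rV[R]_d}}) : simplicial_complex K ->
  triangulation (map_complex (@height_embedding d) K) lsubmx (space K).
Proof.
move=> cK; have Kf s : s \in K -> affine_on s (@height_embedding d).
  by move=> _; exact: height_embedding_affine.
have fK (x : 'rV[R]_d) : space K x -> lsubmx (height_embedding x) = x.
  by move=> _; rewrite /height_embedding row_mxKl.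
have cM := map_simplicial cK Kf fK; split=> //; split.
- exists (map_complex (@height_embedding d) K); split=> // s _; exact: lsubmx_affine.
- rewrite (map_space Kf fK); apply/seteqP; split=> [_ [_ [x Kx <-] <-]|x Kx].
    by rewrite fK.
  by exists (height_embedding x); [exists x|exact: fK].
exists (@height_embedding d); first by exists K.
by move=> y; rewrite (map_space Kf fK) => -[x Kx <-]; rewrite fK.
Qed.

Lemma tree_like_union_deforms d (K1 K2 : {fset {fset 'rV[R]_d}}) :
  simplicial_complex (K1 `|` K2) -> at_most_2dim (K1 `|` K2) ->
  tree_like K1 -> tree_like K2 -> tree_like (K1 `&` K2) ->
  exists x : 'rV[R]_d, pl_deforms 3 (space (K1 `|` K2)) [set x].
Proof.
(* The target point is arbitrary: a single vertex in any space triangulates it. *)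
move=> cK K2d t1 t2 t12; exists 0.
pose f := @height_embedding d; pose v : 'rV[R]_(d + 1) := row_mx 0 1.
have fI : injective f by move=> x y /eq_row_mx[].
have tf K : tree_like K -> tree_like (map_complex f K).
  by apply: (tree_like_map (h := lsubmx)) => s x _ _; rewrite /f /height_embedding row_mxKl.
pose M1 := map_complex f K1; pose M2 := map_complex f K2.
have MU : map_complex f (K1 `|` K2) = M1 `|` M2 by exact: imfsetU.
have MI : map_complex f (K1 `&` K2) = M1 `&` M2.
  apply: imfsetI => s t _ _ /= st; apply/fsetP => x.
  by have := congr1 (fun q : {fset _} => f x \in q) st; rewrite /= !mem_imfset.
have cM : simplicial_complex (M1 `|` M2).
  rewrite -MU; apply: (map_simplicial (h := lsubmx) cK).
    by move=> s _; exact: height_embedding_affine.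
  by move=> x _; rewrite /height_embedding row_mxKl.
have T1 : tree_like M1 := tf _ t1; have T2 : tree_like M2 := tf _ t2.
have T12 : tree_like (M1 `&` M2) by rewrite -MI; exact: tf.
have F1 : face_closed M1 by case: T1.
have F2 : face_closed M2 by case: T2.
have FU : face_closed (M1 `|` M2) := ((simplicial_complexP _).1 cM).1.
have flat s x : s \in M1 `|` M2 -> x \in s -> affine_form (height_form d) x = 0.
  rewrite -MU => /map_complexP[r _ ->] /imfsetP[y /= _ ->].
  by rewrite height_formE row_mxEr mxE.
have fv : affine_form (height_form d) v = 1 by rewrite height_formE row_mxEr mxE eqxx.
have cC : simplicial_complex (attach_cone v (M1 `|` M2) M2).
  by apply: attach_cone_simplicial fv flat => //; exact: fsubsetUr.
have vU : avoids v (M1 `|` M2).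
  move=> s sM; apply/negP => vs; move/eqP: fv; rewrite (flat s) //.
  by rewrite eq_sym oner_eq0.
have v1 : avoids v M1 by move=> s sM; apply: vU; rewrite inE sM.
have v2 : avoids v M2 by move=> s sM; apply: vU; rewrite inE sM orbT.
have v12 : avoids v (M1 `&` M2) by move=> s; rewrite inE => /andP[/v1].
have dC : (complex_dim (attach_cone v (M1 `|` M2) M2) <= 3)%N.
  apply: complex_dim_le; apply: attach_cone_card => //; last exact: fsubsetUr.
  by move=> s; rewrite inE => /orP[]; [case: T1|case: T2] => _ + _ _ _; apply.
have [q cq] := tree_like_collapsible T1.
exists (d + 1)%N, (M1 `|` M2), [fset [fset q]], lsubmx, (fun=> 0); split.
- by rewrite -MU; exact: height_triangulation.
- exact: point_triangulation.
apply: (@deforms_trans _ _ _ _ (attach_cone v (M1 `|` M2) M2)).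
  apply/deforms_sym/collapses_deforms => //.
  by apply: cone_collapses => //; exact: tree_like_collapsible.
apply: collapses_deforms => //; apply: collapses_trans (cone_sweep F1 F2 v1 v2) _.
apply: collapses_trans cq; apply: cone_collapses => //; last exact: tree_like_collapsible.
by case: T12.
Qed.

End Polyhedra.

(** * Acyclicity of contractible polyhedra *)

Section Topology.
Local Open Scope fset_scope.
Local Open Scope classical_set_scope.
Local Open Scope ring_scope.
Context {R : realType} {d : nat}.
Local Notation point := 'rV[R]_d.
Implicit Types (s t r : {fset point}) (K L : {fset {fset point}}).
Implicit Types (x y v : point) (f : 'cV[R]_d * R).

Lemma coord_norm x j : `|x 0 j| <= `|x|.
Proof.
rewrite /Num.norm /= mx_normrE.
exact: (le_bigmax _ (fun ij : 'I_1 * 'I_d => `|x ij.1 ij.2|) (0, j)).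
Qed.

Lemma norm_lt_coord x (e : R) : 0 < e -> (forall j, `|x 0 j| < e) -> `|x| < e.
Proof.
move=> e0 xe; rewrite /Num.norm /= mx_normrE; apply/bigmax_ltP; split=> // -[i j] _ /=.
by rewrite ord1.
Qed.

Lemma affine_form_lipschitz f x y :
  `|affine_form f y - affine_form f x| <= `|x - y| * \sum_j `|f.1 j 0|.
Proof.
have -> : affine_form f y - affine_form f x = ((y - x) *m f.1) 0 0.
  by rewrite /affine_form mulmxBl !mxE; ring.
rewrite mxE mulr_sumr (le_trans (ler_norm_sum _ _ _)) // ler_sum // => j _.
by rewrite normrM ler_wpM2r // distrC coord_norm.
Qed.

Lemma hull_avoid s x : affinely_independent s -> ~ hull s x ->
  exists2 e, 0 < e & forall y, `|x - y| < e -> ~ hull s y.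
Proof.
move=> si; have [F FP] := hull_halfspaces si.
move/FP/negP/allPn => [f fF]; rewrite -ltNge => fx.
pose D := 1 + \sum_j `|f.1 j 0|.
have D0 : 0 < D by rewrite ltr_pwDl // sumr_ge0.
exists (- affine_form f x / D); first by rewrite divr_gt0 ?oppr_gt0.
move=> y; rewrite ltr_pdivlMr // => xy /FP/allP/(_ f fF) fy.
have := affine_form_lipschitz f x y; have : 0 <= `|x - y| by [].
rewrite /D in xy; have := ler_norm (affine_form f y - affine_form f x); nra.
Qed.

Lemma hulls_avoid (T : seq {fset point}) x : (forall s, s \in T -> affinely_independent s) ->
  (forall s, s \in T -> ~ hull s x) ->
  exists2 e, 0 < e & forall y, `|x - y| < e -> forall s, s \in T -> ~ hull s y.
Proof.
move=> Ti Tx.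
have [|e e0 eP] := @small_uniform R _ (fun s e => forall y, `|x - y| < e -> ~ hull s y) T.
  move=> s sT; have [e e0 eP] := hull_avoid (Ti s sT) (Tx s sT).
  exists e => // e' /andP[_ e'e] y xy; apply: eP; exact: lt_le_trans e'e.
by exists e => // y xy s sT; apply: (eP e) => //; rewrite e0 lexx.
Qed.

Lemma hull_norm s x : hull s x -> `|x| <= \sum_(v <- s) `|v|.
Proof.
move=> /hullP[w wx]; have [w0 _ _ <-] := wx.
rewrite (le_trans (ler_norm_sum _ _ _)) // ler_sum // => v _.
by rewrite normrZ ger0_norm // ler_piMl // (barycentric_le1 _ wx).
Qed.

Lemma space_bounded K : exists2 M, 0 < M & forall x, space K x -> `|x| <= M.
Proof.
exists (1 + \sum_(s <- K) \sum_(v <- s) `|v|).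
  by rewrite ltr_pwDl // sumr_ge0 // => s _; rewrite sumr_ge0.
move=> x [s sK /hull_norm xs]; rewrite (le_trans xs) //.
rewrite (big_fsetD1 s) //= addrCA lerDl addr_ge0 // sumr_ge0 // => t _.
by rewrite sumr_ge0.
Qed.

Lemma space_compact K : simplicial_complex K -> compact (space K).
Proof.
move=> [_ _ Ki _]; apply: bounded_closed_compact.
  have [M M0 KM] := space_bounded K.
  by exists M; split; [exact: num_real|move=> N MN x /KM /le_trans; apply; exact: ltW].
move=> x Kx; apply: contrapT => nKx.
have [|e e0 eP] := hulls_avoid Ki (x := x).
  by move=> s sK sx; apply: nKx; exists s.
have [y [[s sK sy]]] := Kx _ (nbhsx_ballx x e e0).
by rewrite -ball_normE /= => /eP/(_ s sK).
Qed.

(* A Lebesgue number for the cover of the space by open stars of vertices. *)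
Lemma star_lebesgue K : simplicial_complex K -> exists2 e, 0 < e &
  exists phi : point -> point, forall x, space K x ->
    forall y, `|x - y| < e -> forall r, r \in K -> hull r y -> phi x \in r.
Proof.
move=> cK; have [_ _ Ki _] := cK; have [_ UK] := (simplicial_complexP K).1 cK.
pose Q (e : R) x := exists v, forall y, `|x - y| < e -> forall r, r \in K -> hull r y -> v \in r.
have : \forall e \near 0^'+, space K `<=` Q e.
  have /compact_near_coveringP := space_compact cK; apply=> x [s sK /hullP[w wx]].
  have [v vs wv] := barycentric_neq0 wx.
  (* The simplices of K without v do not contain x, because v has positive weight there; hence they
     all miss a ball around x. Half of its radius is reserved for moving x. *)
  have [||e e0 eP] := @hulls_avoid [seq r <- K | v \notin r] x.
  - by move=> r; rewrite mem_filter => /andP[_ /Ki].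
  - move=> r; rewrite mem_filter => /andP[vr rK] /hullP[w' w'x].
    move/negP: vr; apply; apply: (barycentric_support w'x).
    by rewrite (UK _ _ _ _ _ rK sK w'x wx) gt_eqF.
  exists (ball x (e / 2), [set e' | 0 < e' < e / 2]) => /=.
    split; first by apply: nbhsx_ballx; rewrite divr_gt0.
    near=> e'; apply/andP; split; near: e'; first exact: nbhs_right_gt.
    by apply: nbhs_right_lt; rewrite divr_gt0.
  move=> [x' e'] /= [xx' /andP[e'0 e'e]]; exists v => y x'y r rK ry.
  apply: contrapT => /negP vr; have xy : `|x - y| < e.
    move: xx'; rewrite -ball_normE /= => xx'.
    rewrite [e]splitr (le_lt_trans (ler_distD x' _ _)) // ltrD //.
    exact: lt_trans e'e.
  by apply: (eP y xy r) => //; rewrite mem_filter vr.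
move=> H; near (0 : R)^'+ => e.
have eQ : space K `<=` Q e by near: e.
have e0 : 0 < e by near: e; exact: nbhs_right_gt.
exists e => //.
have /choice[phi phiP] : forall x, exists v, space K x ->
    forall y, `|x - y| < e -> forall r, r \in K -> hull r y -> v \in r.
  by move=> x; have [/eQ[v vP]|] := pselect (space K x); [exists v|exists x].
by exists phi.
Unshelve. all: by end_near. Qed.

(** Heine-Cantor on the compact product, with the bounds in space and in time stated separately. *)
Lemma homotopy_uniform K (H : point * R -> point) : simplicial_complex K ->
  {within space K `*` `[0, 1], continuous H} -> forall e : R, 0 < e ->
  exists2 a : R, 0 < a & forall x y (t u : R), space K x -> space K y ->
    0 <= t <= 1 -> 0 <= u <= 1 -> `|x - y| < a -> `|t - u| < a ->
    `|H (x, t) - H (y, u)| < e.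
Proof.
move=> cK /subspace_continuousP cH e e0.
pose D : set (point * R) := space K `*` `[0, 1].
pose Q (a : R) (z : point * R) := forall z', D z' -> `|z.1 - z'.1| < a ->
  `|z.2 - z'.2| < a -> `|H z - H z'| < e.
have cD : compact D by apply: compact_setX; [exact: space_compact|exact: segment_compact].
have : \forall a \near 0^'+, D `<=` Q a.
  move: cD => /compact_near_coveringP /near_covering_withinP; apply=> z Dz.
  have e20 : 0 < e / 2 by rewrite divr_gt0.
  have /nbhs_ballP [a /= a0 aP] : nbhs z [set z' | D z' -> `|H z - H z'| < e / 2].
    have W : nbhs z [set z' | D z' -> ball (H z) (e / 2) (H z')].
      exact: (cH z Dz _ (nbhsx_ballx _ _ e20)).
    by apply: filterS W => z' /= + Dz' => /(_ Dz'); rewrite -ball_normE.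
  have a20 : 0 < a / 2 by rewrite divr_gt0.
  exists (ball z (a / 2), [set a' | 0 < a' < a / 2]) => /=.
    split; first exact: nbhsx_ballx.
    near=> a'; apply/andP; split; near: a'; first exact: nbhs_right_gt.
    exact: nbhs_right_lt.
  move=> [z' a'] /= [zz' /andP[a'0 a'a]] Dz' z'' Dz'' d1 d2.
  have [zz1 zz2] : `|z.1 - z'.1| < a / 2 /\ `|z.2 - z'.2| < a / 2.
    by move: zz' => [/=]; rewrite -!ball_normE.
  have Hz' : `|H z - H z'| < e / 2.
    apply: aP Dz'; split; rewrite /= -ball_normE /=; [move: zz1|move: zz2] => /lt_trans; apply;
      by rewrite ltr_pdivrMr // ltr_pMr // ltr1n.
  have Hz'' : `|H z - H z''| < e / 2.
    apply: aP Dz''; split; rewrite /= -ball_normE /=.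
      rewrite [a]splitr (le_lt_trans (ler_distD z'.1 _ _)) // ltrD //.
      exact: lt_trans a'a.
    rewrite [a]splitr (le_lt_trans (ler_distD z'.2 _ _)) // ltrD //.
    exact: lt_trans a'a.
  rewrite [e]splitr (le_lt_trans (ler_distD (H z) _ _)) // ltrD //.
  by rewrite distrC.
move=> N; near (0 : R)^'+ => a.
have aQ : D `<=` Q a by near: a.
have a0 : 0 < a by near: a; exact: nbhs_right_gt.
exists a => // x y t u Kx Ky t01 u01 xy tu.
by apply: (aQ (x, t)) => //; split=> //=; rewrite in_itv.
Unshelve. all: by end_near. Qed.

(** The complex is cut along the coordinate hyperplanes of a grid of step e / 2 over a cube
    containing it. No simplex straddles a hyperplane, so each coordinate varies by less than two
    steps on its vertices; the norm is the maximum norm. *)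
Lemma fine_subdivision K (e : R) : simplicial_complex K -> 0 < e ->
  exists2 L, stellar_subdivision K L &
    forall s x y, s \in L -> x \in s -> y \in s -> `|x - y| < e.
Proof.
move=> cK e0; have [M M0 KM] := space_bounded K.
pose a := e / 2; have a0 : 0 < a by rewrite divr_gt0.
pose N := (Num.truncn (2 * M / a)).+1.
pose grid (jk : 'I_d * nat) : 'cV[R]_d * R := (delta_mx jk.1 0, M - jk.2%:R * a).
have gridE jk x : affine_form (grid jk) x = x 0 jk.1 + M - jk.2%:R * a.
  rewrite /affine_form /= mxE (bigD1 jk.1) //= mxE !eqxx mulr1 big1 ?addr0 ?addrA //.
  by move=> i ij; rewrite mxE (negPf ij) mulr0.
have [L KL cL] := stellar_cuts [seq grid (j, k) | j <- enum 'I_d, k <- iota 0 N.+1] cK.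
exists L => //.
have LK := refines_space (stellar_refines KL cK).
have bound s x j : s \in L -> x \in s -> `|x 0 j| <= M.
  move=> sL xs; apply: le_trans (coord_norm x j) _; apply: KM; rewrite -LK.
  by exists s => //; exact: hull_vertex.
have key s x y j : s \in L -> x \in s -> y \in s -> y 0 j < x 0 j + e.
  move=> sL xs ys; rewrite ltNge; apply/negP => xy.
  have /ler_normlP[xM _] := bound s x j sL xs; have /ler_normlP[_ yM] := bound s y j sL ys.
  have x0 : 0 <= (x 0 j + M) / a by apply: divr_ge0; [lra|exact: ltW].
  (* The hyperplane of index k + 1 is the first one above x. As e equals two steps, y would lie
     strictly beyond it; the index stays in the grid because the coordinates are bounded by M. *)
  have /andP[k1 k2] := truncn_itv x0; set k := Num.truncn _ in k1 k2.
  have ka : k%:R * a <= x 0 j + M by rewrite -ler_pdivlMr.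
  have ka' : x 0 j + M < k.+1%:R * a by rewrite -ltr_pdivrMr.
  have kN : (k.+1 <= N)%N.
    rewrite /N ltnS truncn_ge_nat; last by rewrite divr_ge0 ?mulr_ge0 // ltW.
    by rewrite ler_pdivlMr //; nra.
  have k1a : k.+1%:R * a = k%:R * a + a by rewrite -natr1 mulrDl mul1r.
  have ea : e = a + a by rewrite -splitr.
  apply: (cL (grid (j, k.+1)) _ s x y sL xs ys); rewrite ?gridE.
  - by apply: (allpairs_f (fun j k => grid (j, k))); rewrite ?mem_enum ?mem_iota.
  - by rewrite subr_lt0.
  - by rewrite /= subr_gt0 k1a; lra.
move=> s x y sL xs ys; apply: norm_lt_coord => // j; rewrite !mxE ltr_norml.
by have := key s x y j sL xs ys; have := key s y x j sL ys xs; lra.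
Qed.

End Topology.

Definition contiguous (V W : choiceType) (L : {fset {fset V}}) (K : {fset {fset W}})
    (f g : V -> W) : Prop :=
  forall s, s \in L -> exists2 r, r \in K & forall x, x \in s -> f x \in r /\ g x \in r.

Section Contiguity.
Local Open Scope fset_scope.
Local Open Scope classical_set_scope.
Local Open Scope ring_scope.
Context {V W : choiceType} (L : {fset {fset V}}) (K : {fset {fset W}}).
Implicit Types (f g : V -> W).

(** The values [c (f x) (g x)] along the track of x are the chain homotopy between the two
    pullbacks. *)
Lemma contiguous_cobounds1 f g c : contiguous L K f g -> cocycle1 K c ->
  (exists h, cobounds1 L (fun x y => c (f x) (f y)) h) ->
  exists h, cobounds1 L (fun x y => c (g x) (g y)) h.
Proof.
move=> fg cc [h hL]; exists (fun x => h x (+) c (f x) (g x)) => s x y sL xs ys.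
have [r rK sr] := fg s sL; have [fx gx] := sr x xs; have [fy gy] := sr y ys.
have := hL s x y sL xs ys; have := cc r (f x) (f y) (g y) rK fx fy gy.
have := cc r (f x) (g x) (g y) rK fx gx gy.
by case: (c (f x) (f y)) (c (f x) (g x)) (c (f x) (g y)) (c (f y) (g y)) (c (g x) (g y))
  (h x) (h y) => [] [] [] [] [] [] [].
Qed.

(* The prism operator of a homotopy between contiguous simplicial maps. *)
Lemma contiguous_cobounds2 f g b : contiguous L K f g -> cocycle2 K b ->
  (exists a, cobounds2 L (fun x y z => b (f x) (f y) (f z)) a) ->
  exists a, cobounds2 L (fun x y z => b (g x) (g y) (g z)) a.
Proof.
move=> fg bc [a aL].
exists (fun x y => a x y (+) (b (f x) (g x) (g y) (+) b (f x) (f y) (g y))).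
move=> s x y z sL xs ys zs.
have [r rK sr] := fg s sL.
have [[fx gx] [fy gy] [fz gz]] := And3 (sr x xs) (sr y ys) (sr z zs).
have solve p q1 q2 q3 : p (+) q1 (+) q2 (+) q3 = false -> p = q1 (+) q2 (+) q3.
  by case: p q1 q2 q3 => [] [] [] [].
rewrite (solve _ _ _ _ (bc r (f x) (g x) (g y) (g z) rK fx gx gy gz)).
have := bc r (f x) (f y) (g y) (g z) rK fx fy gy gz; rewrite [_ (+) b _ (g y) (g z)]addbC.
move=> /solve ->; have := bc r (f x) (f y) (f z) (g z) rK fx fy fz gz.
rewrite (aL s x y z sL xs ys zs) => E.
have {E}-> : b (f x) (f y) (g z) =
    b (f y) (f z) (g z) (+) b (f x) (f z) (g z) (+) (a x y (+) a y z (+) a x z).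
  move: E; case: (b (f y) (f z) (g z)) (b (f x) (f z) (g z)) (b (f x) (f y) (g z))
    (a x y) (a y z) (a x z) => [] [] [] [] [] [] //.
by case: (b (f y) (f z) (g z)) (b (f x) (f z) (g z)) (b (f y) (g y) (g z))
  (b (f x) (f y) (g y)) (b (f x) (g x) (g z)) (b (f x) (g x) (g y)) (a x y) (a y z)
  (a x z) => [] [] [] [] [] [] [] [] [].
Qed.

End Contiguity.

Section Contractible.
Local Open Scope fset_scope.
Local Open Scope classical_set_scope.
Local Open Scope ring_scope.
Context {R : realType} {d : nat}.
Implicit Types (K L : {fset {fset 'rV[R]_d}}).

(* Approximate the homotopy at finitely many times t_i by the maps phi (H (., t_i))
   into the vertices of K: on a fine subdivision consecutive ones are contiguous. *)
Lemma contractible_acyclic K : simplicial_complex K -> contractible (space K) ->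
  [/\ edge_connected K, H1_trivial K & H2_trivial K].
Proof.
move=> cK [x0 [H [Kx0 cH HK H0 H1]]].
have [FK _] := (simplicial_complexP K).1 cK.
have [e e0 [phi phiP]] := star_lebesgue cK.
have [a a0 aP] := homotopy_uniform cK cH e0.
have phiK r x : r \in K -> hull r x -> phi x \in r.
  move=> rK rx; apply: (phiP x _ x) => //; first by exists r.
  by rewrite subrr normr0.
have phi_vertex r v : r \in K -> v \in r -> phi v = v.
  move=> rK vr; have := phiK _ v (face_mem1 FK rK vr) (hull_vertex (fset11 v)).
  by rewrite inE => /eqP.
(* More than 1 / a time steps, so that consecutive times differ by less than a. *)
pose N := (Num.truncn a^-1).+1; pose t (i : nat) : R := i%:R / N%:R.
have N0 : 0 < N%:R :> R by rewrite ltr0n.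
have t01 i : (i <= N)%N -> 0 <= t i <= 1.
  by move=> iN; rewrite divr_ge0 ?ler0n //= ler_pdivrMr // mul1r ler_nat.
have tS i : `|t i - t i.+1| < a.
  rewrite /t -mulrBl -natr1 opprD addrA subrr sub0r mulN1r normrN ger0_norm ?invr_ge0 //.
  rewrite invf_plt ?posrE // /N.
  have a1 : 0 <= a^-1 by rewrite invr_ge0 ltW.
  by have /andP[] := truncn_itv a1.
have t0 : t 0%N = 0 by rewrite /t mul0r.
have tN : t N = 1 by rewrite /t divff // gt_eqF.
pose h i x := phi (H (x, t i)).
have spaceH i x : (i <= N)%N -> space K x -> space K (H (x, t i)).
  by move=> iN Kx; apply: HK => //; exact: t01.
(* Both images of y are within e of H (x, t i), so the Lebesgue property of phi puts their values
   into any simplex containing that point. *)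
have step i x y : (i < N)%N -> space K x -> space K y -> `|x - y| < a ->
    forall r, r \in K -> hull r (H (x, t i)) -> h i y \in r /\ h i.+1 y \in r.
  move=> iN Kx Ky xy r rK rx; have iN' := ltnW iN.
  have tii : `|t i - t i| < a by rewrite subrr normr0.
  split; apply: (phiP _ _ (H (x, t i))) => //; try exact: spaceH.
  - by apply: aP => //; rewrite ?t01 // distrC.
  - by apply: aP => //; rewrite ?t01 // distrC.
have hN x : space K x -> h N x = phi x0 by move=> Kx; rewrite /h tN H1.
have h0 x : space K x -> h 0%N x = phi x by move=> Kx; rewrite /h t0 H0.
have [L KL Lfine] := fine_subdivision cK a0.
have cL := stellar_simplicial KL cK.
have LK := stellar_refines KL cK; have LKs := refines_space LK.
have [FL _] := (simplicial_complexP L).1 cL.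
have LKx s x : s \in L -> x \in s -> space K x.
  by move=> sL xs; rewrite -LKs; exists s => //; exact: hull_vertex.
have contig i : (i < N)%N -> contiguous L K (h i.+1) (h i).
  move=> iN s sL; have [x xs] := face_neq0 FL sL.
  have [r rK rx] := spaceH i x (ltnW iN) (LKx s x sL xs); exists r => // y ys.
  by have [] := step i x y iN (LKx s x sL xs) (LKx s y sL ys) (Lfine s x y sL xs ys) r rK rx.
(* Induction from the constant map at time 1 back to phi at time 0. Invariance under equality on the
   vertices of L is required because the identities at both ends hold only on the space of K. *)
have Lphi (P : ('rV[R]_d -> 'rV[R]_d) -> Prop) :
    (forall f g, (forall s x, s \in L -> x \in s -> f x = g x) -> P f -> P g) ->
    P (fun=> phi x0) -> (forall f g, contiguous L K f g -> P f -> P g) -> P phi.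
  move=> Pext Pconst Pcont.
  suff Ph i : (i <= N)%N -> P (h (N - i)%N).
    apply: (Pext (h 0%N)); first by move=> s x sL /(LKx s x sL)/h0.
    by rewrite -(subnn N); exact: Ph.
  elim: i => [_|i IH iN].
    by rewrite subn0; apply: (Pext (fun=> phi x0)) => // s x sL /(LKx s x sL)/hN.
  apply: Pcont (IH (ltnW iN)).
  have : (N - i.+1 < N)%N by rewrite ltn_subrL.
  by move=> /contig; rewrite -subSn // subSS.
split.
- split; first by have [r rK _] := Kx0; exists r.
  move=> g gK r1 r2 x y r1K r2K xr1 yr2.
  (* For connectedness it is enough to follow the track of one point, without any subdivision. *)
  have gphi z : space K z -> g (phi z) = g (phi x0).
    move=> Kz; rewrite -h0 // -(hN z Kz).
    suff E i : (i <= N)%N -> g (h 0%N z) = g (h i z) by exact: E.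
    elim: i => // i IH iN; rewrite IH ?(ltnW iN) //.
    have [r rK rz] := spaceH i z (ltnW iN) Kz.
    have [|h1 h2] := step i z z iN Kz Kz _ r rK rz; first by rewrite subrr normr0.
    exact: gK h1 h2.
  rewrite -(phi_vertex r1 x r1K xr1) -(phi_vertex r2 y r2K yr2) !gphi //.
    by exists r2 => //; exact: hull_vertex.
  by exists r1 => //; exact: hull_vertex.
- move=> c cc.
  have [g gL] : exists g, cobounds1 L (fun x y => c (phi x) (phi y)) g.
    apply: (Lphi (fun f => exists g, cobounds1 L (fun x y => c (f x) (f y)) g)).
    + move=> f g fg [k kL]; exists k => s x y sL xs ys.
      by rewrite -!(fg s) //; exact: (kL s).
    + exists (fun=> false) => s x y _ _ _ /=; have [r rK rx0] := Kx0.
      have := phiK r x0 rK rx0 => p0.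
      by have := cc r _ _ _ rK p0 p0 p0; case: (c _ _).
    + by move=> f g fg; exact: (contiguous_cobounds1 fg cc).
  by exists g; exact: (refines_cobounds1 cL cK LK phiK cc gL).
(* The homotopy controls the pullback along phi, whereas injectivity on H^2 is known for psi. The
   two are contiguous, since both send a simplex of L into a simplex of K containing it. *)
- move=> b bc; have [psi [psiL psib]] := stellar_simplicial_map KL cK; apply: psib => //.
  apply: (@contiguous_cobounds2 _ _ L K phi psi b) => //.
    by move=> s /psiL[r rK sr]; exists r => // x /sr[rx psix]; split=> //; exact: phiK.
  apply: (Lphi (fun f => exists g, cobounds2 L (fun x y z => b (f x) (f y) (f z)) g)).
  + move=> f g fg [k kL]; exists k => s x y z sL xs ys zs.
    by rewrite -!(fg s) //; exact: (kL s).
  (* Mod 2, a constant 2-cochain is the coboundary of the 1-cochain with the same value, as a + a +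
     a = a. *)
  + exists (fun _ _ => b (phi x0) (phi x0) (phi x0)) => s x y z _ _ _ _ /=.
    by case: (b _ _ _).
  + by move=> f g fg; exact: (contiguous_cobounds2 fg bc).
Qed.

End Contractible.

Theorem mainTheorem3 (R : realType) (d : nat) (P : set 'rV[R]_d)
    (P_polyhedron : compact_polyhedron P) (P_dim : polyhedron_dim P 2)
    (P_contractible : contractible P)
    (P_cover : exists P1 P2 : set 'rV[R]_d,
       [/\ subpolyhedron P1 P, subpolyhedron P2 P,
           pl_collapsible P1, pl_collapsible P2 & P = P1 `|` P2]) :
  exists x : 'rV[R]_d, pl_deforms 3 P [set x].
Proof.
case: P_polyhedron P_cover => K0 cK0 K0P [P1 [P2 [_ _ c1 c2 PE]]].
rewrite -K0P in P_dim P_contractible.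
have K02 : at_most_2dim K0 := polyhedron_dim_card cK0 P_dim.
have [|K1 [K2 [cK KK0 K2d t1 t2]]] := tree_like_cover cK0 K02 _ c1 c2.
  by rewrite K0P.
rewrite -KK0 in P_contractible; have [con h1 h2] := contractible_acyclic cK P_contractible.
rewrite -K0P -KK0; apply: tree_like_union_deforms => //.
exact: tree_like_cap.
Qed.
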